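(* Let $V:\mathbb{R}^D\to\mathbb{R}$ be $2\pi$-periodic in each variable, and assume that its gradient $V'$ is a trigonometric polynomial of degree $J$. All notions (formal solution, irrational/Diophantine multiple of $2\pi$, norms) are as defined in the context. Three problems are considered: maximal dimensional tori with $\gamma\ne0$ (any $D$); lower dimensional tori with $\gamma\neq0$ ($D=2$, $L=1$); lower dimensional tori with $\gamma=0$ ($D=2$, $L=1$). **Maximal dimensional tori.** Let $D$ be arbitrary and assume $\gamma\neq 0$. (A) If $\omega\in\mathbb{R}^D$ is an irrational multiple of $2\pi$, then there exists a unique solution $u_\varepsilon=\sum_n\varepsilon^n u_n$, $\mu_\varepsilon=\sum_n\varepsilon^n\mu_n$ (with $u_n:\mathbb{T}^D\to\mathbb{R}^D$, $\mu_n\in\mathbb{R}^D$), in the sense of formal power series, of $$u(\theta+\omega)+u(\theta-\omega)-2u(\theta)=\varepsilon V'(\theta+u(\theta))+\mu-\gamma\varepsilon^3\big(u(\theta)-u(\theta-\omega)+\omega\big),\qquad \theta\in\mathbb{T}^D,$$ satisfying the normalization $\int_{\mathbb{T}^D}u(\theta)\,d\theta=0$ (equivalently, $\int_{\mathbb{T}^D}u_n\,d\theta=0$ for all $n$). Furthermore, each $u_n$ is a trigonometric polynomial of degree $nJ$. (B) If $\omega$ is a Diophantine multiple of $2\pi$, then for any $\rho\ge 1$, $r>D/2$, the formal solution in (A) is Gevrey under the norm $\|\cdot\|_{\rho,r}$: there exist $A,R,\sigma>0$ such that for all $n$ $$\|u_n\|_{\rho,r}\le A R^n(n!)^\sigma,\qquad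 |\mu_n|\le A R^n(n!)^\sigma .$$ **Lower dimensional tori.** Let $D=2$, $L=1$, and let either $\gamma\neq0$ or $\gamma=0$. Fix a nonzero integer vector $k\in\mathbb{Z}^2$ (giving the topology of the embedding of the torus) and a nonzero integer vector $k^\perp\in\mathbb{Z}^2$ orthogonal to $k$. Choose $\beta_0\in[0,2\pi)$ such that $$\int_0^{2\pi}k^\perp\cdot V'(\theta k+\beta_0k^\perp)\,d\theta=0$$ (there are always at least two choices of such $\beta_0$), and assume that this $\beta_0$ satisfies $$\int_0^{2\pi}k^\perp\cdot D^2V(\theta k+\beta_0k^\perp)\,k^\perp\,d\theta\neq 0 .$$ (A) If $\omega\in\mathbb{R}$ is an irrational multiple of $2\pi$, then there exists a unique solution $g_\varepsilon=\sum_n\varepsilon^ng_n$, $\mu_\varepsilon=\sum_n\varepsilon^n\mu_n$ (with $g_n:\mathbb{T}\to\mathbb{R}^2$, $\mu_n\in\mathbb{R}^2$, and zeroth order term $g_0\equiv\beta_0k^\perp$ given by the chosen $\beta_0$), in the sense of formal power series, of $$g(\theta+\omega)-2g(\theta)+g(\theta-\omega)=\varepsilon V'(\theta k+g(\theta))+\mu-\gamma\varepsilon^3\big(k\omega+g(\theta)-g(\theta-\omega)\big),\qquad\theta\in\mathbb{T},$$ satisfying the normalization $\int_0^{2\pi}g(\theta)\cdot k\,d\theta=0$ (equivalently, $\int_0^{2\pi}g_n\cdot k\,d\theta=0$ for all $n$). Furthermore, each $g_n$ is a trigonometric polynomial of degree $nJ$. (B) If $\omega$ is a Diophantine multiple of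 $2\pi$, then for any $\rho\ge1$, $r>1/2$, the formal solution in (A) is Gevrey under the norm $\|\cdot\|_{\rho,r}$: there exist $A,R,\sigma>0$ such that for all $n$ $$\|g_n\|_{\rho,r}\le AR^n(n!)^\sigma,\qquad|\mu_n|\le AR^n(n!)^\sigma .$$
   Context: **Conventions.** $\mathbb{T}^L$ is $\mathbb{R}^L/2\pi\mathbb{Z}^L$; functions on it are functions on $\mathbb{R}^L$ that are $2\pi$-periodic in each variable. For $\ell\in\mathbb{Z}^L$, $|\ell|=\sum_j|\ell_j|$. $V'$ denotes the gradient of $V$ and $D^2V$ its Hessian; $\gamma\in\mathbb{R}$ is a parameter. A trigonometric polynomial of degree $J$ is a function of the form $\sum_{|\ell|\le J}\alpha_\ell e^{i\ell\cdot\theta}$ (so ''degree $J$'' means degree at most $J$); thus $V'(\theta)=\sum_{|\ell|\le J,\ \ell\in\mathbb{Z}^D}\alpha_\ell e^{i\ell\cdot\theta}$ with $\alpha_\ell\in\mathbb{C}^D$, $\alpha_0=0$, $\alpha_{-\ell}=\overline{\alpha_\ell}$. **Frequencies.** $\omega\in\mathbb{R}^L$ is an irrational multiple of $2\pi$ if $\ell\cdot\omega\notin2\pi\mathbb{Z}$ for all $\ell\in\mathbb{Z}^L\setminus\{0\}$. A vector $\tilde\omega\in\mathbb{R}^L$ is Diophantine of type $(\nu,\tau)$, $\nu,\tau>0$, if $|m\cdot\tilde\omega-n|^{-1}\le\nu|m|^\tau$ for all $n\in\mathbb{Z}$, $m\in\mathbb{Z}^L\setminus\{0\}$. $\omega$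 is a Diophantine multiple of $2\pi$ if $\omega=2\pi\tilde\omega$ with $\tilde\omega$ Diophantine of some type $(\nu,\tau)$. For maximal dimensional tori $L=D$. **Norms.** For $\rho\ge0$, $r\in\mathbb{Z}_+$ and $u(\theta)=\sum_{\ell\in\mathbb{Z}^L}\hat u_\ell e^{i\ell\cdot\theta}$ with values in $\mathbb{C}^D$, $$\|u\|_{\rho,r}^2=|\hat u_0|^2+\sum_{\ell\ne0}|\hat u_\ell|^2e^{2|\ell|\rho}(1+|\ell|^2)^r .$$ **Formal solutions.** Define $$\mathcal{E}^{\omega}_\varepsilon[u,\mu](\theta)=u(\theta+\omega)+u(\theta-\omega)-2u(\theta)-\varepsilon V'(\theta+u(\theta))-\mu+\gamma\varepsilon^3\big(u(\theta)-u(\theta-\omega)+\omega\big),$$ $$\mathcal{E}^{\omega,k}_\varepsilon[g,\mu](\theta)=g(\theta+\omega)+g(\theta-\omega)-2g(\theta)-\varepsilon V'(\theta k+g(\theta))-\mu+\gamma\varepsilon^3\big(g(\theta)-g(\theta-\omega)+\omega k\big).$$ The two equations in the claim are $\mathcal{E}^{\omega}_\varepsilon[u,\mu]=0$ and $\mathcal{E}^{\omega,k}_\varepsilon[g,\mu]=0$. Fix a norm $\|\cdot\|$ in the space of periodic functions (here one of the norms $\|\cdot\|_{\rho,r}$). The series $\sum_n\varepsilon^nu_n$, $\sum_n\varepsilon^n\mu_n$ are a solution of $\mathcal{E}^\omega_\varepsilon[u,\mu]=0$ in the sense of formal power series if for every $N\in\mathbb{N}$ there is $C_N>0$ such that, for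 small $\varepsilon$, $$\Big\|\mathcal{E}^{\omega}_\varepsilon\Big[\sum_{n=0}^N\varepsilon^nu_n,\sum_{n=0}^N\varepsilon^n\mu_n\Big]\Big\|\le C_N|\varepsilon|^{N+1};$$ similarly for $\sum_n\varepsilon^ng_n$, $\sum_n\varepsilon^n\mu_n$ with $\mathcal{E}^{\omega,k}_\varepsilon$ in place of $\mathcal{E}^\omega_\varepsilon$.
   Formalization: For lower dimensional tori, each μ_n is required to be orthogonal to k^⊥ (with μ_n free in R² uniqueness fails), and g_n is of degree nJ in the ambient angles: its frequencies are ℓ·k with |ℓ|≤nJ (the literal degree nJ fails e.g. for k=(2,0)). *)

(* Defs.v *)
(* Points of R^n are row vectors 'rV[R]_n; integer vectors are 'rV[int]_n. *)
From HB Require Import structures.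
From mathcomp Require Import all_boot all_order all_algebra.
From mathcomp Require Import all_classical all_reals all_analysis.
From mathcomp Require Import complex.

Set Implicit Arguments.
Unset Strict Implicit.
Unset Printing Implicit Defensive.

Import Order.TTheory GRing.Theory Num.Theory.
Import numFieldNormedType.Exports.

Local Open Scope classical_set_scope.
Local Open Scope ring_scope.
Local Open Scope complex_scope.

Definition intv (R : realType) (n : nat) (l : 'rV[int]_n) : 'rV[R]_n :=
  map_mx intr l.
Arguments intv R {n} l.

Definition dot (R : realType) (n : nat) (x y : 'rV[R]_n) : R :=
  \sum_j x 0 j * y 0 j.

(* The norm of 'rV[R]_n provided by the library is the sup norm. *)
Definition enorm (R : realType) (n : nat) (x : 'rV[R]_n) : R :=
  Num.sqrt (dot x x).

Definition l1norm (n : nat) (l : 'rV[int]_n) : nat := (\sum_j absz (l ord0 j))%N.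

Definition torus_periodic (R : realType) (n : nat) (T : Type)
    (f : 'rV[R]_n -> T) : Prop :=
  forall (j : 'I_n) (x : 'rV[R]_n), f (x + (2 * pi) *: delta_mx 0 j) = f x.

Definition grad (R : realType) (n : nat) (V : 'rV[R]_n -> R) (x : 'rV[R]_n) :
    'rV[R]_n :=
  \row_j 'D_(delta_mx 0 j) V x.

Definition hessian (R : realType) (n : nat) (V : 'rV[R]_n -> R)
    (x : 'rV[R]_n) : 'M[R]_n :=
  \matrix_(i, j) 'D_(delta_mx 0 j) (fun y => grad V y 0 i) x.

Definition expi (R : realType) (t : R) : R[i] := cos t +i* sin t.

(* Degree J means degree at most J. *)
Definition trig_poly (R : realType) (L p : nat) (J : nat)
    (f : 'rV[R]_L -> 'rV[R]_p) : Prop :=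
  exists a : 'rV[int]_L -> 'rV[R[i]]_p, forall theta : 'rV[R]_L,
    map_mx (fun x : R => x%:C) (f theta) =
    \sum_(l \in [set l : 'rV[int]_L | (l1norm l <= J)%N])
      expi (dot (intv R l) theta) *: a l.

(* Integral over the torus (R / 2 pi Z)^L, as an iterated Lebesgue integral
   over [0, 2 pi]^L; it is only applied to continuous functions. *)
Fixpoint torus_int (R : realType) (L : nat) : ('rV[R]_L -> R) -> R :=
  match L with
  | 0 => fun f => f 0
  | L'.+1 => fun f =>
      \int[@lebesgue_measure R]_(x in `[0, 2 * pi])
        torus_int (fun theta : 'rV[R]_L' =>
                     f (row_mx (x%:M : 'rV[R]_1) theta : 'rV[R]_(1 + L')))
  end.

Definition fourier (R : realType) (L : nat) (f : 'rV[R]_L -> R)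
    (l : 'rV[int]_L) : R[i] :=
  (((2 * pi) ^- L)%:C : R[i]) *
  (torus_int (fun theta => f theta * cos (dot (intv R l) theta)) +i*
   - torus_int (fun theta => f theta * sin (dot (intv R l) theta))).

(* |\hat u_l|^2, for the Euclidean norm of C^p. *)
Definition fourier_sqr (R : realType) (L p : nat) (u : 'rV[R]_L -> 'rV[R]_p)
    (l : 'rV[int]_L) : R :=
  \sum_j ComplexField.Normc.normc (fourier (fun theta => u theta 0 j) l) ^+ 2.

(* The norm || . ||_{rho,r}, with value +oo when the series diverges. *)
Definition rho_r_norm (R : realType) (rho : R) (r : nat) (L p : nat)
    (u : 'rV[R]_L -> 'rV[R]_p) : \bar R :=
  sqrte ((fourier_sqr u 0)%:E +
         \esum_(l in [set l : 'rV[int]_L | l != 0%R])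
           (fourier_sqr u l * expR (2 * (l1norm l)%:R * rho) *
            (1 + (l1norm l)%:R ^+ 2) ^+ r)%:E)%E.

Definition irrational_multiple (R : realType) (L : nat) (omega : 'rV[R]_L) :
    Prop :=
  forall (l : 'rV[int]_L) (m : int), l != 0 ->
    dot (intv R l) omega != 2 * pi * m%:~R.

(* The first conjunct is needed because 0^-1 = 0 in the library. *)
Definition diophantine (R : realType) (L : nat) (nu tau : R)
    (omega : 'rV[R]_L) : Prop :=
  forall (m : 'rV[int]_L) (n : int), m != 0 ->
    dot (intv R m) omega - n%:~R != 0 /\
    `|dot (intv R m) omega - n%:~R|^-1 <= nu * (l1norm m)%:R `^ tau.

Definition diophantine_multiple (R : realType) (L : nat)
    (omega : 'rV[R]_L) : Prop :=
  exists (omega' : 'rV[R]_L) (nu tau : R),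
    [/\ omega = (2 * pi) *: omega', 0 < nu, 0 < tau &
        diophantine nu tau omega'].

Definition residual_max (R : realType) (D : nat) (V : 'rV[R]_D -> R)
    (gamma : R) (omega : 'rV[R]_D) (eps : R)
    (u : 'rV[R]_D -> 'rV[R]_D) (mu : 'rV[R]_D) (theta : 'rV[R]_D) :
    'rV[R]_D :=
  u (theta + omega) + u (theta - omega) - 2 *: u theta
  - eps *: grad V (theta + u theta) - mu
  + (gamma * eps ^+ 3) *: (u theta - u (theta - omega) + omega).

(* 'rV[R]_1 plays the role of R, and theta 0 0, omega 0 0 are the scalars. *)
Definition residual_low (R : realType) (D : nat) (V : 'rV[R]_D -> R)
    (gamma : R) (omega : 'rV[R]_1) (k : 'rV[R]_D) (eps : R)
    (g : 'rV[R]_1 -> 'rV[R]_D) (mu : 'rV[R]_D) (theta : 'rV[R]_1) :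
    'rV[R]_D :=
  g (theta + omega) + g (theta - omega) - 2 *: g theta
  - eps *: grad V (theta 0 0 *: k + g theta) - mu
  + (gamma * eps ^+ 3) *: (g theta - g (theta - omega) + omega 0 0 *: k).

(* The formal series \sum_n eps^n u_n and \sum_n eps^n mu_n. *)
Definition series_pair (R : realType) (L p : nat) : Type :=
  ((nat -> 'rV[R]_L -> 'rV[R]_p) * (nat -> 'rV[R]_p))%type.

(* Functions on the torus are continuous and 2 pi-periodic. *)
Definition formal_solution (R : realType) (L p : nat) (rho : R) (r : nat)
    (E : R -> ('rV[R]_L -> 'rV[R]_p) -> 'rV[R]_p -> 'rV[R]_L -> 'rV[R]_p)
    (s : series_pair R L p) : Prop :=
  (forall n, continuous (s.1 n) /\ torus_periodic (s.1 n)) /\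
  (forall N : nat, exists2 C : R, 0 < C &
     \forall eps \near (0 : R),
       let u theta := \sum_(n < N.+1) eps ^+ n *: s.1 n theta in
       let mu := \sum_(n < N.+1) eps ^+ n *: s.2 n in
       (rho_r_norm rho r (E eps u mu) <= (C * `|eps| ^+ N.+1)%:E)%E).

Definition max_solution (R : realType) (D : nat) (V : 'rV[R]_D -> R)
    (gamma : R) (omega : 'rV[R]_D) (rho : R) (r : nat)
    (s : series_pair R D D) : Prop :=
  formal_solution rho r (residual_max V gamma omega) s /\
  (forall (n : nat) (j : 'I_D), torus_int (fun theta => s.1 n theta 0 j) = 0).

(* The drift mu is a multiple of k: the component of the equation along k^\perp
   is solved by adjusting the average of g along k^\perp, starting from beta0.
   Without this constraint those averages would be free (any choice could be
   compensated by mu) and the solution would not be unique. *)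
Definition low_solution (R : realType) (V : 'rV[R]_2 -> R) (gamma : R)
    (omega : 'rV[R]_1) (k kperp : 'rV[R]_2) (beta0 : R) (rho : R) (r : nat)
    (s : series_pair R 1 2) : Prop :=
  [/\ formal_solution rho r (residual_low V gamma omega k) s,
      forall theta, s.1 0%N theta = beta0 *: kperp,
      forall n, torus_int (fun theta => dot (s.1 n theta) k) = 0 &
      forall n, dot (s.2 n) kperp = 0].

Definition gevrey (R : realType) (L p : nat) (rho : R) (r : nat)
    (s : series_pair R L p) : Prop :=
  exists A B sigma : R, [/\ 0 < A, 0 < B, 0 < sigma &
    forall n : nat,
      (rho_r_norm rho r (s.1 n) <= (A * B ^+ n * n`!%:R `^ sigma)%:E)%E /\
      enorm (s.2 n) <= A * B ^+ n * n`!%:R `^ sigma].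

Definition beta_condition (R : realType) (V : 'rV[R]_2 -> R)
    (k kperp : 'rV[R]_2) (beta : R) : Prop :=
  \int[@lebesgue_measure R]_(t in `[0, 2 * pi])
    dot kperp (grad V (t *: k + beta *: kperp)) = 0.

Definition beta_nondegenerate (R : realType) (V : 'rV[R]_2 -> R)
    (k kperp : 'rV[R]_2) (beta : R) : Prop :=
  \int[@lebesgue_measure R]_(t in `[0, 2 * pi])
    (kperp *m hessian V (t *: k + beta *: kperp) *m kperp^T) 0 0 != 0.

(* For an embedding theta |-> theta k the degree of g is counted in the angles
   of the ambient torus: g is the restriction to theta k of a trigonometric
   polynomial of degree J on R^D, i.e. its frequencies are l . k with |l| <= J.
   If all entries of k are in {-1, 0, 1} and k is nonzero, these are exactly
   the integers of absolute value at most J. *)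
Definition trig_poly_along (R : realType) (D p : nat) (k : 'rV[R]_D) (J : nat)
    (g : 'rV[R]_1 -> 'rV[R]_p) : Prop :=
  exists2 G : 'rV[R]_D -> 'rV[R]_p, trig_poly J G &
    forall theta : 'rV[R]_1, g theta = G (theta 0 0 *: k).

(* Main.v *)
Require Import Defs.
From HB Require Import structures.
From mathcomp Require Import all_boot all_order all_algebra.
From mathcomp Require Import all_classical all_reals all_analysis.
From mathcomp Require Import complex.
From mathcomp Require Import ring lra zify.

Set Implicit Arguments.
Unset Strict Implicit.
Unset Printing Implicit Defensive.

Import Order.TTheory GRing.Theory Num.Theory.
Import numFieldNormedType.Exports.

Local Open Scope classical_set_scope.
Local Open Scope ring_scope.

(** Both problems are instances of one difference equation on the L-torus. An
    integer matrix K embeds theta as theta K in R^D (K is the identity for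
    maximal tori and the row k for lower dimensional ones), and the averages
    of the unknown g are required to lie on a line R kp (kp = 0, respectively
    kp = k^perp). Put Delta g = g(. + omega) + g(. - omega) - 2 g. The
    coefficient of e^n in the equation is Delta g_n = S_n + mu_n, where S_n
    depends on g_0, ..., g_(n-1) only: it is a Taylor coefficient of
    grad V (theta K + g), minus gamma times a first difference of the lift
    theta K + g at order n - 3.

    Existence ([formal_expansion]). On the exponential of frequency m the
    operator Delta is multiplication by 2 cos (m . omega) - 2, which for
    irrational omega vanishes only at m = 0. Hence mu_n is minus the average of
    S_n, and g_n is determined up to its average a kp. As mu_n is orthogonal to
    kp, the average of S_n must be orthogonal to kp too. For n >= 1 the average
    of g_n enters S_(n+1) linearly, with the averaged Hessian form along kp as
    coefficient; this coefficient is nonzero, so the condition at order n + 1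
    fixes a. At order 1 the condition is the equation that defines beta. For
    the maximal tori kp = 0 and there is no condition. A product of an
    exponential of degree J with terms g_k whose indices add up to n - 1 has
    degree n J, and dividing coefficients keeps the degree.

    Residual ([resid_bound]). All estimates are made in the algebra of
    absolutely convergent Fourier series weighted by exp (kap |m|), whose norm
    dominates the norm with parameters rho and r once kap = rho + r
    ([wien_rho_r_norm]). There the remainder of the exponential series is
    of the order of e^(N+1).

    Uniqueness ([expansion_unique]). Any formal solution is compared with the
    one constructed. Each Fourier coefficient of the residual is O(e^(N+1)), so
    the leading coefficient of the difference of two residuals vanishes
    ([leading_zero]). At the first order n where the two solutions differ this
    gives Delta (u_n - g_n) = const, so the difference is a constant a kp
    because a continuous periodic function is determined by its Fourier
    coefficients ([cfourier_inj]); order n + 1 and the nondegenerate Hessian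
    then give a kp = 0.

    Gevrey bounds ([expansion_gevrey]). For a Diophantine omega the divisors met
    at order n are at least of the order of n^(-s). The weights
    (n!)^s B^n / (n+1)^2 are stable under convolution up to a factor 8, and
    passing from n - 1 to n in them pays for the loss n^s with a gain of 1/B
    ([gevrey_weight_conv], [gevrey_weight_step]). The part of the average of
    g_n that is not controlled by this gain is quadratic in the earlier terms.
    So the bound A (n!)^s B^n / (n+1)^2 propagates when first A is taken small
    and then B large.

    Existence of two values of beta ([beta_potential],
    [periodic_two_critical]). Since V is periodic, its gradient has average
    zero; this makes the integral that defines beta the derivative of a
    periodic function, which has a maximum and a minimum. *)

(** * Integrals over a period of the line *)

Section Circle.
Variable R : realType.
Implicit Types f g : R -> R.
Let I1 (f : R -> R) : R := \int[@lebesgue_measure R]_(x in `[0, 2 * pi]) f x.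

Lemma period_gt0 : 0 < 2 * pi :> R.
Proof. by rewrite mulr_gt0 // pi_gt0. Qed.

Lemma integrable_segment f a b : continuous f ->
  (@lebesgue_measure R).-integrable `[a, b] (EFin \o f).
Proof.
move=> cf; apply: continuous_compact_integrable; first exact: segment_compact.
exact: continuous_subspaceT.
Qed.
Hint Resolve integrable_segment : core.

Lemma int1D f g : continuous f -> continuous g ->
  I1 (fun x => f x + g x) = I1 f + I1 g.
Proof. by move=> cf cg; apply: RintegralD => //; apply: integrable_segment. Qed.

Lemma int1Z r f : continuous f -> I1 (fun x => r * f x) = r * I1 f.
Proof. by move=> cf; apply: RintegralZl => //; apply: integrable_segment. Qed.

Lemma int1_le f g : continuous f -> continuous g ->
  (forall x, 0 <= x <= 2 * pi -> f x <= g x) -> I1 f <= I1 g.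
Proof.
move=> cf cg fg; apply: le_Rintegral => //; try exact: integrable_segment.
Qed.

Lemma int1_primitive f g : continuous f ->
  (forall x : R, is_derive x 1 g (f x)) ->
  I1 f = g (2 * pi) - g 0.
Proof.
move=> cf dG; have cG : continuous g.
  by move=> x; apply/differentiable_continuous/derivable1_diffP; have := dG x; case.
rewrite /I1 /Rintegral (@continuous_FTC2 _ f g) //; first exact: period_gt0.
- exact: continuous_subspaceT.
- split; [by move=> x _; have [] := dG x | |].
  + exact/cvg_at_right_filter/cG.
  + exact/cvg_at_left_filter/cG.
- by move=> x _; rewrite derive1E; have [] := dG x.
Qed.

Lemma int1_cst r : I1 (fun=> r) = 2 * pi * r.
Proof.
have d (x : R) : is_derive x 1 (fun y => r * y) r.
  by apply: is_derive_eq; rewrite /GRing.scale /= mulr1.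
by rewrite (int1_primitive _ d) ?mulr0 ?subr0 1?mulrC // => x; exact: cvg_cst.
Qed.

(** A periodic integrand makes the integral over [y, y + 2 pi] independent of y:
    as a function of y it has derivative f (y + 2 pi) - f y = 0. The primitive
    starts at a point to the left of 0 and of a, so that every evaluation
    point is interior to its domain. *)
Lemma int1_shift f a : continuous f -> (forall x, f (x + 2 * pi) = f x) ->
  I1 (fun x => f (x + a)) = I1 f.
Proof.
move=> cf pf.
pose A : R := - `|a| - 1.
pose H (x : R) : R := \int[@lebesgue_measure R]_(t in `[A, x]) f t.
have dH (x : R) : A < x -> is_derive x 1 H (f x).
  move=> Ax; have x1 : x < x + 1 by rewrite ltrDl.
  have [] := @continuous_FTC1_closed _ f A x (x + 1) x1 (integrable_segment A (x + 1) cf) Ax (cf x).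
  by rewrite derive1E => d1 d2; split.
have dHs (x c : R) : A < x + c -> is_derive x 1 (fun y => H (y + c)) (f (x + c)).
  move=> Ax; have h1 := dH _ Ax.
  have h2 : is_derive x 1 (fun y : R => y + c) 1.
    by apply: is_derive_eq; rewrite addr0.
  have := @is_derive1_comp _ H (fun y => y + c) x _ _ h1 h2; rewrite mulr1.
  exact.
have A0 : A < 0 by rewrite /A; have := normr_ge0 a; lra.
have Aa : A < a by rewrite /A; have := ler_norm (- a); rewrite normrN; lra.
have T0 := period_gt0.
have intE (c : R) : A < c -> I1 (fun x => f (x + c)) = H (2 * pi + c) - H c.
  move=> Ac.
  have cHs (x : R) : A < x + c -> {for x, continuous (fun y => H (y + c))}.
    move=> h; apply/differentiable_continuous/derivable1_diffP.
    by have := dHs _ _ h; case.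
  have cfc : continuous (fun x => f (x + c)).
    by move=> x; apply: continuous_comp; [apply: cvgD; [exact: cvg_id|exact: cvg_cst]| exact: cf].
  rewrite /I1 /Rintegral (@continuous_FTC2 _ _ (fun y => H (y + c))) ?add0r //.
  - exact: continuous_subspaceT.
  - split.
    + move=> x; rewrite in_itv /= => /andP[x0 _].
      have h : A < x + c by lra.
      by have := dHs _ _ h; case.
    + by apply/cvg_at_right_filter/cHs; lra.
    + by apply/cvg_at_left_filter/cHs; lra.
  - move=> x; rewrite in_itv /= => /andP[x0 _]; rewrite derive1E.
    have h : A < x + c by lra.
    by have := dHs _ _ h; case.
have -> : I1 f = I1 (fun x => f (x + 0)) by congr Rintegral; apply/funext => x; rewrite addr0.
rewrite !intE //.
have dD (x : R) : A < x -> is_derive x 1 (fun y => H (y + 2 * pi) - H (y + 0)) 0.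
  move=> Ax; have h1 : A < x + 2 * pi by lra.
  have h2 : A < x + 0 by lra.
  have d1 := dHs _ _ h1; have d2 := dHs _ _ h2.
  by apply: is_derive_eq; rewrite pf addr0 subrr.
have cD (x : R) : A < x -> {for x, continuous (fun y => H (y + 2 * pi) - H (y + 0))}.
  by move=> h; apply/differentiable_continuous/derivable1_diffP; have := dD _ h; case.
pose D (y : R) : R := H (y + 2 * pi) - H (y + 0).
suff E (u v : R) : A < u -> u < v -> D u = D v.
  have e c : H (2 * pi + c) - H c = D c by rewrite /D [2 * pi + c]addrC addr0.
  by rewrite !e; have [a0|a0|->] := ltgtP a 0; [exact: E | apply/esym; exact: E | ].
move=> Au uv.
have [] := @MVT R D (fun=> 0) u v uv.
- by move=> x; rewrite in_itv /= => /andP[ux _]; apply: dD; lra.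
- apply: derivable_within_continuous => x; rewrite in_itv /= => /andP[ux _].
  have h : A < x by lra.
  by have := dD _ h; case.
by move=> x _; rewrite mul0r => /eqP; rewrite subr_eq0 => /eqP ->.
Qed.
End Circle.

(** * Iterated integrals over the torus *)

Section Torus.
Variable R : realType.

Definition torus_box (L : nat) : set 'rV[R]_L :=
  [set theta | forall i, 0 <= theta 0 i <= 2 * pi].

Lemma compact_torus_box L : compact (@torus_box L).
Proof.
have := @rV_compact R L (fun=> `[0, 2 * pi]%classic) (fun=> @segment_compact R _ _).
congr (compact _).
Qed.

Lemma continuous_o (T U V : topologicalType) (f : T -> U) (g : U -> V) :
  continuous f -> continuous g -> continuous (fun x => g (f x)).
Proof. by move=> cf cg x; apply: continuous_comp; [exact: cf|exact: cg]. Qed.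

Lemma continuous_fct_cst (T U : topologicalType) (c : U) : continuous (fun _ : T => c).
Proof. by move=> x; exact: cst_continuous. Qed.

Lemma continuous_fctD (T : topologicalType) (f g : T -> R) :
  continuous f -> continuous g -> continuous (fun x => f x + g x).
Proof. by move=> cf cg x; apply: cvgD; [exact: cf|exact: cg]. Qed.

Lemma continuous_fctM (T : topologicalType) (f g : T -> R) :
  continuous f -> continuous g -> continuous (fun x => f x * g x).
Proof. by move=> cf cg x; apply: cvgM; [exact: cf|exact: cg]. Qed.

Lemma continuous_mx (T : topologicalType) m n (f : T -> 'M[R]_(m, n)) :
  (forall i j, continuous (fun x => f x i j)) -> continuous f.
Proof.
move=> cf x A [P nP sPA]; rewrite nbhs_simpl /=.
have h : \forall y \near x, forall i j, P i j (f y i j).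
  apply: filter_forall => i; apply: filter_forall => j; exact: cf (nP i j).
by apply: filterS h => y hy; exact: sPA.
Qed.

Definition rcons_torus L (x : R) (theta : 'rV[R]_L) : 'rV[R]_L.+1 :=
  row_mx (x%:M : 'rV[R]_1) theta.

Lemma rcons_torus0 L x (theta : 'rV[R]_L) : rcons_torus x theta 0 ord0 = x.
Proof.
transitivity (rcons_torus x theta 0 (lshift L (ord0 : 'I_1))).
  by congr (rcons_torus _ _ _ _); exact/val_inj.
by apply: etrans (row_mxEl _ _ _ _) _; rewrite mxE.
Qed.

Lemma rcons_torusS L x (theta : 'rV[R]_L) i :
  rcons_torus x theta 0 (lift ord0 i) = theta 0 i.
Proof.
transitivity (rcons_torus x theta 0 (rshift 1 i)).
  by congr (rcons_torus _ _ _ _); exact/val_inj.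
exact: row_mxEr.
Qed.

Lemma continuous_rcons_torus L :
  continuous (fun p : R * 'rV[R]_L => rcons_torus p.1 p.2).
Proof.
apply: continuous_mx => i j; rewrite (ord1 i).
case: (unliftP ord0 j) => [k|] ->.
  rewrite (_ : (fun _ => _) = (fun p : R * 'rV[R]_L => p.2 0 k)).
    apply: (@continuous_o _ _ _ snd (fun t : 'rV[R]_L => t 0 k)) => [p|].
      exact: cvg_snd.
    exact: coord_continuous.
  by apply/funext => p; rewrite rcons_torusS.
rewrite (_ : (fun _ => _) = (fun p : R * 'rV[R]_L => p.1)).
  by move=> p; exact: cvg_fst.
by apply/funext => p; rewrite rcons_torus0.
Qed.

Lemma continuous_slice (T U V : topologicalType) (f : T * U -> V) (x : T) :
  continuous f -> continuous (fun y => f (x, y)).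
Proof.
apply: continuous_o => y.
by apply: cvg_pair; [exact: cvg_cst|exact: cvg_id].
Qed.

Lemma torus_box_rcons L x (theta : 'rV[R]_L) :
  0 <= x <= 2 * pi -> torus_box theta -> torus_box (rcons_torus x theta).
Proof.
move=> hx ht i; case: (unliftP ord0 i) => [k|] ->.
  by rewrite rcons_torusS.
by rewrite rcons_torus0.
Qed.

(** The tube lemma over the compact box: joint continuity gives closeness
    that is uniform in theta. *)
Lemma near_torus_box (T : topologicalType) L (f : T * 'rV[R]_L -> R) (x0 : T) (e : R) :
  continuous f -> 0 < e ->
  \forall x \near x0, forall theta, torus_box theta -> `|f (x0, theta) - f (x, theta)| < e.
Proof.
move=> cf e0.
have /compact_near_coveringP h := @compact_torus_box L.
apply: (h _ (nbhs x0) (fun x theta => `|f (x0, theta) - f (x, theta)| < e)).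
move=> t _.
have e20 : 0 < e / 2 by rewrite divr_gt0.
have := continuous_slice cf (x := x0); move/(_ t).
move=> /cvgrPdist_lt /(_ _ e20) h1.
have := cf (x0, t); move=> /cvgrPdist_lt /(_ _ e20) [[A B] /= [nA nB] h2].
exists (B `&` [set u | `|f (x0, t) - f (x0, u)| < e / 2], A) => /=.
  by split => //; apply: filterI.
move=> [u x] /= [[Bu uu] Ax].
rewrite (_ : _ - _ = f (x0, t) - f (x, u) - (f (x0, t) - f (x0, u))); last by ring.
rewrite (le_lt_trans (ler_normB _ _)) // (splitr e) ltrD //.
exact: (h2 (x, u)).
Qed.

(** Linearity and positivity are proved together by induction on L: one more
    integration needs continuity of the inner integral in its parameter, and
    this continuity uses all four properties in dimension L. *)
Definition torus_pos L := 
  [/\ forall f g : 'rV[R]_L -> R, continuous f -> continuous g ->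
        torus_int (fun t => f t + g t) = torus_int f + torus_int g,
      forall (r : R) (f : 'rV[R]_L -> R), continuous f ->
        torus_int (fun t => r * f t) = r * torus_int f,
      forall f g : 'rV[R]_L -> R, continuous f -> continuous g ->
        (forall t, torus_box t -> f t <= g t) -> torus_int f <= torus_int g &
      forall r : R, torus_int (fun _ : 'rV[R]_L => r) = (2 * pi) ^+ L * r].

Lemma torus_pos_norm L (f : 'rV[R]_L -> R) M : torus_pos L -> continuous f ->
  (forall t, torus_box t -> `|f t| <= M) -> `|torus_int f| <= (2 * pi) ^+ L * M.
Proof.
move=> [_ hZ hle hc] cf fM.
have cc (r : R) := @continuous_fct_cst 'rV[R]_L R r.
rewrite ler_norml -mulrN -!hc; apply/andP; split; apply: hle => // t /fM.
  by rewrite ler_norml => /andP[].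
by rewrite ler_norml => /andP[].
Qed.

Lemma torus_pos_param (T : topologicalType) L (f : T * 'rV[R]_L -> R) :
  torus_pos L -> continuous f -> continuous (fun x => torus_int (fun t => f (x, t))).
Proof.
move=> hL cf x0; apply/cvgrPdist_lt => e e0.
have T0 : 0 < (2 * pi) ^+ L :> R by rewrite exprn_gt0 // period_gt0.
have e1 : 0 < e / (2 * pi) ^+ L / 2 by rewrite !divr_gt0.
apply: filterS (near_torus_box x0 cf e1) => x hx.
have c1 := continuous_slice cf (x := x0); have c2 := continuous_slice cf (x := x).
have c3 : continuous (fun y => (-1) * f (x, y)).
  by apply: continuous_fctM => //; exact: continuous_fct_cst.
have -> : torus_int (fun t => f (x0, t)) - torus_int (fun t => f (x, t)) =
    torus_int (fun t => f (x0, t) + (-1) * f (x, t)).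
  by have [hD hZ _ _] := hL; rewrite hD // hZ // mulN1r.
apply: (@le_lt_trans _ _ ((2 * pi) ^+ L * (e / (2 * pi) ^+ L / 2))).
  apply: torus_pos_norm => //.
    exact: continuous_fctD.
  by move=> t /hx; rewrite mulN1r => /ltW.
by rewrite mulrA [_ * (e / _)]mulrC divfK ?gt_eqF // ltr_pdivrMr ?ltr_pMr ?ltr1n.
Qed.

Lemma continuous_rcons_comp (U : topologicalType) L (f : 'rV[R]_L.+1 -> U) : continuous f ->
  continuous (fun p : R * 'rV[R]_L => f (rcons_torus p.1 p.2)).
Proof.
by apply: (@continuous_o _ _ _ (fun p : R * 'rV[R]_L => rcons_torus p.1 p.2) f);
  exact: continuous_rcons_torus.
Qed.

Lemma continuous_rcons_slice (U : topologicalType) L (f : 'rV[R]_L.+1 -> U) x : continuous f ->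
  continuous (fun t : 'rV[R]_L => f (rcons_torus x t)).
Proof. by move=> cf; exact: (continuous_slice (continuous_rcons_comp cf)). Qed.

Lemma torus_posP L : torus_pos L.
Proof.
elim: L => [|L IH].
  split=> //= [f g _ _ h|r]; last by rewrite expr0 mul1r.
  by apply: h; case.
have ci (f : 'rV[R]_L.+1 -> R) : continuous f ->
    continuous (fun x => torus_int (fun t => f (rcons_torus x t))).
  by move=> /continuous_rcons_comp /(torus_pos_param IH).
have [hD hZ hle hc] := IH.
split=> [f g cf cg|r f cf|f g cf cg fg|r] /=.
- transitivity (\int[@lebesgue_measure R]_(x in `[0, 2 * pi])
    (torus_int (fun t => f (rcons_torus x t)) + torus_int (fun t => g (rcons_torus x t)))).
    by apply: eq_Rintegral => x _; apply: hD; exact: continuous_rcons_slice.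
  by apply: int1D; exact: ci.
- transitivity (\int[@lebesgue_measure R]_(x in `[0, 2 * pi])
    (r * torus_int (fun t => f (rcons_torus x t)))).
    by apply: eq_Rintegral => x _; apply: hZ; exact: continuous_rcons_slice.
  by apply: int1Z; exact: ci.
- apply: int1_le; [exact: ci|exact: ci|] => x hx.
  apply: hle; [exact: continuous_rcons_slice|exact: continuous_rcons_slice|].
  by move=> t ht; apply: fg; exact: torus_box_rcons.
- transitivity (\int[@lebesgue_measure R]_(x in `[0, 2 * pi]) ((2 * pi) ^+ L * r)).
    by apply: eq_Rintegral => x _; exact: hc.
  by rewrite int1_cst mulrA -exprS.
Qed.

Lemma torus_intD L (f g : 'rV[R]_L -> R) : continuous f -> continuous g ->
  torus_int (fun t => f t + g t) = torus_int f + torus_int g.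
Proof. by have [+ _ _ _] := torus_posP L; apply. Qed.

Lemma torus_intZ L r (f : 'rV[R]_L -> R) : continuous f ->
  torus_int (fun t => r * f t) = r * torus_int f.
Proof. by have [_ + _ _] := torus_posP L; apply. Qed.

Lemma torus_int_cst L r : torus_int (fun _ : 'rV[R]_L => r) = (2 * pi) ^+ L * r.
Proof. by have [_ _ _ +] := torus_posP L; apply. Qed.

Lemma torus_int_norm L (f : 'rV[R]_L -> R) M : continuous f ->
  (forall t, torus_box t -> `|f t| <= M) -> `|torus_int f| <= (2 * pi) ^+ L * M.
Proof. exact: torus_pos_norm (torus_posP L). Qed.

Lemma continuous_torus_int (T : topologicalType) L (f : T * 'rV[R]_L -> R) :
  continuous f -> continuous (fun x => torus_int (fun t => f (x, t))).
Proof. exact: torus_pos_param (torus_posP L). Qed.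

Lemma continuous_torus_slice L (f : 'rV[R]_L.+1 -> R) : continuous f ->
  continuous (fun x => torus_int (fun t => f (rcons_torus x t))).
Proof. by move=> cf; exact: (continuous_torus_int (continuous_rcons_comp cf)). Qed.

Lemma torus_intS L (f : 'rV[R]_L.+1 -> R) : torus_int f =
  \int[@lebesgue_measure R]_(x in `[0, 2 * pi]) torus_int (fun t => f (rcons_torus x t)).
Proof. by []. Qed.

Lemma rcons_torusD L x y (s t : 'rV[R]_L) :
  rcons_torus (x + y) (s + t) = rcons_torus x s + rcons_torus y t.
Proof.
apply/rowP => i; rewrite [RHS]mxE.
by case: (unliftP ord0 i) => [k|] ->; rewrite !(rcons_torus0, rcons_torusS) ?mxE.
Qed.

Lemma rcons_torus_split L (t : 'rV[R]_L.+1) :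
  t = rcons_torus (t 0 ord0) (\row_i t 0 (lift ord0 i)).
Proof.
apply/rowP => i; case: (unliftP ord0 i) => [k|] ->.
  by rewrite rcons_torusS mxE.
by rewrite rcons_torus0.
Qed.

Lemma torus_int_shift L (f : 'rV[R]_L -> R) (w : 'rV[R]_L) : continuous f ->
  torus_periodic f -> torus_int (fun t => f (t + w)) = torus_int f.
Proof.
elim: L f w => [|L IH] f w cf pf; first by rewrite /=; congr f; apply/rowP; case.
rewrite !torus_intS.
transitivity (\int[@lebesgue_measure R]_(x in `[0, 2 * pi])
   torus_int (fun t => f (rcons_torus (x + w 0 ord0) t))).
  apply: eq_Rintegral => x _.
  rewrite -[RHS](IH _ (\row_i w 0 (lift ord0 i))).
  - congr torus_int; apply/funext => t; rewrite {1}(rcons_torus_split w).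
    by rewrite rcons_torusD.
  - exact: continuous_rcons_slice.
  - move=> j t; rewrite -[in RHS](pf (lift ord0 j)); congr f.
    apply/rowP => i; rewrite [RHS]mxE [in X in _ = _ + X]mxE [in X in _ = _ + X]mxE.
    case: (unliftP ord0 i) => [k|] ->; last first.
      by rewrite !rcons_torus0 /= mulr0 addr0.
    by rewrite !rcons_torusS !mxE eqxx /= (inj_eq lift_inj).
pose F x := torus_int (fun t => f (rcons_torus x t)).
apply: (@int1_shift _ F); first exact: continuous_torus_slice.
move=> x; congr torus_int; apply/funext => t.
rewrite -[in RHS](pf ord0); congr f; apply/rowP => i.
rewrite [RHS]mxE [in X in _ = _ + X]mxE [in X in _ = _ + X]mxE.
case: (unliftP ord0 i) => [k|] ->; last first.
  by rewrite !rcons_torus0 eqxx mulr1.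
by rewrite !rcons_torusS /= mulr0 addr0.
Qed.

End Torus.

(** * Uniqueness of Fourier coefficients on the circle *)

Section CircleUniqueness.
Variable R : realType.
Local Notation int1 f := (\int[@lebesgue_measure R]_(x in `[0, 2 * pi]) f x).

Lemma periodic_int (T : Type) (f : R -> T) (n : int) x :
  (forall x, f (x + 2 * pi) = f x) -> f (x + 2 * pi * n%:~R) = f x.
Proof.
move=> pf.
have pn (m : nat) y : f (y + 2 * pi * m%:R) = f y.
  elim: m y => [|m IH] y; first by rewrite mulr0 addr0.
  rewrite (_ : _ + _ = y + 2 * pi * m%:R + 2 * pi); first by rewrite pf IH.
  by rewrite -[m.+1]addn1 natrD; ring.
case: n => n; first exact: pn.
by rewrite NegzE mulrNz mulrN -[LHS](pn n.+1) subrK.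
Qed.

Lemma cosD2pi_per (x : R) : cos (x + 2 * pi) = cos x.
Proof. by rewrite mulr_natl cosD2pi. Qed.

Lemma sinD2pi_per (x : R) : sin (x + 2 * pi) = sin x.
Proof. by rewrite mulr_natl sinD2pi. Qed.

Lemma cos_eq1 (y : R) : cos y = 1 -> exists n : int, y = 2 * pi * n%:~R.
Proof.
move=> cy; have T0 := period_gt0 R.
pose n := Num.floor (y / (2 * pi)).
exists n; pose z := y - 2 * pi * n%:~R.
have z0 : 0 <= z by rewrite subr_ge0 mulrC -ler_pdivlMr // Num.Theory.ge_floor.
have z1 : z < 2 * pi.
  rewrite ltrBlDr -{1}[2 * pi]mulr1 -mulrDr mulrC -ltr_pdivrMr //.
  by rewrite addrC -[1](_ : 1%:~R = _) // -intrD Num.Theory.floorD1_gt.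
have cz : cos z = 1.
  by rewrite /z -mulrN -mulrNz (@periodic_int _ cos) // => x; exact: cosD2pi_per.
suff : z = 0 by move=> /eqP; rewrite subr_eq0 => /eqP.
apply/eqP; apply: contraTT isT => zn0.
have : 0 < sin (z / 2).
  apply: sin_gt0_pi; rewrite divr_gt0 //=; last by rewrite lt_neqAle eq_sym zn0.
  by rewrite ltr_pdivrMr // mulrC.
suff -> : sin (z / 2) = 0 by rewrite ltxx.
have := cos_mulr2n (z / 2); rewrite (_ : _ *+ 2 = z); last by rewrite mulr2n; lra.
rewrite cz cos2sin2; move=> h; apply/eqP; rewrite -sqrf_eq0; apply/eqP; move: h; rewrite mulr2n; lra.
Qed.

Definition cosbump (x0 x : R) := 1 + cos (x - x0).

Lemma is_derive_cosB (x0 x : R) :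
  is_derive x 1 (fun y => cos (y - x0)) (- sin (x - x0)).
Proof.
have h : is_derive x 1 (fun y : R => y - x0) 1 by apply: is_derive_eq; rewrite subr0.
by have := @is_derive1_comp _ cos _ x _ _ (is_derive_cos _) h; rewrite mulr1.
Qed.

Lemma is_derive_sinB (x0 x : R) :
  is_derive x 1 (fun y => sin (y - x0)) (cos (x - x0)).
Proof.
have h : is_derive x 1 (fun y : R => y - x0) 1 by apply: is_derive_eq; rewrite subr0.
by have := @is_derive1_comp _ sin _ x _ _ (is_derive_sin _) h; rewrite mulr1.
Qed.

Lemma continuous_exp (f : R -> R) n : continuous f -> continuous (fun x => f x ^+ n).
Proof.
by move=> cf; elim: n => [|n IH];
  [exact: continuous_fct_cst | under eq_fun do rewrite exprS; exact: continuous_fctM].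
Qed.

Lemma continuous_cosbump x0 : continuous (cosbump x0).
Proof.
apply: continuous_fctD; first exact: continuous_fct_cst.
move=> x; apply/differentiable_continuous/derivable1_diffP.
by have [] := is_derive_cosB x0 x.
Qed.

(** The Wallis recursion for the kernel 1 + cos (x - x0): differentiate
    (1 + cos)^n sin. *)
Lemma int1_cosbumpS x0 n :
  (n%:R + 1) * int1 (fun x => cosbump x0 x ^+ n.+1) = (2 * n%:R + 1) * int1 (fun x => cosbump x0 x ^+ n).
Proof.
have cb m : continuous (fun x => cosbump x0 x ^+ m) := continuous_exp (@continuous_cosbump x0).
have dG (x : R) : is_derive x 1 (fun y => cosbump x0 y ^+ n * sin (y - x0))
   ((n%:R + 1) * cosbump x0 x ^+ n.+1 + (- (2 * n%:R + 1)) * cosbump x0 x ^+ n).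
  have d1 : is_derive x 1 (cosbump x0) (- sin (x - x0)).
    by rewrite /cosbump; apply: is_derive_eq; ring.
  have d2 := is_derive_sinB x0 x.
  have d3 := is_deriveM (is_deriveX n d1) d2; rewrite exprfctE in d3.
  apply: (@is_derive_eq _ _ _ _ _ _ _ _ d3). rewrite /GRing.scale /=.
  have s2 : sin (x - x0) * sin (x - x0) = cosbump x0 x * (2 - cosbump x0 x).
    by rewrite -expr2 sin2cos2 /cosbump; ring.
  have c1 : cos (x - x0) = cosbump x0 x - 1 by rewrite /cosbump; ring.
  rewrite (_ : sin _ * _ = - (n%:R * cosbump x0 x ^+ n.-1 *
    (sin (x - x0) * sin (x - x0)))); last by ring.
  rewrite c1 s2; clear -s2; case: n => [|n] /=; first by ring.
  by rewrite !exprS -natr1; ring.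
have cZ r m : continuous (fun x => r * cosbump x0 x ^+ m).
  by apply: continuous_fctM => //; exact: continuous_fct_cst.
have := int1_primitive (continuous_fctD (cZ _ n.+1) (cZ _ n)) dG.
have -> : cosbump x0 (2 * pi) = cosbump x0 0.
  by rewrite /cosbump -(cosD2pi_per (0 - x0)); congr (1 + cos _); ring.
have -> : sin (2 * pi - x0) = sin (0 - x0).
  by rewrite -(sinD2pi_per (0 - x0)); congr sin; ring.
rewrite subrr int1D // !int1Z // mulNr.
by move/eqP; rewrite subr_eq0 => /eqP.
Qed.

Lemma int1_cosbump_gt0 x0 n : 0 < int1 (fun x => cosbump x0 x ^+ n).
Proof.
elim: n => [|n IH].
  have -> : (fun x => cosbump x0 x ^+ 0) = fun=> 1 by apply/funext => x; rewrite expr0.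
  by rewrite int1_cst mulr1 period_gt0.
by rewrite -(@pmulr_rgt0 _ (n%:R + 1)) ?ltr_wpDl // int1_cosbumpS mulr_gt0.
Qed.

Definition trig_orth (f : R -> R) := forall m : int,
  int1 (fun x => f x * cos (m%:~R * x)) = 0 /\ int1 (fun x => f x * sin (m%:~R * x)) = 0.

Lemma continuous_cosZ (c : R) : continuous (fun x => cos (c * x)).
Proof.
apply: continuous_o; last exact: continuous_cos.
by apply: continuous_fctM; [exact: continuous_fct_cst|move=> x].
Qed.

Lemma continuous_sinZ (c : R) : continuous (fun x => sin (c * x)).
Proof.
apply: continuous_o; last exact: continuous_sin.
by apply: continuous_fctM; [exact: continuous_fct_cst|move=> x].
Qed.

Let null (f : R -> R) := continuous f /\ int1 f = 0.

Let nullD f g : null f -> null g -> null (fun x => f x + g x).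
Proof.
by move=> [cf f0] [cg g0]; split; [exact: continuous_fctD|rewrite int1D // f0 g0 addr0].
Qed.

Let nullZ r f : null f -> null (fun x => r * f x).
Proof.
move=> [cf f0]; split; last by rewrite int1Z // f0 mulr0.
by apply: continuous_fctM => //; exact: continuous_fct_cst.
Qed.

Let null_eq f g : null f -> (forall x, g x = f x) -> int1 g = 0.
Proof. by move=> [_ +] h; have -> : g = f by exact/funext. Qed.

(** The kernel is a trigonometric polynomial of degree 1, so a product with it
    only shifts frequencies. *)
Lemma trig_orth_cosbump f x0 : continuous f -> trig_orth f ->
  trig_orth (fun x => f x * cosbump x0 x).
Proof.
move=> cf of_ m.
have nc (k : int) : null (fun x => f x * cos (k%:~R * x)).
  split; last by have [] := of_ k.
  by apply: continuous_fctM => //; exact: continuous_cosZ.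
have ns (k : int) : null (fun x => f x * sin (k%:~R * x)).
  split; last by have [] := of_ k.
  by apply: continuous_fctM => //; exact: continuous_sinZ.
have e1 (x : R) : (m + 1)%:~R * x = m%:~R * x + x by rewrite intrD mulrDl mul1r.
have e2 (x : R) : (m - 1)%:~R * x = m%:~R * x - x by rewrite intrB mulrBl mul1r.
split.
- apply: (null_eq (nullD (nc m) (nullD (nullD (nullZ (cos x0 / 2) (nc (m + 1)))
    (nullZ (cos x0 / 2) (nc (m - 1)))) (nullD (nullZ (sin x0 / 2) (ns (m + 1)))
    (nullZ (- sin x0 / 2) (ns (m - 1))))))) => x.
  by rewrite /cosbump cosB e1 e2 cosD sinD cosB sinB; field.
- apply: (null_eq (nullD (ns m) (nullD (nullD (nullZ (- sin x0 / 2) (nc (m + 1)))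
    (nullZ (sin x0 / 2) (nc (m - 1)))) (nullD (nullZ (cos x0 / 2) (ns (m + 1)))
    (nullZ (cos x0 / 2) (ns (m - 1))))))) => x.
  by rewrite /cosbump cosB e1 e2 cosD sinD cosB sinB; field.
Qed.

Lemma trig_orth_cosbumpX f x0 n : continuous f -> trig_orth f ->
  int1 (fun x => f x * cosbump x0 x ^+ n) = 0.
Proof.
move=> cf of_.
suff [_ /(_ 0) [+ _]] : continuous (fun x => f x * cosbump x0 x ^+ n) /\
    trig_orth (fun x => f x * cosbump x0 x ^+ n).
  by under eq_Rintegral do rewrite mulr0z mul0r cos0 mulr1.
elim: n => [|n [IHc IHo]].
  by have -> : (fun x => f x * cosbump x0 x ^+ 0) = f by apply/funext => x; rewrite expr0 mulr1.
have -> : (fun x => f x * cosbump x0 x ^+ n.+1) = (fun x => f x * cosbump x0 x ^+ n * cosbump x0 x).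
  by apply/funext => x; rewrite exprSr mulrA.
split; first by apply: continuous_fctM => //; exact: continuous_cosbump.
exact: trig_orth_cosbump.
Qed.

(** The powers of 1 + cos (x - x0) concentrate at x0. If f x0 > 0, then f is at
    least c - C (1 - cos (x - x0)) with c > 0: near x0 by continuity and
    elsewhere for C large. Integrating this against the n-th power, which is
    orthogonal to f, contradicts the Wallis recursion for n > C / c. *)
Lemma trig_orth_le0 f x0 : continuous f -> (forall x, f (x + 2 * pi) = f x) ->
  trig_orth f -> f x0 <= 0.
Proof.
move=> cf pf of_; rewrite leNgt; apply/negP => fx0.
pose c := f x0 / 2.
have c0 : 0 < c by rewrite divr_gt0.
have T0 := period_gt0 R.
pose k x : R := 2 - cosbump x0 x.
have ck : continuous k.
  apply: (@continuous_fctD _ _ (fun=> 2) (fun x => - cosbump x0 x)); first exact: continuous_fct_cst.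
  by move=> x; apply: cvgN; exact: continuous_cosbump.
have k0 x : 0 <= k x by rewrite /k /cosbump; have := cos_le1 (x - x0); lra.
have [C C0 hC] : exists2 C : R, 0 <= C & forall x, 0 <= x <= 2 * pi -> c - C * k x <= f x.
  (* Z stays away from x0, so 1 - cos (x - x0) is bounded below on it *)
  pose Z := `[0, 2 * pi]%classic `&` [set x | f x <= c].
  have cZ : compact Z.
    apply: (@subclosed_compact _ _ `[0, 2 * pi]%classic); last by move=> x [].
      apply: closedI; first exact: itv_closed.
      by apply: (@preimage_closed _ _ f [set y | y <= c]) => [x _|]; [exact: cf|exact: closed_le].
    exact: segment_compact.
  have [Z0|/set0P Z0] := eqVneq Z set0.
    exists 0 => // x hx; rewrite mul0r subr0 leNgt; apply/negP => /ltW fx.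
    have : Z x by split => //=; rewrite in_itv.
    by rewrite Z0.
  have [z Zz hz] := compact_EVT_min Z0 cZ (continuous_subspaceT ck).
  have [w Zw hw] := compact_EVT_min Z0 cZ (continuous_subspaceT cf).
  have kz : 0 < k z.
    rewrite lt_neqAle k0 andbT eq_sym; apply/negP => /eqP kz0.
    have /cos_eq1 [n zE] : cos (z - x0) = 1 by move: kz0; rewrite /k /cosbump; lra.
    have : f z = f x0.
      by rewrite -(periodic_int n x0 pf) -zE; congr f; ring.
    by move: Zz; rewrite inE => -[_ /=] h1 h2; move: h1; rewrite h2 /c => h1; lra.
  have M0 : 0 <= `|f w| + c by have := normr_ge0 (f w); lra.
  have C0 : 0 <= (`|f w| + c) / k z by rewrite divr_ge0 // ltW.
  exists ((`|f w| + c) / k z) => // x hx; have [fx|/ltW fx] := leP c (f x).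
    by apply: le_trans fx; rewrite gerBl mulr_ge0.
  have Zx : Z x by split => //=; rewrite in_itv.
  have h1 : k z <= k x by apply: hz; rewrite inE.
  have h2 : f w <= f x by apply: hw; rewrite inE.
  apply: le_trans h2; have h3 : `|f w| + c <= (`|f w| + c) / k z * k x.
    by rewrite -mulrA ler_peMr // ler_pdivlMl // mulr1.
  by have := ler_norm (- f w); rewrite normrN; lra.
have cb n : continuous (fun x => cosbump x0 x ^+ n) := continuous_exp (@continuous_cosbump x0).
have cZ r n : continuous (fun x => r * cosbump x0 x ^+ n).
  by apply: continuous_fctM => //; exact: continuous_fct_cst.
have b0 x : 0 <= cosbump x0 x by rewrite /cosbump; have := cos_geN1 (x - x0); lra.
pose J n := int1 (fun x => cosbump x0 x ^+ n).
have main n : (c - 2 * C) * J n + C * J n.+1 <= 0.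
  rewrite -(@trig_orth_cosbumpX f x0 n cf of_) /J -!int1Z // -int1D //.
  apply: int1_le; [exact: continuous_fctD|exact: continuous_fctM|] => x hx.
  rewrite exprS mulrA -mulrDl; apply: ler_wpM2r; first exact: exprn_ge0.
  by apply: le_trans (hC x hx); rewrite /k; lra.
pose n := Num.truncn (C / c).
have nC : C < c * (n%:R + 1).
  by rewrite mulrC -ltr_pdivrMr // natr1 Num.Theory.truncnS_gt.
have := main n; rewrite leNgt => /negP; apply.
rewrite -(@pmulr_rgt0 _ (n%:R + 1)) ?ltr_wpDl //.
have J0 : 0 < J n := int1_cosbump_gt0 x0 n.
have JS : (n%:R + 1) * J n.+1 = (2 * n%:R + 1) * J n := int1_cosbumpS x0 n.
rewrite mulrDr [(n%:R + 1) * (C * _)]mulrCA JS.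
rewrite [X in _ < X](_ : _ = (c * (n%:R + 1) - C) * J n); last by ring.
by rewrite mulr_gt0 // subr_gt0.
Qed.

Lemma trig_orth_eq0 f : continuous f -> (forall x, f (x + 2 * pi) = f x) ->
  trig_orth f -> forall x, f x = 0.
Proof.
move=> cf pf of_ x; apply/eqP; rewrite eq_le trig_orth_le0 //= -oppr_le0.
apply: (@trig_orth_le0 (fun x => - f x)).
- by move=> y; apply: cvgN; exact: cf.
- by move=> y; rewrite pf.
- move=> m; have [h1 h2] := of_ m; split.
  + rewrite (_ : (fun x => _) = (fun x => (-1) * (f x * cos (m%:~R * x)))).
      rewrite int1Z ?h1 ?mulr0 //; apply: continuous_fctM => //; exact: continuous_cosZ.
    by apply/funext => y; ring.
  + rewrite (_ : (fun x => _) = (fun x => (-1) * (f x * sin (m%:~R * x)))).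
      rewrite int1Z ?h2 ?mulr0 //; apply: continuous_fctM => //; exact: continuous_sinZ.
    by apply/funext => y; ring.
Qed.

End CircleUniqueness.

(** * Complex Fourier coefficients on the torus *)

Section ComplexFourier.
Variable R : realType.
Local Notation C := (complex R).
Local Notation normc := ComplexField.Normc.normc.

Definition ccont (T : topologicalType) (f : T -> C) : Prop :=
  continuous (fun x => complex.Re (f x)) /\ continuous (fun x => complex.Im (f x)).

Lemma ReM (x y : C) : complex.Re (x * y) =
  complex.Re x * complex.Re y - complex.Im x * complex.Im y.
Proof. by case: x y => [a b] [c d]. Qed.

Lemma ImM (x y : C) : complex.Im (x * y) =
  complex.Re x * complex.Im y + complex.Im x * complex.Re y.
Proof. by case: x y => [a b] [c d]. Qed.

Lemma ReD (x y : C) : complex.Re (x + y) = complex.Re x + complex.Re y.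
Proof. by case: x y => [a b] [c d]. Qed.

Lemma ImD (x y : C) : complex.Im (x + y) = complex.Im x + complex.Im y.
Proof. by case: x y => [a b] [c d]. Qed.

Lemma complexP (x y : C) :
  complex.Re x = complex.Re y -> complex.Im x = complex.Im y -> x = y.
Proof. by case: x y => [a b] [c d] /= -> ->. Qed.

Lemma ccontD (T : topologicalType) (f g : T -> C) :
  ccont f -> ccont g -> ccont (fun x => f x + g x).
Proof.
move=> [f1 f2] [g1 g2]; split; [under eq_fun do rewrite ReD|under eq_fun do rewrite ImD];
  exact: continuous_fctD.
Qed.

Lemma continuous_fctB (T : topologicalType) (f g : T -> R) :
  continuous f -> continuous g -> continuous (fun x => f x - g x).
Proof. by move=> cf cg x; apply: cvgB; [exact: cf|exact: cg]. Qed.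

Lemma ccontM (T : topologicalType) (f g : T -> C) :
  ccont f -> ccont g -> ccont (fun x => f x * g x).
Proof.
move=> [f1 f2] [g1 g2]; split; [under eq_fun do rewrite ReM|under eq_fun do rewrite ImM].
  by apply: continuous_fctB; exact: continuous_fctM.
by apply: continuous_fctD; exact: continuous_fctM.
Qed.

Lemma ccont_cst (T : topologicalType) (c : C) : ccont (fun _ : T => c).
Proof. by split; exact: continuous_fct_cst. Qed.

Lemma ccontZ (T : topologicalType) (c : C) (f : T -> C) :
  ccont f -> ccont (fun x => c * f x).
Proof. by apply: ccontM; exact: ccont_cst. Qed.

Lemma ccont_sum (T : topologicalType) (I : Type) (s : seq I) (f : I -> T -> C) :
  (forall i, ccont (f i)) -> ccont (fun x => \sum_(i <- s) f i x).
Proof.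
move=> cf; elim: s => [|i s IH].
  by under eq_fun do rewrite big_nil; exact: ccont_cst.
by under eq_fun do rewrite big_cons; apply: ccontD.
Qed.

Lemma ccont_real (T : topologicalType) (f : T -> R) :
  continuous f -> ccont (fun x => (f x)%:C%C).
Proof. by move=> cf; split => //=; exact: continuous_fct_cst. Qed.

Lemma ccont_o (T U : topologicalType) (g : T -> U) (f : U -> C) :
  continuous g -> ccont f -> ccont (fun x => f (g x)).
Proof.
by move=> cg [f1 f2]; split; [exact: (continuous_o cg f1)|exact: (continuous_o cg f2)].
Qed.

Lemma expiD (x y : R) : expi (x + y) = expi x * expi y.
Proof. by apply: complexP; rewrite ?ReM ?ImM /= ?cosD ?sinD // addrC. Qed.

Lemma expi0 : expi 0 = 1 :> C.
Proof. by rewrite /expi cos0 sin0. Qed.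

Lemma normc_expi (x : R) : normc (expi x) = 1.
Proof. by rewrite /= cos2Dsin2 sqrtr1. Qed.

Lemma expi_per (x : R) : expi (x + 2 * pi) = expi x.
Proof. by rewrite /expi cosD2pi_per sinD2pi_per. Qed.

Lemma normc_real (x : R) : normc x%:C%C = `|x|.
Proof. by rewrite /= expr0n addr0 sqrtr_sqr. Qed.

Lemma normc_ge0 (x : C) : 0 <= normc x.
Proof. by case: x => a b; exact: sqrtr_ge0. Qed.

Lemma normc_eq0 (x : C) : (normc x == 0) = (x == 0).
Proof.
apply/eqP/eqP => [|->]; first exact: ComplexField.Normc.eq0_normc.
exact: ComplexField.Normc.normc0.
Qed.

Lemma le_normc_sum (I : Type) (s : seq I) (f : I -> C) :
  normc (\sum_(i <- s) f i) <= \sum_(i <- s) normc (f i).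
Proof.
elim: s => [|i s IH]; first by rewrite !big_nil ComplexField.Normc.normc0.
by rewrite !big_cons (le_trans (le_normcD _ _)) // lerD2l.
Qed.

Lemma normcX (x : C) n : normc (x ^+ n) = normc x ^+ n.
Proof.
elim: n => [|n IH]; first by rewrite !expr0 ComplexField.Normc.normc1.
by rewrite !exprS ComplexField.Normc.normcM IH.
Qed.

Lemma le_Re_normc (x : C) : `|complex.Re x| <= normc x.
Proof. by case: x => a b /=; rewrite -sqrtr_sqr ler_wsqrtr // lerDl sqr_ge0. Qed.

Lemma le_Im_normc (x : C) : `|complex.Im x| <= normc x.
Proof. by case: x => a b /=; rewrite -sqrtr_sqr ler_wsqrtr // lerDr sqr_ge0. Qed.

Lemma le_normc_ReIm (x : C) : normc x <= `|complex.Re x| + `|complex.Im x|.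
Proof.
rewrite [x in normc x]complexE (le_trans (le_normcD _ _)) //.
rewrite ComplexField.Normc.normcM !normc_real lerD2l.
by rewrite /= expr0n add0r expr1n sqrtr1 mul1r.
Qed.

Definition cint L (f : 'rV[R]_L -> C) : C :=
  Complex (torus_int (fun t => complex.Re (f t))) (torus_int (fun t => complex.Im (f t))).

Lemma cintD L (f g : 'rV[R]_L -> C) : ccont f -> ccont g ->
  cint (fun t => f t + g t) = cint f + cint g.
Proof.
move=> [f1 f2] [g1 g2]; apply: complexP => /=.
  by under eq_fun do rewrite ReD; exact: torus_intD.
by under eq_fun do rewrite ImD; exact: torus_intD.
Qed.

Lemma cintZ L (c : C) (f : 'rV[R]_L -> C) : ccont f ->
  cint (fun t => c * f t) = c * cint f.
Proof.
move=> [f1 f2]; have cZ r (g : _ -> R) : continuous g -> continuous (fun t : 'rV[R]_L => r * g t).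
  by move=> cg; apply: continuous_fctM => //; exact: continuous_fct_cst.
case: c => a b; apply: complexP => /=.
  under eq_fun do rewrite ReM /= -mulNr.
  by rewrite torus_intD ?torus_intZ ?mulNr //; exact: cZ.
under eq_fun do rewrite ImM /=.
by rewrite torus_intD ?torus_intZ //; exact: cZ.
Qed.

Lemma cint_sum L (I : Type) (s : seq I) (f : I -> 'rV[R]_L -> C) :
  (forall i, ccont (f i)) ->
  cint (fun t => \sum_(i <- s) f i t) = \sum_(i <- s) cint (f i).
Proof.
move=> cf; elim: s => [|i s IH].
  rewrite big_nil; under eq_fun do rewrite big_nil.
  by apply: complexP; rewrite /= torus_int_cst mulr0.
rewrite big_cons -IH -cintD //; last exact: ccont_sum.
by under eq_fun do rewrite big_cons.
Qed.

Lemma cint_norm L (f : 'rV[R]_L -> C) M : ccont f ->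
  (forall t, torus_box t -> normc (f t) <= M) -> normc (cint f) <= 2 * (2 * pi) ^+ L * M.
Proof.
move=> [f1 f2] hM; rewrite (le_trans (le_normc_ReIm _)) //= -mulrA mulr_natl mulr2n.
apply: lerD; apply: torus_int_norm => // t /hM; apply: le_trans.
  exact: le_Re_normc.
exact: le_Im_normc.
Qed.

Lemma dotDl n (x y z : 'rV[R]_n) : dot (x + y) z = dot x z + dot y z.
Proof. by rewrite /dot -big_split; apply: eq_bigr => j _; rewrite mxE mulrDl. Qed.

Lemma dotC n (x y : 'rV[R]_n) : dot x y = dot y x.
Proof. by apply: eq_bigr => j _; rewrite mulrC. Qed.

Lemma dotDr n (x y z : 'rV[R]_n) : dot z (x + y) = dot z x + dot z y.
Proof. by rewrite dotC dotDl !(dotC z). Qed.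

Lemma dotZl n a (x y : 'rV[R]_n) : dot (a *: x) y = a * dot x y.
Proof. by rewrite /dot mulr_sumr; apply: eq_bigr => j _; rewrite mxE mulrA. Qed.

Lemma dotZr n a (x y : 'rV[R]_n) : dot x (a *: y) = a * dot x y.
Proof. by rewrite dotC dotZl dotC. Qed.

Lemma dotNl n (x y : 'rV[R]_n) : dot (- x) y = - dot x y.
Proof. by rewrite -scaleN1r dotZl mulN1r. Qed.

Lemma dotNr n (x y : 'rV[R]_n) : dot x (- y) = - dot x y.
Proof. by rewrite dotC dotNl dotC. Qed.

Lemma dot0l n (x : 'rV[R]_n) : dot 0 x = 0.
Proof. by rewrite -(scale0r 0) dotZl mul0r. Qed.

Lemma dot0r n (x : 'rV[R]_n) : dot x 0 = 0.
Proof. by rewrite dotC dot0l. Qed.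

Lemma dot_delta n (x : 'rV[R]_n) j : dot x (delta_mx 0 j) = x 0 j.
Proof.
rewrite /dot (bigD1 j) //= big1 ?addr0 => [|k kj]; first by rewrite mxE !eqxx mulr1.
by rewrite mxE eqxx /= (negbTE kj) mulr0.
Qed.

Lemma intvD n (l m : 'rV[int]_n) : intv R (l + m) = intv R l + intv R m.
Proof. by apply/rowP => i; rewrite !mxE intrD. Qed.

Lemma intvN n (l : 'rV[int]_n) : intv R (- l) = - intv R l.
Proof. by apply/rowP => i; rewrite !mxE mulrNz. Qed.

Lemma intv0 n : intv R (0 : 'rV[int]_n) = 0.
Proof. by apply/rowP => i; rewrite !mxE. Qed.

Lemma continuous_fct_sum (T : topologicalType) (I : Type) (s : seq I) (f : I -> T -> R) :
  (forall i, continuous (f i)) -> continuous (fun x => \sum_(i <- s) f i x).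
Proof.
move=> cf; elim: s => [|i s IH].
  by under eq_fun do rewrite big_nil; exact: continuous_fct_cst.
by under eq_fun do rewrite big_cons; apply: continuous_fctD.
Qed.

Lemma continuous_dot n (x : 'rV[R]_n) : continuous (fun t => dot x t).
Proof.
apply: continuous_fct_sum => j; apply: continuous_fctM.
  exact: continuous_fct_cst.
exact: coord_continuous.
Qed.

Lemma ccont_expi : ccont (@expi R).
Proof. by split; [exact: continuous_cos|exact: continuous_sin]. Qed.

Lemma ccont_expi_dot n (x : 'rV[R]_n) : ccont (fun t => expi (dot x t)).
Proof. by apply: ccont_o; [exact: continuous_dot|exact: ccont_expi]. Qed.

Lemma periodic_expi_dot n (l : 'rV[int]_n) :
  torus_periodic (fun t => expi (dot (intv R l) t)).
Proof.
move=> j t; rewrite dotDr dotZr dot_delta mxE.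
by apply: (periodic_int (l 0 j)); exact: expi_per.
Qed.

Lemma periodicM n (f g : 'rV[R]_n -> C) : torus_periodic f -> torus_periodic g ->
  torus_periodic (fun t => f t * g t).
Proof. by move=> pf pg j t; rewrite pf pg. Qed.

(** Moving all variables at once; on the torus this is the translation
    invariance that diagonalizes difference operators. *)
Lemma cint_shift L (f : 'rV[R]_L -> C) w : ccont f -> torus_periodic f ->
  cint (fun t => f (t + w)) = cint f.
Proof.
move=> [f1 f2] pf; apply: complexP => /=.
  by apply: (torus_int_shift (f := fun t => complex.Re (f t))) => // j t; rewrite pf.
by apply: (torus_int_shift (f := fun t => complex.Im (f t))) => // j t; rewrite pf.
Qed.

Lemma cint_expi_dot L (l : 'rV[int]_L) :
  cint (fun t => expi (dot (intv R l) t)) = ((l == 0)%:R * (2 * pi) ^+ L)%:C%C.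
Proof.
have [->|/rV0Pn [j lj]] := eqVneq l 0.
  under eq_fun do rewrite intv0 dot0l expi0.
  by apply: complexP; rewrite /= torus_int_cst ?mulr0 // mulr1 mul1r.
rewrite mul0r; apply/eqP; rewrite eq_complex /=; apply/andP.
have cl := ccont_expi_dot (intv R l).
have := cint_shift ((pi / (l 0 j)%:~R) *: delta_mx 0 j) cl (@periodic_expi_dot _ l).
under eq_fun do rewrite dotDr dotZr dot_delta mxE divfK ?intr_eq0 // addrC expiD.
rewrite cintZ // /expi cospi sinpi => h.
have : cint (fun t => expi (dot (intv R l) t)) *+ 2 = 0.
  by rewrite mulr2n -{1}h -{2}[cint _]mul1r -mulrDl; apply/eqP;
     rewrite mulf_eq0; apply/orP; left; rewrite eq_complex /= addNr addr0 !eqxx.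
by move=> /eqP; rewrite mulrn_eq0 /= eq_complex /= => /andP[].
Qed.

Definition cfourier L (f : 'rV[R]_L -> C) (l : 'rV[int]_L) : C :=
  ((2 * pi) ^- L)%:C%C * cint (fun t => f t * expi (- dot (intv R l) t)).

Lemma ccont_fourier L (f : 'rV[R]_L -> C) l : ccont f ->
  ccont (fun t => f t * expi (- dot (intv R l) t)).
Proof.
by move=> cf; apply: ccontM => //; under eq_fun do rewrite -dotNl; exact: ccont_expi_dot.
Qed.

Lemma fourierE L (f : 'rV[R]_L -> R) l : continuous f ->
  fourier f l = cfourier (fun t => (f t)%:C%C) l.
Proof.
move=> cf; rewrite /fourier /cfourier; congr (_ * _); apply: complexP => /=.
  by congr torus_int; apply/funext => t; rewrite mul0r subr0 cosN.
rewrite -mulN1r -torus_intZ.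
  by congr torus_int; apply/funext => t; rewrite mul0r addr0 sinN; ring.
apply: continuous_fctM => //.
by apply: continuous_o; [exact: continuous_dot|exact: continuous_sin].
Qed.

Lemma cfourierD L (f g : 'rV[R]_L -> C) l : ccont f -> ccont g ->
  cfourier (fun t => f t + g t) l = cfourier f l + cfourier g l.
Proof.
move=> cf cg; rewrite /cfourier -mulrDr -cintD; do ?exact: ccont_fourier.
by under eq_fun do rewrite mulrDl.
Qed.

Lemma cfourierZ L c (f : 'rV[R]_L -> C) l : ccont f ->
  cfourier (fun t => c * f t) l = c * cfourier f l.
Proof.
move=> cf; rewrite /cfourier mulrCA -[c * cint _]cintZ; last exact: ccont_fourier.
by under eq_fun do rewrite -mulrA.
Qed.

Lemma cfourier_sum L (I : Type) (s : seq I) (f : I -> 'rV[R]_L -> C) l :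
  (forall i, ccont (f i)) ->
  cfourier (fun t => \sum_(i <- s) f i t) l = \sum_(i <- s) cfourier (f i) l.
Proof.
move=> cf; rewrite /cfourier -mulr_sumr -cint_sum; last by move=> i; exact: ccont_fourier.
by under eq_fun do rewrite mulr_suml.
Qed.

Lemma period_neq0 L : ((2 * pi) ^+ L : R) != 0.
Proof. by rewrite expf_neq0 // gt_eqF // period_gt0. Qed.

Lemma cfourier_expi L (l m : 'rV[int]_L) :
  cfourier (fun t => expi (dot (intv R l) t)) m = (l == m)%:R.
Proof.
rewrite /cfourier; under eq_fun do rewrite -expiD -dotNl -intvN -dotDl -intvD.
rewrite cint_expi_dot subr_eq0; apply: complexP; rewrite ?ReM ?ImM /=.
  by rewrite mul0r subr0 mulrCA mulVf ?period_neq0 // mulr1; case: (l == m).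
by rewrite mulr0 mul0r addr0; case: (l == m).
Qed.

Lemma cfourier_cst L c (m : 'rV[int]_L) : cfourier (fun _ => c) m = (m == 0)%:R * c.
Proof.
have := @cfourier_expi L 0 m; under eq_fun do rewrite intv0 dot0l expi0.
rewrite eq_sym => <-; rewrite mulrC -cfourierZ; last exact: ccont_cst.
by rewrite mulr1.
Qed.

Lemma continuous_shift L (w : 'rV[R]_L) : continuous (fun t : 'rV[R]_L => t + w).
Proof.
apply: continuous_mx => i j.
under eq_fun do rewrite mxE.
by apply: continuous_fctD; [exact: coord_continuous|exact: continuous_fct_cst].
Qed.

Lemma cfourier_shift L (f : 'rV[R]_L -> C) w l : ccont f -> torus_periodic f ->
  cfourier (fun t => f (t + w)) l = expi (dot (intv R l) w) * cfourier f l.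
Proof.
move=> cf pf; rewrite /cfourier mulrCA; congr (_ * _).
rewrite -(@cint_shift _ (fun t => f t * expi (- dot (intv R l) t)) w); last 2 first.
- exact: ccont_fourier.
- apply: periodicM => // j t; rewrite -!dotNl -intvN; exact: periodic_expi_dot.
rewrite -cintZ.
  congr cint; apply/funext => t; rewrite mulrCA -expiD; congr (_ * expi _).
  by rewrite dotDr; ring.
exact: (ccont_o (@continuous_shift _ w) (ccont_fourier l cf)).
Qed.

Lemma cfourier_norm L (f : 'rV[R]_L -> C) l M : ccont f ->
  (forall t, torus_box t -> normc (f t) <= M) -> normc (cfourier f l) <= 2 * M.
Proof.
move=> cf hM; rewrite /cfourier ComplexField.Normc.normcM normc_real.
have T0 : 0 < (2 * pi) ^+ L :> R by rewrite exprn_gt0 // period_gt0.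
rewrite ger0_norm ?invr_ge0 ?(ltW T0) // ler_pdivrMl //.
rewrite mulrA [_ * 2]mulrC; apply: cint_norm; first exact: ccont_fourier.
by move=> t /hM; rewrite ComplexField.Normc.normcM normc_expi mulr1.
Qed.

Lemma dot_rcons L x y (s t : 'rV[R]_L) :
  dot (rcons_torus x s) (rcons_torus y t) = x * y + dot s t.
Proof.
rewrite /dot big_ord_recl !rcons_torus0; congr (_ + _).
by apply: eq_bigr => i _; rewrite !rcons_torusS.
Qed.

(** The hypotheses are the real and imaginary parts of the vanishing of all
    Fourier coefficients of G1 + i G2; the frequencies m and -m together
    separate G1 from G2. *)
Lemma trig_orth_pair (G1 G2 : R -> R) : continuous G1 -> continuous G2 ->
  (forall m : int, \int[@lebesgue_measure R]_(y in `[0, 2 * pi])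
     (cos (m%:~R * y) * G1 y + sin (m%:~R * y) * G2 y) = 0 /\
    \int[@lebesgue_measure R]_(y in `[0, 2 * pi])
     (cos (m%:~R * y) * G2 y + - sin (m%:~R * y) * G1 y) = 0) ->
  trig_orth G1 /\ trig_orth G2.
Proof.
move=> c1 c2 orth.
pose A (G : R -> R) (m : int) : R :=
  \int[@lebesgue_measure R]_(y in `[0, 2 * pi]) (G y * cos (m%:~R * y)).
pose B (G : R -> R) (m : int) : R :=
  \int[@lebesgue_measure R]_(y in `[0, 2 * pi]) (G y * sin (m%:~R * y)).
have cc (G : R -> R) (m : int) : continuous G -> continuous (fun y => G y * cos (m%:~R * y)).
  by move=> cG; apply: continuous_fctM => //; exact: continuous_cosZ.
have cs (G : R -> R) (m : int) : continuous G -> continuous (fun y => G y * sin (m%:~R * y)).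
  by move=> cG; apply: continuous_fctM => //; exact: continuous_sinZ.
have h1 m : A G1 m + B G2 m = 0.
  rewrite -(int1D (cc _ _ c1) (cs _ _ c2)) -[RHS](proj1 (orth m)).
  by apply: eq_Rintegral => y _; ring.
have h2 m : A G2 m - B G1 m = 0.
  have cZ : continuous (fun y => (-1) * (G1 y * sin (m%:~R * y))).
    by apply: continuous_fctM; [exact: continuous_fct_cst|exact: cs].
  rewrite -mulN1r -(int1Z _ (cs _ m c1)) -(int1D (cc _ _ c2) cZ) -[RHS](proj2 (orth m)).
  by apply: eq_Rintegral => y _; ring.
have AN (G : R -> R) (m : int) : A G (- m) = A G m.
  by apply: eq_Rintegral => y _; rewrite mulrNz mulNr cosN.
have BN (G : R -> R) (m : int) : continuous G -> B G (- m) = - B G m.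
  move=> cG; rewrite -[- B G m]mulN1r -(int1Z _ (cs _ m cG)).
  by apply: eq_Rintegral => y _; rewrite mulrNz mulNr sinN; ring.
split=> m; rewrite -/(A _ m) -/(B _ m).
  by have := h1 m; have := h1 (- m); have := h2 m; have := h2 (- m);
    rewrite !AN !BN //; split; lra.
by have := h1 m; have := h1 (- m); have := h2 m; have := h2 (- m);
  rewrite !AN !BN //; split; lra.
Qed.

(** Induction on L: integrating out all variables but the first gives a
    function of one variable with vanishing Fourier coefficients, so the
    coefficients of every slice vanish. *)
Lemma cfourier_eq0 L (f : 'rV[R]_L -> C) : ccont f -> torus_periodic f ->
  (forall l, cfourier f l = 0) -> forall t, f t = 0.
Proof.
elim: L f => [|L IH] f cf pf f0 t.
  have := f0 0; rewrite /cfourier expr0 invr1 mul1r intv0.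
  under eq_fun do rewrite dot0l oppr0 expi0 mulr1.
  move=> [h1 h2]; have -> : t = 0 by apply/rowP; case.
  exact: complexP.
have f0' l : cint (fun t => f t * expi (- dot (intv R l) t)) = 0.
  have /eqP := f0 l; rewrite mulf_eq0 => /orP[|/eqP//].
  by rewrite eq_complex /= eqxx andbT invr_eq0 (negbTE (period_neq0 _)).
rewrite (rcons_torus_split t); move: (t 0 ord0) (\row_i _) => x t' {t}.
apply: (IH (fun s => f (rcons_torus x s))).
- by have [f1 f2] := cf; split; [exact: (continuous_rcons_slice f1)|exact: (continuous_rcons_slice f2)].
- move=> j s; rewrite -[RHS](pf (lift ord0 j)); congr f; apply/rowP => i.
  rewrite [RHS]mxE [in X in _ = _ + X]mxE [in X in _ = _ + X]mxE.
  case: (unliftP ord0 i) => [k|] ->.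
    by rewrite !rcons_torusS !mxE eqxx /= (inj_eq lift_inj).
  by rewrite !rcons_torus0 /= mulr0 addr0.
move=> l'.
pose ll (m : int) : 'rV[int]_L.+1 := \row_i oapp (fun k => l' 0 k) m (unlift ord0 i).
have intvll m : intv R (ll m) = rcons_torus m%:~R (intv R l').
  apply/rowP => i; rewrite [LHS]mxE [X in X%:~R]mxE.
  case: (unliftP ord0 i) => [k|] ->.
    by rewrite /= rcons_torusS mxE.
  by rewrite /= rcons_torus0.
pose g t := f t * expi (- dot (intv R (ll 0)) t).
have cg : ccont g by exact: ccont_fourier.
pose G1 x := torus_int (fun s => complex.Re (g (rcons_torus x s))).
pose G2 x := torus_int (fun s => complex.Im (g (rcons_torus x s))).
have cG1 : continuous G1 by exact: (continuous_torus_slice (proj1 cg)).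
have cG2 : continuous G2 by exact: (continuous_torus_slice (proj2 cg)).
have pG y (s : 'rV[R]_L) : g (rcons_torus (y + 2 * pi) s) = g (rcons_torus y s).
  have pg : torus_periodic g.
    by apply: periodicM => // j u; rewrite -!dotNl -intvN; exact: periodic_expi_dot.
  rewrite -[RHS](pg ord0); congr g; apply/rowP => i.
  rewrite [RHS]mxE [in X in _ = _ + X]mxE [in X in _ = _ + X]mxE.
  case: (unliftP ord0 i) => [k|] ->.
    by rewrite !rcons_torusS /= mulr0 addr0.
  by rewrite !rcons_torus0 eqxx mulr1.
have key (m : int) y (s : 'rV[R]_L) : let u := rcons_torus y s in
    f u * expi (- dot (intv R (ll m)) u) = expi (- (m%:~R * y)) * g u.
  rewrite /= /g !intvll !dot_rcons mulrCA -expiD; congr (_ * expi _); ring.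
have orth m : \int[@lebesgue_measure R]_(y in `[0, 2 * pi])
     (cos (m%:~R * y) * G1 y + sin (m%:~R * y) * G2 y) = 0 /\
    \int[@lebesgue_measure R]_(y in `[0, 2 * pi])
     (cos (m%:~R * y) * G2 y + - sin (m%:~R * y) * G1 y) = 0.
  have [h1 h2] := f0' (ll m).
  have s1 y : continuous (fun s => complex.Re (g (rcons_torus y s))).
    exact: (continuous_rcons_slice (proj1 cg)).
  have s2 y : continuous (fun s => complex.Im (g (rcons_torus y s))).
    exact: (continuous_rcons_slice (proj2 cg)).
  have cz (r : R) (h : 'rV[R]_L -> R) : continuous h -> continuous (fun s => r * h s).
    by move=> ch; apply: continuous_fctM => //; exact: continuous_fct_cst.
  split.
    rewrite -[RHS]h1; apply: eq_Rintegral => y _.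
    rewrite -(torus_intZ _ (s1 y)) -(torus_intZ _ (s2 y)) -(torus_intD (cz _ _ (s1 y)) (cz _ _ (s2 y))).
    congr torus_int; apply/funext => s.
    transitivity (complex.Re (expi (- (m%:~R * y)) * g (rcons_torus y s))); last by rewrite -key.
    by rewrite ReM /= cosN sinN; ring.
  rewrite -[RHS]h2; apply: eq_Rintegral => y _.
  rewrite -(torus_intZ _ (s1 y)) -(torus_intZ _ (s2 y)) -(torus_intD (cz _ _ (s2 y)) (cz _ _ (s1 y))).
  congr torus_int; apply/funext => s.
  transitivity (complex.Im (expi (- (m%:~R * y)) * g (rcons_torus y s))); last by rewrite -key.
  by rewrite ImM /= cosN sinN; ring.
have [orth1 orth2] := trig_orth_pair cG1 cG2 orth.
have G1p y : G1 (y + 2 * pi) = G1 y by congr torus_int; apply/funext => s; rewrite pG.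
have G2p y : G2 (y + 2 * pi) = G2 y by congr torus_int; apply/funext => s; rewrite pG.
have z1 := trig_orth_eq0 cG1 G1p orth1 x.
have z2 := trig_orth_eq0 cG2 G2p orth2 x.
rewrite /cfourier; apply/eqP; rewrite mulf_eq0; apply/orP; right; apply/eqP.
apply: complexP.
  rewrite -[RHS]z1; congr torus_int; apply/funext => s.
  by rewrite /g intvll dot_rcons mulr0z mul0r add0r.
rewrite -[RHS]z2; congr torus_int; apply/funext => s.
by rewrite /g intvll dot_rcons mulr0z mul0r add0r.
Qed.

Lemma cfourier_inj L (f g : 'rV[R]_L -> C) : ccont f -> ccont g ->
  torus_periodic f -> torus_periodic g ->
  (forall l, cfourier f l = cfourier g l) -> f =1 g.
Proof.
move=> cf cg pf pg fg t; apply/eqP; rewrite -subr_eq0; apply/eqP.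
rewrite -mulN1r; apply: (@cfourier_eq0 _ (fun t => f t + (-1) * g t)).
- by apply: ccontD => //; exact: ccontZ.
- by move=> j s; rewrite pf pg.
by move=> l; rewrite cfourierD ?cfourierZ ?fg ?mulN1r ?subrr //; exact: ccontZ.
Qed.

End ComplexFourier.

(** * Trigonometric polynomials with weighted coefficient norms *)

Section TrigPoly.
Variable R : realType.
Local Notation C := (complex R).
Local Notation normc := ComplexField.Normc.normc.

Lemma normcJ (x : C) : normc (conjc x) = normc x.
Proof. by case: x => a b /=; rewrite sqrrN. Qed.

Lemma normc_natV n : normc (n%:R^-1 : C) = n%:R^-1.
Proof.
rewrite ComplexField.Normc.normcV -(rmorph_nat (real_complex R)) normc_real.
by rewrite normr_nat.
Qed.

Lemma l1normD n (l m : 'rV[int]_n) : (l1norm (l + m) <= l1norm l + l1norm m)%N.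
Proof.
rewrite /l1norm -big_split /=; apply: leq_sum => j _; rewrite mxE.
by rewrite -lez_nat PoszD !abszE ler_normD.
Qed.

Lemma l1normN n (l : 'rV[int]_n) : l1norm (- l) = l1norm l.
Proof. by apply: eq_bigr => j _; rewrite mxE abszN. Qed.

Lemma l1norm0 n : l1norm (0 : 'rV[int]_n) = 0%N.
Proof. by apply: big1 => j _; rewrite mxE. Qed.

Lemma l1norm_eq0 n (l : 'rV[int]_n) : (l1norm l == 0%N) = (l == 0).
Proof.
apply/eqP/eqP => [|->]; last exact: l1norm0.
move=> h; apply/rowP => j; rewrite mxE; apply/eqP; rewrite -absz_eq0.
by have /eqP := h; rewrite sum_nat_eq0 => /forallP /(_ j).
Qed.

Variables (L D : nat) (K : 'M[int]_(L, D)) (kap : R).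
Hypothesis kap0 : 0 <= kap.

(** The frequency of the exponential of l restricted to the embedded torus. *)
Definition pull (l : 'rV[int]_D) : 'rV[int]_L := l *m K^T.

Definition embed (theta : 'rV[R]_L) : 'rV[R]_D := theta *m map_mx intr K.

Lemma dot_embed l theta : dot (intv R l) (embed theta) = dot (intv R (pull l)) theta.
Proof.
rewrite /dot /embed /pull.
under eq_bigr do rewrite [X in _ * X]mxE mulr_sumr.
under [RHS]eq_bigr do rewrite !mxE rmorph_sum mulr_suml.
rewrite exchange_big; apply: eq_bigr => i _; apply: eq_bigr => j _.
by rewrite !mxE rmorphM /=; ring.
Qed.

Lemma pullD l m : pull (l + m) = pull l + pull m.
Proof. exact: mulmxDl. Qed.

Lemma pullN l : pull (- l) = - pull l.
Proof. exact: mulNmx. Qed.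

Lemma pull0 : pull 0 = 0.
Proof. exact: mul0mx. Qed.

Definition emon (l : 'rV[int]_D) (theta : 'rV[R]_L) : C :=
  expi (dot (intv R (pull l)) theta).

Definition wexp (m : 'rV[int]_L) : R := expR (kap * (l1norm m)%:R).

Lemma wexp_ge1 m : 1 <= wexp m.
Proof. by rewrite -expR0 ler_expR mulr_ge0. Qed.

Lemma wexp_ge0 m : 0 <= wexp m.
Proof. exact: expR_ge0. Qed.

Lemma wexpD l m : wexp (l + m) <= wexp l * wexp m.
Proof.
rewrite /wexp -expRD ler_expR -mulrDr ler_wpM2l // -natrD ler_nat; exact: l1normD.
Qed.

Lemma emonD l m theta : emon (l + m) theta = emon l theta * emon m theta.
Proof. by rewrite /emon pullD intvD dotDl expiD. Qed.

Definition teval (s : seq (C * 'rV[int]_D)) (theta : 'rV[R]_L) : C :=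
  \sum_(x <- s) x.1 * emon x.2 theta.

Definition tnorm (s : seq (C * 'rV[int]_D)) : R :=
  \sum_(x <- s) normc x.1 * wexp (pull x.2).

(** A function on the L-torus that is the restriction to the embedded torus of a
    trigonometric polynomial of degree J in the ambient D angles, with weighted
    coefficient norm at most M. The degree is counted in ambient frequencies,
    the weight in the pulled back ones; the list may repeat frequencies. *)
Definition tp (J : nat) (M : R) (f : 'rV[R]_L -> C) : Prop :=
  exists s : seq (C * 'rV[int]_D),
    [/\ f =1 teval s, all (fun x => l1norm x.2 <= J)%N s & tnorm s <= M].

Lemma tp_ext J M f g : f =1 g -> tp J M f -> tp J M g.
Proof. by move=> fg [s [fs sJ sM]]; exists s; split => // t; rewrite -fg. Qed.

Lemma tnorm_ge0 s : 0 <= tnorm s.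
Proof. by apply: sumr_ge0 => x _; rewrite mulr_ge0 ?normc_ge0 ?wexp_ge0. Qed.

Lemma tp_ge0 J M f : tp J M f -> 0 <= M.
Proof. by move=> [s [_ _]]; apply: le_trans; exact: tnorm_ge0. Qed.

Lemma tp_le J J' M M' f : (J <= J')%N -> M <= M' -> tp J M f -> tp J' M' f.
Proof.
move=> JJ MM [s [fs sJ sM]]; exists s; split => //; last exact: le_trans MM.
by apply: sub_all sJ => x /leq_trans; apply.
Qed.

Lemma tp_mon l : tp (l1norm l) (wexp (pull l)) (emon l).
Proof.
exists [:: (1, l)]; split=> [t||].
- by rewrite /teval big_seq1 mul1r.
- by rewrite /= leqnn.
by rewrite /tnorm big_seq1 [normc _]ComplexField.Normc.normc1 mul1r.
Qed.

Lemma tp_cst c J M : normc c <= M -> tp J M (fun _ => c).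
Proof.
move=> cM; exists [:: (c, 0)]; split=> [t||].
- by rewrite /teval big_seq1 /emon pull0 intv0 dot0l expi0 mulr1.
- by rewrite /= l1norm0.
by rewrite /tnorm big_seq1 /= pull0 /wexp l1norm0 mulr0 expR0 mulr1.
Qed.

Lemma tp0 J : tp J 0 (fun _ => 0).
Proof. by apply: tp_cst; rewrite ComplexField.Normc.normc0. Qed.

Lemma tpD J M N f g : tp J M f -> tp J N g -> tp J (M + N) (fun t => f t + g t).
Proof.
move=> [s [fs sJ sM]] [s' [gs sJ' sM']]; exists (s ++ s'); split=> [t||].
- by rewrite fs gs /teval big_cat.
- by rewrite all_cat sJ.
by rewrite /tnorm big_cat lerD.
Qed.

Lemma tp_sum J (I : Type) (r : seq I) (M : I -> R) (f : I -> 'rV[R]_L -> C) :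
  (forall i, tp J (M i) (f i)) ->
  tp J (\sum_(i <- r) M i) (fun t => \sum_(i <- r) f i t).
Proof.
move=> h; elim: r => [|i r IH].
  by rewrite big_nil; apply: tp_ext (tp0 J) => t; rewrite big_nil.
by rewrite big_cons; apply: tp_ext (tpD (h i) IH) => t; rewrite big_cons.
Qed.

Lemma tpM J J' M N f g : tp J M f -> tp J' N g -> tp (J + J') (M * N) (fun t => f t * g t).
Proof.
move=> [s [fs sJ sM]] [s' [gs sJ' sM']].
exists [seq (x.1 * y.1, x.2 + y.2) | x <- s, y <- s']; split=> [t||].
- rewrite fs gs /teval big_allpairs_dep /= mulr_suml.
  apply: eq_bigr => x _; rewrite mulr_sumr; apply: eq_bigr => y _.
  by rewrite emonD; ring.
- apply/allP => z /allpairsP [[x y] [/= xs ys ->]] /=.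
  rewrite (leq_trans (l1normD _ _)) // leq_add //.
    exact: (allP sJ).
  exact: (allP sJ').
apply: le_trans (ler_pM (tnorm_ge0 _) (tnorm_ge0 _) sM sM').
rewrite /tnorm big_allpairs_dep /= mulr_suml; apply: ler_sum => x _.
rewrite mulr_sumr; apply: ler_sum => y _.
rewrite ComplexField.Normc.normcM mulrACA ler_wpM2l ?mulr_ge0 ?normc_ge0 //.
by rewrite pullD wexpD.
Qed.

Lemma tpZ J M c f : tp J M f -> tp J (normc c * M) (fun t => c * f t).
Proof. by move=> h; apply: (@tpM 0 J) => //; exact: tp_cst. Qed.

Lemma conj_expi (x : R) : conjc (expi x) = expi (- x).
Proof. by rewrite /expi cosN sinN. Qed.

Lemma tp_conj J M f : tp J M f -> tp J M (fun t => conjc (f t)).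
Proof.
move=> [s [fs sJ sM]]; exists [seq (conjc x.1, - x.2) | x <- s]; split=> [t||].
- rewrite fs /teval big_map rmorph_sum; apply: eq_bigr => x _ /=.
  rewrite rmorphM; congr (_ * _).
  by rewrite /emon pullN intvN dotNl; exact: conj_expi.
- by rewrite all_map; apply: sub_all sJ => x /=; rewrite l1normN.
rewrite /tnorm big_map; apply: le_trans sM; rewrite le_eqVlt; apply/orP; left; apply/eqP.
by apply: eq_bigr => x _; rewrite /= normcJ pullN /wexp l1normN.
Qed.

Lemma tp_Re J M f : tp J M f -> tp J M (fun t => (complex.Re (f t))%:C%C).
Proof.
move=> h; have := tpZ (2^-1) (tpD h (tp_conj h)).
rewrite normc_natV -mulr2n -[M *+ 2]mulr_natl mulrA mulVf ?mul1r ?pnatr_eq0 //.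
by apply: tp_ext => t; rewrite ReJ_add mulrC.
Qed.

Lemma tp_shift J M f w : tp J M f -> tp J M (fun t => f (t + w)).
Proof.
move=> [s [fs sJ sM]]; exists [seq (x.1 * emon x.2 w, x.2) | x <- s]; split=> [t||].
- rewrite fs /teval big_map; apply: eq_bigr => x _ /=.
  by rewrite /emon dotDr expiD; ring.
- by rewrite all_map; exact: sJ.
rewrite /tnorm big_map; apply: le_trans sM; rewrite le_eqVlt; apply/orP; left; apply/eqP.
by apply: eq_bigr => x _; rewrite /= ComplexField.Normc.normcM normc_expi mulr1.
Qed.

Lemma ccont_teval s : ccont (teval s).
Proof.
apply: ccont_sum => x; apply: ccontZ; exact: ccont_expi_dot.
Qed.

Lemma tp_ccont J M f : tp J M f -> ccont f.
Proof.
move=> [s [fs _ _]]; have -> : f = teval s by exact/funext.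
exact: ccont_teval.
Qed.

Lemma tp_periodic J M f : tp J M f -> torus_periodic f.
Proof.
move=> [s [fs _ _]] j t; rewrite !fs; apply: eq_bigr => x _.
by rewrite /emon; congr (_ * _); exact: periodic_expi_dot.
Qed.

Lemma tp_normc J M f t : tp J M f -> normc (f t) <= M.
Proof.
move=> [s [-> _ sM]]; apply: le_trans sM; rewrite (le_trans (le_normc_sum _ _)) //.
apply: ler_sum => x _; rewrite ComplexField.Normc.normcM normc_expi mulr1.
by rewrite ler_peMr ?normc_ge0 ?wexp_ge1.
Qed.

Lemma cfourier_teval s m : cfourier (teval s) m = \sum_(x <- s) x.1 * (pull x.2 == m)%:R.
Proof.
rewrite cfourier_sum; last by move=> x; apply: ccontZ; exact: ccont_expi_dot.
apply: eq_bigr => x _; rewrite cfourierZ; last exact: ccont_expi_dot.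
by rewrite cfourier_expi.
Qed.

(** Several ambient frequencies may pull back to the same one; collecting them
    only decreases the weighted sum. *)
Lemma tp_wiener J M f (r : seq 'rV[int]_L) : tp J M f -> uniq r ->
  \sum_(m <- r) normc (cfourier f m) * wexp m <= M.
Proof.
move=> [s [fs _ sM]] ur; have -> : f = teval s by exact/funext.
apply: le_trans sM.
apply: (@le_trans _ _ (\sum_(m <- r) \sum_(x <- s) (pull x.2 == m)%:R * (normc x.1 * wexp (pull x.2)))).
  apply: ler_sum => m _; rewrite cfourier_teval.
  apply: le_trans (ler_wpM2r (wexp_ge0 m) (le_normc_sum _ _)) _.
  rewrite mulr_suml; apply: ler_sum => x _; rewrite ComplexField.Normc.normcM.
  have [->|_] := eqVneq (pull x.2) m.
    by rewrite ComplexField.Normc.normc1 mulr1 mul1r.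
  by rewrite ComplexField.Normc.normc0 mulr0 !mul0r.
rewrite exchange_big; apply: ler_sum => x _ /=.
rewrite -mulr_suml -[leRHS]mul1r ler_wpM2r ?mulr_ge0 ?normc_ge0 ?wexp_ge0 //.
have [xr|xr] := boolP (pull x.2 \in r).
  rewrite (bigD1_seq _ xr ur) /= eqxx big1 ?addr0 // => m mx.
  by rewrite eq_sym (negbTE mx).
rewrite big1_seq // => m /andP[_ mr]; case: eqVneq => // xm.
by move: xr; rewrite xm mr.
Qed.

Lemma tp_cfourier J M f m : tp J M f -> normc (cfourier f m) <= M.
Proof.
move=> h; have := tp_wiener h (isT : uniq [:: m]); rewrite big_seq1; apply: le_trans.
by rewrite ler_peMr ?normc_ge0 ?wexp_ge1.
Qed.

(** The eigenvalue of the second difference with step w on the exponential of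
    frequency m. *)
Definition divisor (w : 'rV[R]_L) (m : 'rV[int]_L) : R :=
  2 * cos (dot (intv R m) w) - 2.

Lemma expi_sdiff (x a : R) :
  expi (x + a) + expi (x - a) - 2 * expi x = (2 * cos a - 2)%:C%C * expi x.
Proof.
by apply: complexP; rewrite !(ReD, ImD, ReM, ImM) /= ?cosD ?sinD ?cosN ?sinN; ring.
Qed.

Lemma cfourier_sdiff w (f : 'rV[R]_L -> C) m : ccont f -> torus_periodic f ->
  cfourier (fun t => f (t + w) + f (t - w) - 2 * f t) m = (divisor w m)%:C%C * cfourier f m.
Proof.
move=> cf pf.
have c1 := ccont_o (@continuous_shift _ _ w) cf.
have c2 := ccont_o (@continuous_shift _ _ (- w)) cf.
under eq_fun do rewrite -mulNr.
rewrite !cfourierD ?cfourierZ ?cfourier_shift //; do ?[exact: ccontZ|exact: ccontD].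
have := expi_sdiff 0 (dot (intv R m) w); rewrite expi0 !add0r !mulr1 => h.
by rewrite [divisor w m]/divisor -h dotNr; ring.
Qed.

(** The resonant coefficients, those with pulled back frequency 0, are dropped:
    together they form the average of f. *)
Lemma tp_inv J M B w (f : 'rV[R]_L -> C) : tp J M f ->
  (forall l, (l1norm l <= J)%N -> pull l != 0 ->
     divisor w (pull l) != 0 /\ `|divisor w (pull l)|^-1 <= B) -> 0 <= B ->
  exists g, [/\ tp J (B * M) g,
    (forall t, g (t + w) + g (t - w) - 2 * g t = f t - cfourier f 0) & cfourier g 0 = 0].
Proof.
move=> [s [fs sJ sM]] hB B0; have fE : f = teval s by exact/funext.
exists (teval [seq (x.1 / (divisor w (pull x.2))%:C%C, x.2) | x <- s & pull x.2 != 0]).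
split.
- eexists; split; first by [].
    rewrite all_map; apply/allP => x; rewrite mem_filter => /andP[_ xs] /=.
    exact: (allP sJ).
  rewrite /tnorm big_map big_filter.
  apply: le_trans (ler_wpM2l B0 sM); rewrite /tnorm mulr_sumr.
  rewrite big_mkcond big_seq [leRHS]big_seq; apply: ler_sum => x xs /=.
  have h0 : 0 <= B * (normc x.1 * wexp (pull x.2)).
    by rewrite !mulr_ge0 ?normc_ge0 ?wexp_ge0.
  case: ifP => // px; have [_ hx] := hB _ (allP sJ _ xs) px.
  rewrite ComplexField.Normc.normcM ComplexField.Normc.normcV normc_real.
  by rewrite mulrAC [leLHS]mulrC ler_wpM2r ?mulr_ge0 ?normc_ge0 ?wexp_ge0.
- move=> t; rewrite fE cfourier_teval /teval !big_map !big_filter.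
  rewrite mulr_sumr -!sumrN -!big_split /= big_mkcond /=.
  rewrite big_seq [RHS]big_seq; apply: eq_bigr => x xs.
  have [px|px] := eqVneq (pull x.2) 0.
    by rewrite /= /emon px intv0 dot0l expi0 subrr.
  have [dx _] := hB _ (allP sJ _ xs) px.
  have dn0 : (divisor w (pull x.2))%:C%C != 0 by rewrite eq_complex /= eqxx andbT.
  have h := expi_sdiff (dot (intv R (pull x.2)) t) (dot (intv R (pull x.2)) w).
  rewrite /= mulr0 subr0 /emon dotDr dotDr dotNr.
  transitivity (x.1 / (divisor w (pull x.2))%:C%C *
    ((divisor w (pull x.2))%:C%C * expi (dot (intv R (pull x.2)) t))).
    by rewrite [in X in _ = _ * (X * _)]/divisor -h; ring.
  by rewrite mulrA divfK.
rewrite cfourier_teval big_map big_filter big1 // => x px.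
by rewrite /= (negbTE px) mulr0.
Qed.

End TrigPoly.

(** * Taylor coefficients of the exponential of a power series *)

Section ExpCoef.
Variable F : fieldType.
Implicit Types (P Q : {poly F}) (x y : nat -> F).

Lemma coef_exp_eq P Q n m : (forall k, (k <= n)%N -> P`_k = Q`_k) ->
  (P ^+ m)`_n = (Q ^+ m)`_n.
Proof.
move=> PQ; elim: m n PQ => [|m IH] n PQ; first by rewrite !expr0.
rewrite !exprS !coefM; apply: eq_bigr => i _.
rewrite PQ ?leq_ord // IH // => k kn; apply: PQ; lia.
Qed.

Lemma coef_exp_lt P n m : P`_0 = 0 -> (n < m)%N -> (P ^+ m)`_n = 0.
Proof.
move=> P0; elim: m n => [//|m IH] n nm; rewrite exprS coefM big1 // => -[[|i] /= ni] _.
  by rewrite P0 mul0r.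
by rewrite IH ?mulr0 //; lia.
Qed.

Lemma coef_exp_eq_strict P Q n m : P`_0 = 0 -> Q`_0 = 0 -> (1 < m)%N ->
  (forall k, (k < n)%N -> P`_k = Q`_k) -> (P ^+ m)`_n = (Q ^+ m)`_n.
Proof.
move=> P0 Q0; case: m => [|[|m]] // _ PQ.
rewrite [P ^+ _]exprS [Q ^+ _]exprS !coefM; apply: eq_bigr => -[[|i] /= ni] _.
  by rewrite P0 Q0 !mul0r.
have [iN|iN] := eqVneq i.+1 n.
  by rewrite iN subnn !coef_exp_lt ?mulr0.
rewrite PQ; last by lia.
congr (_ * _); apply: coef_exp_eq => k kn; apply: PQ; lia.
Qed.

(** The truncated exponential series, applied to a polynomial. *)
Definition pexp M P : {poly F} := \sum_(m < M.+1) (m`!%:R)^-1 *: P ^+ m.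

Lemma coef_pexp M P n : (pexp M P)`_n = \sum_(m < M.+1) (m`!%:R)^-1 * (P ^+ m)`_n.
Proof. by rewrite /pexp coef_sum; apply: eq_bigr => m _; rewrite coefZ. Qed.

(** The coefficient of e^n in exp (sum_k x_k e^k) when x_0 = 0. Truncation of both
    series at n makes this a finite expression. *)
Definition ecoef x n : F := (pexp n (\poly_(k < n.+1) x k))`_n.

Lemma ecoef_eq x y n : (forall k, (k <= n)%N -> x k = y k) -> ecoef x n = ecoef y n.
Proof.
move=> xy; rewrite /ecoef !coef_pexp; apply: eq_bigr => m _; congr (_ * _).
by apply: coef_exp_eq => k kn; rewrite !coef_poly ltnS kn xy.
Qed.

Lemma ecoef0 x : ecoef x 0 = 1.
Proof. by rewrite /ecoef coef_pexp big_ord1 expr0 invr1 mul1r coef1. Qed.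

Lemma ecoef_trunc x n N M : x 0%N = 0 -> (n <= N)%N -> (n <= M)%N ->
  (pexp M (\poly_(k < N.+1) x k))`_n = ecoef x n.
Proof.
move=> x0 nN nM; rewrite /ecoef !coef_pexp.
rewrite (big_ord_widen_cond M.+1 predT
  (fun m => (m`!%:R)^-1 * (((\poly_(k < n.+1) x k) ^+ m)`_n))) ?ltnS //=.
rewrite [RHS]big_mkcond /=; apply: eq_bigr => m _; rewrite ltnS; case: leqP => nm.
  by congr (_ * _); apply: coef_exp_eq => k kn; rewrite !coef_poly !ltnS kn (leq_trans kn).
by rewrite coef_exp_lt ?mulr0 // coef_poly /= x0.
Qed.

(** Since x_0 = 0, a product of two or more terms of total degree n cannot contain
    x_n; so x_n enters the n-th coefficient through the linear term only. *)
Lemma ecoef_lin x y n : (0 < n)%N -> x 0%N = 0 -> y 0%N = 0 ->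
  (forall k, (k < n)%N -> x k = y k) -> ecoef x n - ecoef y n = x n - y n.
Proof.
move=> n0 x0 y0 xy; rewrite /ecoef !coef_pexp -sumrB.
case: n n0 xy => // n _ xy.
rewrite !big_ord_recl /= /bump /= !expr0 !expr1 subrr add0r factS fact0 invr1 !mul1r.
rewrite !coef_poly ltnSn big1 ?addr0 // => i _.
apply/eqP; rewrite subr_eq0; apply/eqP; congr (_ * _).
apply: coef_exp_eq_strict => //; rewrite ?coef_poly ?x0 ?y0 //.
by move=> k kn; rewrite !coef_poly xy.
Qed.

Lemma horner_pexp M P a : (pexp M P).[a] = \sum_(m < M.+1) (m`!%:R)^-1 * P.[a] ^+ m.
Proof.
by rewrite /pexp horner_sum; apply: eq_bigr => m _; rewrite hornerZ horner_exp.
Qed.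

Lemma size_pexp M N P : (size P <= N.+1)%N -> (size (pexp M P) <= (N * M).+1)%N.
Proof.
move=> sP; apply: (leq_trans (size_sum _ _ _)); apply/bigmax_leqP => m _.
apply: leq_trans (size_scale_leq _ _) _; apply: leq_trans (size_poly_exp_leq _ _) _.
rewrite ltnS leq_mul //; [lia|exact: leq_ord].
Qed.

End ExpCoef.

(** * Majorants for exponentials of trigonometric series *)

Section Majorant.
Variable R : realType.
Local Notation C := (complex R).
Local Notation normc := ComplexField.Normc.normc.
Variables (L D : nat) (K : 'M[int]_(L, D)) (kap : R).
Hypothesis kap0 : 0 <= kap.
Variable J : nat.
Local Notation tp := (tp K kap).

(** A polynomial in e whose coefficients are trigonometric polynomials, with the
    degree growing by J per power of e, is majorized coefficientwise by a real
    polynomial; majorants multiply. *)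
Definition maj (P : 'rV[R]_L -> {poly C}) (B : {poly R}) : Prop :=
  forall n, tp (n * J) B`_n (fun t => (P t)`_n).

Lemma majM P Q A B : maj P A -> maj Q B -> maj (fun t => P t * Q t) (A * B).
Proof.
move=> hP hQ n; rewrite coefM.
apply: tp_ext (_ : tp _ _ (fun t => \sum_(i < n.+1) (P t)`_i * (Q t)`_(n - i))).
  by move=> t; rewrite coefM.
apply: tp_sum => i; apply: (@tp_le _ _ _ _ _ (i * J + (n - i) * J)) (tpM kap0 _ _) => //.
  by rewrite -mulnDl subnKC // leq_ord.
Qed.

Lemma maj1 : maj (fun _ => 1) 1.
Proof.
move=> n; rewrite coef1; under eq_fun do rewrite coef1.
by apply: tp_cst; case: (n == 0)%N; rewrite ?ComplexField.Normc.normc1 ?ComplexField.Normc.normc0.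
Qed.

Lemma majX P B m : maj P B -> maj (fun t => P t ^+ m) (B ^+ m).
Proof.
move=> h; elim: m => [|m IH]; first exact: maj1.
by rewrite exprS => n; under eq_fun do rewrite exprS; exact: majM.
Qed.

Lemma maj_pexp M P B : maj P B -> maj (fun t => pexp M (P t)) (pexp M B).
Proof.
move=> h n; rewrite coef_pexp.
apply: tp_ext (_ : tp _ _ (fun t => \sum_(m < M.+1) (m`!%:R)^-1 * (P t ^+ m)`_n)).
  by move=> t; rewrite coef_pexp.
apply: tp_sum => m; rewrite -normc_natV; apply: tpZ => //; exact: majX.
Qed.

Lemma maj_poly (x : nat -> 'rV[R]_L -> C) (b : nat -> R) N :
  (forall k, (k <= N)%N -> tp (k * J) (b k) (x k)) ->
  maj (fun t => \poly_(k < N.+1) x k t) (\poly_(k < N.+1) b k).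
Proof.
move=> h n; rewrite coef_poly; under eq_fun do rewrite coef_poly.
by case: ltnP => nN; [exact: h|exact: tp0].
Qed.

Lemma tp_ecoef (x : nat -> 'rV[R]_L -> C) (b : nat -> R) n :
  (forall k, (k <= n)%N -> tp (k * J) (b k) (x k)) ->
  tp (n * J) (ecoef b n) (fun t => ecoef (fun k => x k t) n).
Proof. by move=> h; exact: (maj_pexp n (maj_poly h)). Qed.

(** The polynomial of degree N M in e has ecoef as its coefficients up to order
    N; the remaining ones carry at least the factor |e|^(N+1), and the sum of
    their majorants is at most the value of the majorant at e = 1. *)
Lemma tp_pexp_rem (x : nat -> 'rV[R]_L -> C) (b : nat -> R) N M (e : R) :
  (forall k, (k <= N)%N -> tp (k * J) (b k) (x k)) ->
  (forall t, x 0%N t = 0) -> `|e| <= 1 -> (N <= M)%N ->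
  exists J', tp J' (`|e| ^+ N.+1 * \sum_(m < M.+1) (m`!%:R)^-1 * (\sum_(k < N.+1) b k) ^+ m)
    (fun t => \sum_(m < M.+1) (m`!%:R)^-1 * (\sum_(k < N.+1) e%:C%C ^+ k * x k t) ^+ m -
              \sum_(n < N.+1) e%:C%C ^+ n * ecoef (fun k => x k t) n).
Proof.
move=> h x0 e1 NM; have hM := maj_pexp M (maj_poly h).
set P := (fun t => \poly_(k < N.+1) x k t) in hM.
set B := \poly_(k < N.+1) b k in hM.
have e0 : 0 <= `|e| by exact: normr_ge0.
pose S := (N * M).+1; exists (S * J)%N.
have hB : \sum_(m < M.+1) (m`!%:R)^-1 * (\sum_(k < N.+1) b k) ^+ m = \sum_(n < S) (pexp M B)`_n.
  have := horner_pexp M B 1; rewrite (@horner_coef_wide _ S) ?size_pexp ?size_poly //.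
  under eq_bigr do rewrite expr1n mulr1.
  move=> ->; apply: eq_bigr => m _; congr (_ * _ ^+ _).
  by rewrite horner_poly; apply: eq_bigr => k _; rewrite expr1n mulr1.
rewrite hB mulr_sumr.
apply: tp_ext (_ : tp _ _ (fun t => \sum_(n < S) if (n <= N)%N then 0 else e%:C%C ^+ n * (pexp M (P t))`_n)).
  move=> t.
  have := horner_pexp M (P t) e%:C%C.
  rewrite (@horner_coef_wide _ S) ?size_pexp ?size_poly // => hS.
  transitivity (\sum_(n < S) (pexp M (P t))`_n * e%:C%C ^+ n -
     \sum_(n < N.+1) e%:C%C ^+ n * ecoef (fun k => x k t) n); last first.
    rewrite hS; congr (_ - _); apply: eq_bigr => m _; congr (_ * _ ^+ _).
    by rewrite horner_poly; apply: eq_bigr => k _; rewrite mulrC.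
  have NS : (N.+1 <= S \/ M = 0)%N by rewrite /S; case: (M) NM => [|M']; [right|left; nia].
  have [NS1|M0] := NS; last first.
    have N0 : N = 0%N by lia.
    rewrite /S N0 M0 !big_ord1 /= coef_pexp big_ord1 !expr0 ecoef0 invr1 !mul1r.
    by rewrite coef1 mulr1 subrr.
  rewrite [X in _ = _ - X](big_ord_widen_cond S predT
    (fun n => e%:C%C ^+ n * ecoef (fun k => x k t) n)) //= [X in _ = _ - X]big_mkcond /=.
  rewrite -sumrB; apply: eq_bigr => n _; rewrite ltnS; case: leqP => nN; last by rewrite subr0 mulrC.
  by rewrite /P ecoef_trunc // ?(leq_trans nN) // mulrC subrr.
apply: tp_sum => -[n /= nS]; case: leqP => nN.
  by apply: tp_cst; rewrite ComplexField.Normc.normc0 mulr_ge0 ?exprn_ge0 ?(tp_ge0 (hM n)).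
apply: (@tp_le _ _ _ _ _ (n * J) _ (normc (e%:C%C ^+ n) * (pexp M B)`_n)).
- by rewrite leq_mul2r ltnW ?orbT.
- rewrite normcX normc_real ler_wpM2r ?(tp_ge0 (hM n)) //.
  exact: ler_wiXn2l.
by apply: tpZ => //; exact: hM.
Qed.

End Majorant.

(** * Taylor expansion of the imaginary exponential *)

Section ExpiTaylor.
Variable R : realType.
Local Notation C := (complex R).
Local Notation normc := ComplexField.Normc.normc.

Lemma le_primitive (f f' g g' : R -> R) (y : R) : 0 <= y ->
  (forall x : R, is_derive x 1 f (f' x)) -> (forall x : R, is_derive x 1 g (g' x)) ->
  f 0 = 0 -> g 0 = 0 -> (forall x, 0 <= x -> f' x <= g' x) -> f y <= g y.
Proof.
move=> y0 df dg f0 g0 fg; have [->|yn0] := eqVneq y 0; first by rewrite f0 g0.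
have {yn0}y0 : 0 < y by rewrite lt_neqAle eq_sym yn0.
pose h x := f x - g x.
have dh (x : R) : is_derive x 1 h (f' x - g' x) by apply: is_deriveB.
have [|c] := @MVT R h (fun x => f' x - g' x) 0 y y0 (fun x _ => dh x).
  by apply: derivable_within_continuous => x _; have [] := dh x.
rewrite in_itv /= => /andP[c0 _]; rewrite /h f0 g0 subrr !subr0 => hE.
by rewrite -subr_le0 hE mulr_le0_ge0 ?(ltW y0) // subr_le0 fg // ltW.
Qed.

(** Taylor remainders are obtained by repeated integration of a bound between
    derivatives. *)
Lemma norm_le_primitive (f f' g g' : R -> R) (y : R) : 0 <= y ->
  (forall x : R, is_derive x 1 f (f' x)) -> (forall x : R, is_derive x 1 g (g' x)) ->
  f 0 = 0 -> g 0 = 0 -> (forall x, 0 <= x -> `|f' x| <= g' x) -> `|f y| <= g y.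
Proof.
move=> y0 df dg f0 g0 fg; rewrite ler_norml; apply/andP; split.
  rewrite lerNl; apply: (@le_primitive (fun x => - f x) (fun x => - f' x) g g') => //.
  - by rewrite f0 oppr0.
  - by move=> x /fg; rewrite ler_norml => /andP[]; rewrite lerNl.
apply: (@le_primitive f f' g g') => // x /fg.
by rewrite ler_norml => /andP[].
Qed.

Definition taylor (c : nat -> R) M : {poly R} := \poly_(m < M) (c m / m`!%:R).

Lemma is_derive_taylor c M (x : R) :
  is_derive x 1 (horner (taylor c M.+1)) (taylor (fun m => c m.+1) M).[x].
Proof.
have <- : (taylor c M.+1)^`() = taylor (fun m => c m.+1) M.
  apply/polyP => i; rewrite coef_deriv !coef_poly ltnS; case: ifP => _; last by rewrite mul0rn.
  have a0 : i.+1%:R != 0 :> R by rewrite pnatr_eq0.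
  have b0 : i`!%:R != 0 :> R by rewrite pnatr_eq0 -lt0n fact_gt0.
  rewrite -[LHS]mulr_natr factS natrM; move: (i.+1%:R) (i`!%:R) a0 b0 => a b a0 b0.
  by field; rewrite a0 b0.
rewrite derivE derive1E; apply/derivableP; exact: derivable_horner.
Qed.

(** The size of the first omitted term of the exponential series. *)
Definition powfact M (x : R) := x ^+ M / M`!%:R.

Lemma is_derive_powfact M (x : R) : is_derive x 1 (powfact M.+1) (powfact M x).
Proof.
have h := is_derive_taylor (fun m => (m == M.+1)%:R) M.+1 x.
have h1 : horner (taylor (fun m => (m == M.+1)%:R) M.+2) = powfact M.+1.
  apply/funext => y; rewrite horner_poly big_ord_recr /= big1 ?add0r => [|i _].
    by rewrite eqxx mul1r mulrC.
  by rewrite (ltn_eqF (ltn_ord i)) !mul0r.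
have h2 : (taylor (fun m => (m.+1 == M.+1)%:R) M.+1).[x] = powfact M x.
  rewrite horner_poly big_ord_recr /= big1 ?add0r => [|i _].
    by rewrite eqxx mul1r mulrC.
  by rewrite eqSS (ltn_eqF (ltn_ord i)) !mul0r.
by rewrite h1 h2 in h.
Qed.

Definition repow m : R := complex.Re (('i%C : C) ^+ m).
Definition impow m : R := complex.Im (('i%C : C) ^+ m).

Lemma repowS m : repow m.+1 = - impow m.
Proof. by rewrite /repow /impow exprS ReM /= mul0r mul1r sub0r. Qed.

Lemma impowS m : impow m.+1 = repow m.
Proof. by rewrite /repow /impow exprS ImM /= mul0r mul1r add0r. Qed.

(** Simultaneous induction: up to sign, the remainders of cos and sin are
    primitives of each other. *)
Lemma trig_taylor_ge0 M (y : R) : 0 <= y ->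
  `|cos y - (taylor repow M).[y]| <= powfact M y /\
  `|sin y - (taylor impow M).[y]| <= powfact M y.
Proof.
elim: M y => [|M IH] y y0.
  rewrite /powfact expr0 fact0 divr1 !horner_poly !big_ord0 !subr0.
  by split; [exact: cos_max|exact: sin_max].
have t0 (c : nat -> R) : (taylor c M.+1).[0] = c 0%N.
  rewrite horner_poly big_ord_recl /= expr0 mulr1 fact0 divr1 big1 ?addr0 // => i _.
  by rewrite expr0n mulr0.
have p0 : powfact M.+1 0 = 0 by rewrite /powfact expr0n mul0r.
split.
  apply: (@norm_le_primitive (fun x => cos x - (taylor repow M.+1).[x])
    (fun x => - sin x - (taylor (fun m => repow m.+1) M).[x]) _ (powfact M)) => //.
  - by move=> x; have := is_derive_taylor repow M x; exact: is_deriveB.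
  - exact: is_derive_powfact.
  - by rewrite t0 cos0 /repow expr0 subrr.
  move=> x x0; have [_] := IH x x0; rewrite -normrN; congr (`|_| <= _).
  rewrite opprB addrC; congr (_ + _); rewrite !horner_poly -sumrN.
  by apply: eq_bigr => i _; rewrite repowS !mulNr opprK.
apply: (@norm_le_primitive (fun x => sin x - (taylor impow M.+1).[x])
  (fun x => cos x - (taylor (fun m => impow m.+1) M).[x]) _ (powfact M)) => //.
- by move=> x; have := is_derive_taylor impow M x; exact: is_deriveB.
- exact: is_derive_powfact.
- by rewrite t0 sin0 /impow expr0 subrr.
move=> x x0; have [+ _] := IH x x0; congr (`|_ - _| <= _).
by rewrite !horner_poly; apply: eq_bigr => i _; rewrite impowS.
Qed.

Definition expi_sum M (y : R) : C := \sum_(m < M) (m`!%:R)^-1 * ('i%C * y%:C%C) ^+ m.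

Lemma ReZr (a : R) (z : C) : complex.Re (a%:C%C * z) = a * complex.Re z.
Proof. by rewrite ReM /= mul0r subr0. Qed.

Lemma ImZr (a : R) (z : C) : complex.Im (a%:C%C * z) = a * complex.Im z.
Proof. by rewrite ImM /= mul0r addr0. Qed.

Lemma Re_sum (I : Type) (s : seq I) (f : I -> C) :
  complex.Re (\sum_(i <- s) f i) = \sum_(i <- s) complex.Re (f i).
Proof. by elim: s => [|i s IH]; rewrite ?big_nil // !big_cons ReD IH. Qed.

Lemma Im_sum (I : Type) (s : seq I) (f : I -> C) :
  complex.Im (\sum_(i <- s) f i) = \sum_(i <- s) complex.Im (f i).
Proof. by elim: s => [|i s IH]; rewrite ?big_nil // !big_cons ImD IH. Qed.

Lemma expi_sumE M y : expi_sum M y = Complex (taylor repow M).[y] (taylor impow M).[y].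
Proof.
have e m : ((m`!%:R)^-1 : C) * ('i%C * y%:C%C) ^+ m = (m`!%:R^-1 * y ^+ m)%:C%C * 'i%C ^+ m.
  by rewrite rmorphM fmorphV rmorph_nat rmorphXn exprMn -mulrA [X in _ * X = _]mulrC.
rewrite /expi_sum !horner_poly; apply: complexP => /=.
  rewrite Re_sum; apply: eq_bigr => m _.
  by rewrite e ReZr -/(repow m); ring.
rewrite Im_sum; apply: eq_bigr => m _.
by rewrite e ImZr -/(impow m); ring.
Qed.

Lemma expi_taylor M y : normc (expi y - expi_sum M y) <= 2 * powfact M `|y|.
Proof.
have ge0 x : 0 <= x -> normc (expi x - expi_sum M x) <= 2 * powfact M x.
  move=> x0; have [h1 h2] := trig_taylor_ge0 M x0.
  rewrite (le_trans (le_normc_ReIm _)) // expi_sumE /= mulr_natl mulr2n.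
  by rewrite lerD.
have [y0|y0] := leP 0 y; first by rewrite ger0_norm // ge0.
have e : conjc (expi y - expi_sum M y) = expi (- y) - expi_sum M (- y).
  rewrite rmorphB; congr (_ - _); first exact: conj_expi.
  rewrite /expi_sum rmorph_sum; apply: eq_bigr => m _.
  rewrite rmorphM fmorphV rmorph_nat rmorphXn rmorphM; congr (_ * _ ^+ _).
  by apply: complexP; rewrite ?ReM ?ImM /=; ring.
rewrite ltr0_norm // -normcJ e.
by apply: ge0; rewrite oppr_ge0 ltW.
Qed.

Lemma cos_le_quadratic (y : R) : `|y| <= 1 -> 1 - cos y >= 11 / 24 * y ^+ 2.
Proof.
move=> y1; rewrite -(cos_norm y) -(real_normK (num_real y)).
set x := `|y| in y1 *; have x0 : 0 <= x by exact: normr_ge0.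
have [+ _] := trig_taylor_ge0 4 x0; rewrite horner_poly !big_ord_recr big_ord0 /=.
rewrite !repowS !impowS /repow /impow !expr0 expr1 /= /powfact.
rewrite !factS fact0 ler_norml => /andP[_].
have : x ^+ 4 <= x ^+ 2 by rewrite -[4%N]/(2 + 2)%N exprD ler_piMr ?exprn_ge0 // exprn_ile1.
by rewrite /=; lra.
Qed.

(** The constant 1/64 is far from optimal; on [1, pi] it suffices that
    cos y <= cos 1 and pi <= 4. *)
Lemma cos_le_quadratic_pi (y : R) : `|y| <= pi -> 1 - cos y >= y ^+ 2 / 64.
Proof.
move=> ypi; have [y1|/ltW y1] := leP `|y| 1.
  have := cos_le_quadratic y1; have := sqr_ge0 y; lra.
have c1 : 1 - cos 1 >= 11 / 24 :> R.
  by have := @cos_le_quadratic 1; rewrite normr1 expr1n mulr1; apply.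
have cy : cos y <= cos 1.
  rewrite -(cos_norm y) leNgt ltr_cos -?leNgt // in_itv /= ?normr_ge0 //.
  by rewrite ler01 /=; have := @pi_ge2 R; lra.
have y4 : y ^+ 2 <= 16.
  rewrite -(real_normK (num_real y)); have p4 : `|y| <= 4.
    by apply: le_trans ypi _; have := @pihalf_lt2 R; lra.
  by rewrite (_ : 16 = 4 ^+ 2) ?lerXn2r ?nnegrE // -natrX.
lra.
Qed.

Lemma exp_sum_le (x : R) M : 0 <= x ->
  \sum_(m < M) (m`!%:R)^-1 * x ^+ m <= expR x.
Proof.
move=> x0; have := nondecreasing_cvgn_le (u_ := series (exp_coeff x)).
move=> /(_ _ (is_cvg_series_exp_coeff x) M) h.
rewrite /expR; apply: le_trans (h _).
  by rewrite /series /= big_mkord exp_coeffE.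
by apply: nondecreasing_series => n _ _; exact: exp_coeff_ge0.
Qed.

Lemma powfact_cvg0 (x : R) : powfact n x @[n --> \oo] --> 0.
Proof.
by have := cvg_exp_coeff x; rewrite exp_coeffE; under eq_fun do rewrite mulrC.
Qed.

End ExpiTaylor.

(** * Small divisors *)

Section Divisors.
Variable R : realType.

Lemma divisor_neq0 L (w : 'rV[R]_L) (m : 'rV[int]_L) :
  irrational_multiple w -> m != 0 -> divisor w m != 0.
Proof.
move=> hw m0; apply/eqP => h.
have [|n hn] := @cos_eq1 R (dot (intv R m) w); first by move: h; rewrite /divisor; lra.
by have /eqP := hw m n m0.
Qed.

Lemma diophantine_irrational L (w : 'rV[R]_L) :
  diophantine_multiple w -> irrational_multiple w.
Proof.
move=> [w' [nu [tau [-> _ _ h]]]] m n m0; rewrite dotZr.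
have [+ _] := h m n m0; rewrite subr_eq0; apply: contra => /eqP e.
by apply/eqP; apply: (mulfI _ e); rewrite gt_eqF // period_gt0.
Qed.

(** If n is the integer nearest to x = m . w', then 2 - 2 cos (2 pi x) is at least
    of the order of (x - n)^2, so the inverse divisor is bounded by the square of
    the Diophantine bound. *)
Lemma diophantine_divisor L (w : 'rV[R]_L) : diophantine_multiple w ->
  exists2 B : R, 0 <= B & exists s : nat, forall m : 'rV[int]_L, m != 0 ->
    `|divisor w m|^-1 <= B * (l1norm m)%:R ^+ s.
Proof.
move=> [w' [nu [tau [-> nu0 tau0 h]]]].
pose T := (Num.truncn tau).+1.
exists (2 * nu ^+ 2); first by rewrite mulr_ge0 // exprn_ge0 // ltW.
exists (T * 2)%N => m m0.
set x := dot (intv R m) w'.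
pose n := Num.floor (x + 2^-1).
have [xn hx] := h m n m0; rewrite -/x in xn hx.
have T0 := period_gt0 R.
have n1 : n%:~R <= x + 2^-1 by exact: Num.Theory.ge_floor.
have n2 : x + 2^-1 < n%:~R + 1.
  by rewrite -[1](_ : 1%:~R = _) // -intrD Num.Theory.floorD1_gt.
have d1 : `|x - n%:~R| <= 2^-1 by rewrite ler_norml; apply/andP; split; lra.
pose y : R := 2 * pi * (x - n%:~R).
have dE : divisor (2 * pi *: w') m = - (2 * (1 - cos y)).
  rewrite /divisor dotZr -/x.
  have <- : cos y = cos (2 * pi * x).
    rewrite -(@periodic_int R _ cos n y) //; last by move=> z; exact: cosD2pi_per.
    by congr cos; rewrite /y; ring.
  by ring.
have yE : `|y| = 2 * pi * `|x - n%:~R| by rewrite normrM (ger0_norm (ltW T0)).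
have ypi : `|y| <= pi by rewrite yE; have := @pi_gt0 R; nra.
have := cos_le_quadratic_pi ypi => hc.
set q := `|x - n%:~R| in d1 yE hx *.
have q0 : 0 < q by rewrite normr_gt0.
have y2 : y ^+ 2 = 4 * pi ^+ 2 * q ^+ 2.
  by rewrite -(real_normK (num_real y)) yE; ring.
have hd : q ^+ 2 / 2 <= `|divisor (2 * pi *: w') m|.
  rewrite dE normrN ger0_norm; last by have := cos_le1 y; lra.
  apply: le_trans (_ : 2 * (y ^+ 2 / 64) <= _); last by lra.
  rewrite y2; have p2 : 4 <= pi ^+ 2 :> R by have := @pi_ge2 R; nra.
  have q2 : 0 < q ^+ 2 by rewrite exprn_gt0.
  nra.
have q2 : 0 < q ^+ 2 / 2 by rewrite divr_gt0 // exprn_gt0.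
apply: (@le_trans _ _ (q ^+ 2 / 2)^-1).
  by rewrite lef_pV2 // posrE // (lt_le_trans q2).
have l1 : 1 <= (l1norm m)%:R :> R by rewrite ler1n lt0n l1norm_eq0.
have hq : q^-1 <= nu * (l1norm m)%:R ^+ T.
  apply: le_trans hx _; rewrite ler_pM2l // -powR_mulrn ?(le_trans ler01) //.
  by rewrite ler_powR // /T ltW // -natr1 natr1 Num.Theory.truncnS_gt.
rewrite invfM invrK exprM -exprVn mulrC -mulrA -exprMn ler_pM2l //.
by rewrite lerXn2r // ?nnegrE ?invr_ge0 ?ltW // (lt_le_trans _ hq) ?invr_gt0.
Qed.

End Divisors.

(** * Frequencies of bounded degree *)

Section L1Ball.
Variable n : nat.

Definition l1ball (J : nat) : seq 'rV[int]_n :=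
  undup [seq l <- [seq \row_j ((f j : nat)%:Z - J%:Z) | f : {ffun 'I_n -> 'I_(J.*2.+1)}]
    | (l1norm l <= J)%N].

Lemma l1ball_uniq J : uniq (l1ball J).
Proof. exact: undup_uniq. Qed.

Lemma mem_l1ball J l : (l \in l1ball J) = (l1norm l <= J)%N.
Proof.
rewrite mem_undup mem_filter andb_idr // => lJ.
have lj j : (`|(l ord0 j + J%:Z)%R| < J.*2.+1)%N.
  have h : (`|l ord0 j| <= J)%N.
    apply: leq_trans lJ; rewrite /l1norm (bigD1 j) //=; exact: leq_addr.
  by lia.
apply/mapP; exists [ffun j => Ordinal (lj j)]; rewrite ?mem_enum //.
apply/rowP => j; rewrite mxE ffunE /=.
have h : (`|l ord0 j| <= J)%N.
  apply: leq_trans lJ; rewrite /l1norm (bigD1 j) //=; exact: leq_addr.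
have -> : l 0 j = l ord0 j by congr (l _ j); exact: val_inj.
by lia.
Qed.

Lemma fsbig_l1ball (U : nmodType) J (f : 'rV[int]_n -> U) :
  \sum_(l \in [set l : 'rV[int]_n | (l1norm l <= J)%N]) f l = \sum_(l <- l1ball J) f l.
Proof.
rewrite [RHS]fsbig_seq ?l1ball_uniq //.
suff -> : [set l : 'rV[int]_n | (l1norm l <= J)%N] = [set` l1ball J] by [].
by apply/seteqP; split=> l /=; rewrite mem_l1ball.
Qed.

End L1Ball.

(** * Weighted absolutely convergent Fourier series *)

Arguments ComplexField.Normc.normc : simpl never.

Section Wiener.
Variable R : realType.
Local Notation C := (complex R).
Local Notation normc := ComplexField.Normc.normc.
Variables (L : nat) (kap : R).
Hypothesis kap0 : 0 <= kap.

(** Absolute convergence of the weighted Fourier series, tested on finite sets of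
    frequencies. *)
Definition wien (M : R) (f : 'rV[R]_L -> C) : Prop :=
  ccont f /\ forall r : seq 'rV[int]_L, uniq r ->
    \sum_(m <- r) normc (cfourier f m) * wexp kap m <= M.

Lemma wien_ge0 M f : wien M f -> 0 <= M.
Proof. by move=> [_ /(_ [::] isT)]; rewrite big_nil. Qed.

Lemma wien_ext M f g : f =1 g -> wien M f -> wien M g.
Proof. by move=> fg; have -> : g = f by apply/funext => t; rewrite fg. Qed.

Lemma wien_le M N f : M <= N -> wien M f -> wien N f.
Proof. by move=> MN [cf hf]; split => // r /hf h; exact: le_trans MN. Qed.

Lemma wienD M N f g : wien M f -> wien N g -> wien (M + N) (fun t => f t + g t).
Proof.
move=> [cf hf] [cg hg]; split; first exact: ccontD.
move=> r ur; apply: le_trans (lerD (hf r ur) (hg r ur)).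
rewrite -big_split /=; apply: ler_sum => m _.
rewrite cfourierD // -mulrDl ler_wpM2r ?wexp_ge0 //; exact: le_normcD.
Qed.

Lemma wienZ M c f : wien M f -> wien (normc c * M) (fun t => c * f t).
Proof.
move=> [cf hf]; split; first exact: ccontZ.
move=> r ur; apply: le_trans (ler_wpM2l (normc_ge0 c) (hf r ur)).
rewrite mulr_sumr; apply: ler_sum => m _.
by rewrite cfourierZ // ComplexField.Normc.normcM mulrA.
Qed.

Lemma wien_tp D (K : 'M[int]_(L, D)) J M f : tp K kap J M f -> wien M f.
Proof. by move=> h; split; [exact: tp_ccont h|move=> r; exact: tp_wiener h]. Qed.

(** Uniform closeness controls each Fourier coefficient, hence every finite sum:
    the bound M passes to uniform limits. *)
Lemma wien_lim M f : ccont f ->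
  (forall e, 0 < e -> exists2 g, wien M g & forall t, normc (f t - g t) <= e) -> wien M f.
Proof.
move=> cf h; split=> // r ur.
pose W := \sum_(m <- r) 2 * wexp kap m.
have W0 : 0 <= W by apply: sumr_ge0 => m _; rewrite mulr_ge0 ?wexp_ge0.
apply/ler_addgt0Pr => e e0.
have e1 : 0 < e / (W + 1) by rewrite divr_gt0 // ltr_wpDl.
have [g [cg hg] fg] := h _ e1.
apply: (@le_trans _ _ (\sum_(m <- r) (normc (cfourier g m) * wexp kap m +
    2 * (e / (W + 1)) * wexp kap m))).
  apply: ler_sum => m _; rewrite -mulrDl ler_wpM2r ?wexp_ge0 //.
  have -> : cfourier f m = cfourier g m + cfourier (fun t => f t + (-1) * g t) m.
    rewrite cfourierD ?cfourierZ //; last exact: ccontZ.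
    by rewrite mulN1r addrC subrK.
  apply: le_trans (le_normcD _ _) _; rewrite lerD2l; apply: cfourier_norm.
    by apply: ccontD => //; exact: ccontZ.
  by move=> t _; rewrite mulN1r; exact: fg.
rewrite big_split /= lerD ?hg //.
have -> : \sum_(m <- r) 2 * (e / (W + 1)) * wexp kap m = e / (W + 1) * W.
  by rewrite /W mulr_sumr; apply: eq_bigr => m _; ring.
by rewrite mulrAC ler_pdivrMr ?ltr_wpDl // ler_wpM2l ?(ltW e0) // lerDl.
Qed.

Lemma wien_coef M f m : wien M f -> normc (cfourier f m) <= M.
Proof.
move=> [_ /(_ [:: m] isT)]; rewrite big_seq1; apply: le_trans.
by rewrite ler_peMr ?normc_ge0 ?wexp_ge1.
Qed.

Lemma sum_sqr_le (I : eqType) (s : seq I) (F : I -> R) : (forall i, 0 <= F i) ->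
  \sum_(i <- s) F i ^+ 2 <= (\sum_(i <- s) F i) ^+ 2.
Proof.
move=> F0; elim: s => [|i s IH]; first by rewrite !big_nil expr0n.
rewrite !big_cons sqrrD; apply: lerD => //.
by rewrite lerDl mulrn_wge0 // mulr_ge0 // sumr_ge0.
Qed.

End Wiener.

(** * Comparison with the weighted square-summable norms *)

Section NormBound.
Variable R : realType.
Local Notation C := (complex R).
Local Notation normc := ComplexField.Normc.normc.
Variables (L p : nat) (rho : R) (r : nat).
Hypothesis rho0 : 0 <= rho.
Let kap : R := rho + r%:R.

(** This is where r enters the exponential weight: (1 + m^2)^r <= exp (2 r m). *)
Lemma weight_le (m : nat) : expR (2 * m%:R * rho) * (1 + m%:R ^+ 2) ^+ r <=
  expR (kap * m%:R) ^+ 2.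
Proof.
have -> : expR (kap * m%:R) ^+ 2 = expR (2 * m%:R * rho) * expR (r%:R * (2 * m%:R)).
  by rewrite -expRM_natl -expRD /kap; congr expR; ring.
rewrite ler_wpM2l ?expR_ge0 //.
rewrite expRM_natl lerXn2r ?nnegrE ?expR_ge0 ?addr_ge0 ?exprn_ge0 //.
rewrite expRM_natl; apply: (@le_trans _ _ ((1 + m%:R) ^+ 2)).
  by rewrite sqrrD expr1n lerD2r mul1r lerDl mulrn_wge0.
by rewrite lerXn2r ?nnegrE ?expR_ge0 ?addr_ge0 // expR_ge1Dx.
Qed.

Variable (f : 'rV[R]_L -> 'rV[R]_p).
Hypothesis cf : forall j, continuous (fun t => f t 0 j).

(** Every single coefficient occurs in the norm with a weight of at least 1. *)
Lemma fourier_sqr_le_norm (M : R) (l : 'rV[int]_L) :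
  (rho_r_norm rho r f <= M%:E)%E -> 0 <= M -> forall j,
  normc (cfourier (fun t => (f t 0 j)%:C%C) l) <= M.
Proof.
move=> hM M0 j; rewrite -fourierE //.
have S0 m : 0 <= fourier_sqr f m by apply: sumr_ge0 => i _; exact: sqr_ge0.
have W1 (m : 'rV[int]_L) : fourier_sqr f m <=
    fourier_sqr f m * expR (2 * (l1norm m)%:R * rho) * (1 + (l1norm m)%:R ^+ 2) ^+ r.
  rewrite -mulrA ler_peMr // mulr_ege1 ?exprn_ege1 ?lerDl ?exprn_ge0 //.
  by rewrite -expR0 ler_expR !mulr_ge0.
pose E : \bar R := (\esum_(l in [set l : 'rV[int]_L | l != 0%R])
           (fourier_sqr f l * expR (2 * (l1norm l)%:R * rho) *
            (1 + (l1norm l)%:R ^+ 2) ^+ r)%:E)%E.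
have hl : ((fourier_sqr f l)%:E <= (fourier_sqr f 0)%:E + E)%E.
  have t0 m : (0 <= (fourier_sqr f m * expR (2 * (l1norm m)%:R * rho) *
            (1 + (l1norm m)%:R ^+ 2) ^+ r)%:E)%E.
    by rewrite lee_fin (le_trans (S0 m)).
  have [->|l0] := eqVneq l 0; first by rewrite leeDl // esum_ge0.
  apply: le_trans (leeDr _ _); last by rewrite lee_fin.
  apply: esum_ge; exists [set l].
    by split=> [|m /= ->//]; exact: finite_set1.
  by rewrite fsbig_set1 lee_fin.
have hE : rho_r_norm rho r f = sqrte ((fourier_sqr f 0)%:E + E)%E by [].
rewrite hE in hM; move: hl hM; set T := (_ + _)%E => hl hM.
have T0 : (0 <= T)%E by apply: le_trans hl; rewrite lee_fin.
have := sqr_sqrte T0; have := sqrte_ge0 T; move: hM.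
case: (sqrte T) => [x|//|//]; rewrite !lee_fin => xM x0 TE.
have {}hl : fourier_sqr f l <= x ^+ 2 by rewrite -lee_fin; move: hl; rewrite -TE.
rewrite -(@ler_pXn2r _ 2) ?nnegrE ?normc_ge0 //.
apply: le_trans (_ : x ^+ 2 <= _); last by rewrite lerXn2r ?nnegrE.
apply: le_trans hl; rewrite /fourier_sqr (bigD1 j) //= lerDl sumr_ge0 // => i _.
exact: sqr_ge0.
Qed.

(** A sum of squares of nonnegative terms is at most the square of the sum; the
    constant mode and the rest of the series contribute p M^2 each. *)
Lemma wien_rho_r_norm (M : R) :
  (forall j, wien kap M (fun t => (f t 0 j)%:C%C)) ->
  (rho_r_norm rho r f <= (2 * p%:R * M)%:E)%E.
Proof.
move=> hw.
have S0 m : 0 <= fourier_sqr f m by apply: sumr_ge0 => i _; exact: sqr_ge0.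
have key (s : seq 'rV[int]_L) : uniq s ->
    \sum_(m <- s) fourier_sqr f m * wexp kap m ^+ 2 <= p%:R * M ^+ 2.
  move=> us; apply: (@le_trans _ _ (\sum_(m <- s) \sum_(j < p)
     (normc (cfourier (fun t => (f t 0 j)%:C%C) m) * wexp kap m) ^+ 2)).
    apply: ler_sum => m _; rewrite /fourier_sqr mulr_suml; apply: ler_sum => j _.
    by rewrite fourierE // exprMn.
  rewrite exchange_big /= (_ : p%:R * M ^+ 2 = \sum_(j < p) M ^+ 2); last first.
    by rewrite sumr_const card_ord mulr_natl.
  apply: ler_sum => j _; have [_ h] := hw j.
  apply: le_trans (sum_sqr_le _ _) _; first by move=> m; rewrite mulr_ge0 ?normc_ge0 ?wexp_ge0.
  rewrite lerXn2r ?nnegrE ?h ?(wien_ge0 (hw j)) //.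
  by apply: sumr_ge0 => m _; rewrite mulr_ge0 ?normc_ge0 ?wexp_ge0.
have pM : 0 <= p%:R * M.
  have [j|p0] := pickP (@predT 'I_p); first by rewrite mulr_ge0 ?(wien_ge0 (hw j)).
  by have : #|'I_p| = 0%N := eq_card0 p0; rewrite card_ord => ->; rewrite mul0r.
have h0 : fourier_sqr f 0 <= p%:R * M ^+ 2.
  have := key [:: 0] isT; rewrite big_seq1 /wexp l1norm0 mulr0 expR0 expr1n mulr1.
  exact.
rewrite /rho_r_norm; set E := (\esum_(l in _) _)%E.
have hE : (E <= (p%:R * M ^+ 2)%:E)%E.
  apply: ub_ereal_sup => _ [F [finF FS] <-].
  rewrite fsbig_finite //= sumEFin lee_fin.
  apply: le_trans (key _ (finmap.fset_uniq (fset_set F))).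
  apply: ler_sum => m _; rewrite -mulrA ler_wpM2l // /wexp; exact: weight_le.
have E0 : (0 <= E)%E.
  apply: esum_ge0 => m _; rewrite lee_fin !mulr_ge0 ?expR_ge0 // exprn_ge0 //.
have T : ((fourier_sqr f 0)%:E + E <= (2 * (p%:R * M ^+ 2))%:E)%E.
  by rewrite mulr_natl mulr2n EFinD leeD.
have T0 : (0 <= (fourier_sqr f 0)%:E + E)%E by rewrite adde_ge0 // lee_fin.
move: T T0; case: (_ + _)%E => [x|//|//]; rewrite !lee_fin => T T0.
have pp : (p%:R : R) <= p%:R ^+ 2.
  by rewrite -natrX ler_nat -mulnn; case: (p) => // n; exact: leq_pmull.
have -> : 2 * p%:R * M = `|2 * p%:R * M| by rewrite ger0_norm // -mulrA mulr_ge0.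
rewrite -sqrtr_sqr ler_wsqrtr //; apply: le_trans T _.
rewrite !exprMn -mulrA; have M2 : 0 <= M ^+ 2 by exact: sqr_ge0.
nra.
Qed.

End NormBound.

(** * Gevrey weights *)

Section GevreyWeight.
Variables (R : realType) (s : nat) (B : R).
Hypothesis B1 : 1 <= B.

(** The denominator (n+1)^2 makes the weights stable under convolution even
    when s = 0. *)
Definition gevrey_weight (n : nat) : R := n`!%:R ^+ s * B ^+ n / n.+1%:R ^+ 2.

Let B0 : 0 < B. Proof. exact: lt_le_trans B1. Qed.

Lemma gevrey_weight_ge0 n : 0 <= gevrey_weight n.
Proof. by rewrite /gevrey_weight divr_ge0 ?mulr_ge0 ?exprn_ge0 // ltW. Qed.

Lemma gevrey_weight0 : gevrey_weight 0 = 1.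
Proof. by rewrite /gevrey_weight fact0 !expr1n expr0 !mul1r invr1. Qed.

(** Telescoping comparison with 1 / (n (n+1)). *)
Lemma sum_invsqr_le n : \sum_(i < n.+1) (i.+1%:R ^+ 2)^-1 <= 2 - n.+1%:R^-1 :> R.
Proof.
elim: n => [|n IH]; first by rewrite big_ord1 /= expr1n invr1; lra.
rewrite big_ord_recr /=; apply: le_trans (lerD IH (lexx _)) _.
have n1 : 0 < n.+1%:R :> R by [].
have -> : n.+2%:R = n.+1%:R + 1 :> R by rewrite -addn1 natrD.
move: n.+1%:R n1 => x x0.
rewrite -subr_ge0 (_ : _ - _ = (x * (x + 1) ^+ 2)^-1); last by field; rewrite !gt_eqF // addr_gt0.
by rewrite invr_ge0 mulr_ge0 ?exprn_ge0 ?addr_ge0 // ltW.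
Qed.

(** Besides i! (n-i)! <= n!, for p = i + 1 and q = n - i + 1 one has
    1 / (p q)^2 <= 2 (1/p^2 + 1/q^2) / (p + q)^2. *)
Lemma gevrey_weight_conv n : \sum_(i < n.+1) gevrey_weight i * gevrey_weight (n - i) <= 8 * gevrey_weight n.
Proof.
pose T : R := n`!%:R ^+ s * B ^+ n; pose q (i : nat) : R := (i.+1%:R ^+ 2)^-1.
have T0 : 0 <= T by rewrite mulr_ge0 ?exprn_ge0 // ltW.
have h (i : 'I_n.+1) : gevrey_weight i * gevrey_weight (n - i) <= T * (2 / n.+2%:R ^+ 2) * (q i + q (n - i)%N).
  have i_n : (i <= n)%N := leq_ord i.
  have -> : gevrey_weight i * gevrey_weight (n - i) = ((i`! * (n - i)`!)%N%:R ^+ s * B ^+ n) * (q i * q (n - i)%N).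
    rewrite /gevrey_weight /q natrM exprMn -[in B ^+ n](subnKC i_n) exprD.
    by ring.
  apply: (@le_trans _ _ (T * (q i * q (n - i)%N))).
    rewrite ler_wpM2r ?mulr_ge0 ?invr_ge0 ?exprn_ge0 // /T ler_wpM2r ?exprn_ge0 ?(ltW B0) //.
    by rewrite lerXn2r ?nnegrE // ler_nat -(bin_fact i_n) leq_pmull // bin_gt0.
  rewrite -mulrA ler_wpM2l //.
  have -> : n.+2%:R = i.+1%:R + (n - i).+1%:R :> R by rewrite -natrD; congr (_%:R); lia.
  rewrite /q; have : 0 < (n - i).+1%:R :> R by [].
  have : 0 < i.+1%:R :> R by [].
  move: i.+1%:R (n - i).+1%:R => x y x0 y0; rewrite -subr_ge0.
  rewrite (_ : _ - _ = (x - y) ^+ 2 / (x * y * (x + y)) ^+ 2).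
    by rewrite divr_ge0 ?sqr_ge0.
  by field; rewrite !gt_eqF // addr_gt0.
apply: le_trans (ler_sum _ (fun i _ => h i)) _.
rewrite -mulr_sumr big_split /= [X in _ + X](reindex_inj rev_ord_inj) /=.
rewrite [X in _ + X](eq_bigr (fun i : 'I_n.+1 => q i)); last first.
  by move=> i _; rewrite subSS subKn // leq_ord.
have hq : \sum_(i < n.+1) q i <= 2.
  by apply: le_trans (sum_invsqr_le n) _; rewrite gerBl.
apply: (@le_trans _ _ (T * (2 / n.+2%:R ^+ 2) * (2 + 2))).
  by rewrite ler_wpM2l ?lerD // mulr_ge0 // divr_ge0 // exprn_ge0.
rewrite /gevrey_weight -/T (_ : T * _ * _ = 8 * (T / n.+2%:R ^+ 2)); last by ring.
rewrite ler_wpM2l // ler_wpM2l // lef_pV2 ?posrE ?exprn_gt0 //.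
by rewrite lerXn2r ?nnegrE // ler_nat.
Qed.

(** The factor (n+1)^s is the loss caused by one division by small divisors. It
    is absorbed by the factorial, and the step also gains 1/B; the 4 bounds
    the ratio ((n+2)/(n+1))^2. *)
Lemma gevrey_weight_step n : n.+1%:R ^+ s * gevrey_weight n <= 4 / B * gevrey_weight n.+1.
Proof.
rewrite /gevrey_weight factS natrM exprMn [B ^+ n.+1]exprS.
have -> : 4 / B * (n.+1%:R ^+ s * n`!%:R ^+ s * (B * B ^+ n) / n.+2%:R ^+ 2) =
  (n.+1%:R ^+ s * (n`!%:R ^+ s * B ^+ n)) * (4 / n.+2%:R ^+ 2).
  by field; rewrite !gt_eqF.
rewrite mulrA ler_wpM2l //.
  by rewrite !mulr_ge0 ?exprn_ge0 // ltW.
rewrite ler_pdivlMr ?exprn_gt0 // mulrC ler_pdivrMr ?exprn_gt0 //.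
rewrite (_ : 4 = 2 ^+ 2) ?expr2; last by ring.
by rewrite -!expr2 -exprMn lerXn2r ?nnegrE // -natrM ler_nat; lia.
Qed.

Lemma gevrey_weight_le : 4 <= B -> {homo gevrey_weight : m n / (m <= n)%N >-> m <= n}.
Proof.
move=> B4; apply: homo_leq => //; first by move=> y x z; exact: le_trans.
move=> n; apply: le_trans (_ : n.+1%:R ^+ s * gevrey_weight n <= _).
  by rewrite ler_peMl ?gevrey_weight_ge0 // exprn_ege1 // ler1n.
apply: le_trans (gevrey_weight_step n) _.
by rewrite ler_piMl ?gevrey_weight_ge0 // ler_pdivrMr // mul1r.
Qed.

Variables (x : nat -> R) (a : R).
Hypothesis a0 : 0 <= a.
Hypothesis a1 : 8 * a <= 1.
Hypothesis x0 : x 0%N = 0.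
Hypothesis xge0 : forall k, 0 <= x k.
Variable n : nat.
Hypothesis xle : forall k, (k <= n)%N -> x k <= a * gevrey_weight k.

Let P := \poly_(k < n.+1) x k.

Lemma coef_exp_gevrey_weight m k : (k <= n)%N -> 0 <= (P ^+ m)`_k <= (8 * a) ^+ m * gevrey_weight k.
Proof.
elim: m k => [|m IH] k kn.
  by rewrite !expr0 mul1r coef1; case: k kn => [|k] _ /=; rewrite ?gevrey_weight0 ?ler01 ?lexx ?gevrey_weight_ge0.
rewrite exprS coefM; apply/andP; split.
  apply: sumr_ge0 => i _; rewrite coef_poly; case: ifP => _; last by rewrite mul0r.
  rewrite mulr_ge0 //; have /IH/andP[] // : (k - i <= n)%N by lia.
apply: (@le_trans _ _ (\sum_(i < k.+1) (a * (8 * a) ^+ m) * (gevrey_weight i * gevrey_weight (k - i)))).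
  apply: ler_sum => i _; have ik := leq_ord i.
  have /IH/andP[p1 p2] : (k - i <= n)%N by lia.
  have i_n : (i <= n)%N by lia.
  rewrite mulrACA coef_poly ltnS i_n; apply: ler_pM => //; exact: xle.
rewrite -mulr_sumr exprS; apply: le_trans (ler_wpM2l _ (gevrey_weight_conv k)) _.
  by rewrite mulr_ge0 ?exprn_ge0 ?mulr_ge0.
by rewrite le_eqVlt; apply/orP; left; apply/eqP; ring.
Qed.

Lemma ecoef_gevrey_weight : ecoef x n <= expR 1 * gevrey_weight n.
Proof.
rewrite /ecoef coef_pexp.
apply: (@le_trans _ _ (\sum_(m < n.+1) (m`!%:R)^-1 * 1 ^+ m * gevrey_weight n)).
  apply: ler_sum => m _; rewrite -mulrA ler_wpM2l ?invr_ge0 // expr1n mul1r.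
  have /andP[_ h] := coef_exp_gevrey_weight m (leqnn n); apply: le_trans h _.
  by rewrite ler_piMl ?gevrey_weight_ge0 // exprn_ile1 // mulr_ge0.
rewrite -mulr_suml ler_wpM2r ?gevrey_weight_ge0 //; exact: exp_sum_le.
Qed.

(** Without the linear term the expansion of the exponential starts with
    squares, which leaves a factor (8 a)^2. *)
Lemma ecoef_gevrey_weight_quadratic : (0 < n)%N -> x n = 0 ->
  ecoef x n <= (8 * a) ^+ 2 * expR 1 * gevrey_weight n.
Proof.
move=> n0 xn; rewrite /ecoef coef_pexp.
apply: (@le_trans _ _ (\sum_(m < n.+1) (m`!%:R)^-1 * 1 ^+ m * ((8 * a) ^+ 2 * gevrey_weight n))).
  apply: ler_sum => -[m mn] _ /=; rewrite -mulrA ler_wpM2l ?invr_ge0 // expr1n mul1r.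
  have c0 : 0 <= (8 * a) ^+ 2 * gevrey_weight n by rewrite mulr_ge0 ?gevrey_weight_ge0 ?exprn_ge0 ?mulr_ge0.
  case: m mn => [|[|m]] mn.
  - by rewrite expr0 coef1; case: (n) n0 c0.
  - by rewrite expr1 -/P coef_poly ltnSn xn.
  have /andP[_ h] := coef_exp_gevrey_weight m.+2 (leqnn n); apply: le_trans h _.
  rewrite ler_wpM2r ?gevrey_weight_ge0 // -[m.+2]addn2 exprD ler_piMl ?exprn_ge0 ?mulr_ge0 //.
  by rewrite exprn_ile1 // mulr_ge0.
rewrite -mulr_suml (_ : (8 * a) ^+ 2 * expR 1 * gevrey_weight n = expR 1 * ((8 * a) ^+ 2 * gevrey_weight n)); last by ring.
apply: ler_wpM2r; last exact: exp_sum_le.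
by rewrite mulr_ge0 ?gevrey_weight_ge0 // exprn_ge0 // mulr_ge0.
Qed.

End GevreyWeight.

(** * Sequences built by dependent choice *)

Section Recursion.
Variables (S : Type) (s0 : S) (ok : (nat -> S) -> nat -> Prop).

Definition upd (h : nat -> S) n s k := if k == n then s else h k.

(** The next entry is chosen for the whole prefix built so far; extensionality
    of ok says that later entries do not disturb earlier orders. *)
Lemma dependent_sequence :
  (forall h h' n, (forall k, (k <= n)%N -> h k = h' k) -> ok h n -> ok h' n) ->
  (forall n h, (forall m, (m < n)%N -> ok h m) -> exists s, ok (upd h n s) n) ->
  exists h, forall n, ok h n.
Proof.
move=> ext step.
have /choice [f hf] : forall nh : nat * (nat -> S), exists s,
    (forall m, (m < nh.1)%N -> ok nh.2 m) -> ok (upd nh.2 nh.1 s) nh.1.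
  move=> [n h]; have [c|c] := pselect (forall m, (m < n)%N -> ok h m).
    by have [s hs] := step n h c; exists s.
  by exists s0 => /= /c.
pose fix build n := if n is m.+1 then upd (build m) m (f (m, build m)) else fun _ => s0.
have buildS n k : (k < n)%N -> build n.+1 k = build n k.
  by move=> kn; rewrite /= /upd ltn_eqF.
have buildE n m k : (k < n)%N -> (n <= m)%N -> build m k = build n k.
  move=> kn; elim: m => [|m IH]; first by case: n kn.
  rewrite leq_eqVlt => /predU1P[->//|nm]; rewrite buildS ?IH //.
  exact: leq_trans kn nm.
have okb n : forall m, (m < n)%N -> ok (build n) m.
  elim: n => [//|n IH] m; rewrite ltnS leq_eqVlt => /predU1P[->|mn].
    exact: (hf (n, build n)).
  apply: ext (IH m mn) => k km; rewrite buildS //; exact: leq_ltn_trans mn.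
exists (fun n => build n.+1 n) => n.
apply: ext (okb n.+1 n (ltnSn n)) => k kn.
by rewrite (buildE k.+1 n.+1).
Qed.

End Recursion.

(** * The equation order by order *)

Section Orders.
Variable R : realType.
Local Notation C := (complex R).
Local Notation normc := ComplexField.Normc.normc.
Variables (L D : nat) (K : 'M[int]_(L, D)) (kap : R).
Hypothesis kap0 : 0 <= kap.
Variables (J : nat) (va : seq ('rV[C]_D * 'rV[int]_D)).
Hypothesis vaJ : all (fun a => l1norm a.2 <= J)%N va.
Variables (gamma : R) (omega : 'rV[R]_L) (kp : 'rV[R]_D) (beta : R).
Local Notation tp := (tp K kap).
Local Notation embed := (@embed R L D K).

Definition cmean (f : 'rV[R]_L -> 'rV[R]_D) (j : 'I_D) : C :=
  cfourier (fun t => (f t 0 j)%:C%C) 0.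

(** The average over the torus; the real part of the zeroth coefficient is taken
    so that it is a real vector without further conditions. *)
Definition mean (f : 'rV[R]_L -> 'rV[R]_D) : 'rV[R]_D :=
  \row_j complex.Re (cmean f j).

Definition vcont (f : 'rV[R]_L -> 'rV[R]_D) : Prop :=
  forall j, ccont (fun t => (f t 0 j)%:C%C).

Definition vtp (d : nat) (M : R) (f : 'rV[R]_L -> 'rV[R]_D) : Prop :=
  forall j, tp d M (fun t => (f t 0 j)%:C%C).

Lemma vtp_cont d M f : vtp d M f -> vcont f.
Proof. by move=> h j; exact: tp_ccont (h j). Qed.

Lemma meanE f j : vcont f -> (mean f 0 j)%:C%C = cmean f j.
Proof.
move=> cf; rewrite mxE; apply: complexP => //.
rewrite /cmean /cfourier ImZr intv0.
under eq_fun do rewrite dot0l oppr0 expi0 mulr1.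
by rewrite /= torus_int_cst !mulr0.
Qed.

Lemma meanD f g : vcont f -> vcont g -> mean (fun t => f t + g t) = mean f + mean g.
Proof.
move=> cf cg; apply/rowP => j; rewrite !mxE -ReD /cmean -cfourierD //.
by congr (complex.Re (cfourier _ _)); apply/funext => t; rewrite mxE rmorphD.
Qed.

Lemma meanZ a f : vcont f -> mean (fun t => a *: f t) = a *: mean f.
Proof.
move=> cf; apply/rowP => j; rewrite !mxE -ReZr /cmean -cfourierZ //.
by congr (complex.Re (cfourier _ _)); apply/funext => t; rewrite mxE rmorphM.
Qed.

Lemma mean_cst c : mean (fun _ => c) = c.
Proof. by apply/rowP => j; rewrite !mxE /cmean cfourier_cst eqxx mul1r. Qed.

Lemma vcontD f g : vcont f -> vcont g -> vcont (fun t => f t + g t).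
Proof.
move=> cf cg j; under eq_fun do rewrite mxE rmorphD.
by apply: ccontD; [exact: cf|exact: cg].
Qed.

Lemma vcontZ a f : vcont f -> vcont (fun t => a *: f t).
Proof.
move=> cf j; under eq_fun do rewrite mxE rmorphM.
by apply: ccontZ; exact: cf.
Qed.

Lemma vcont_cst c : vcont (fun _ => c).
Proof. by move=> j; exact: ccont_cst. Qed.

Lemma vcont_shift f w : vcont f -> vcont (fun t => f (t + w)).
Proof. by move=> cf j; exact: (ccont_o (@continuous_shift _ _ w) (cf j)). Qed.

Lemma mean_shift f w : vcont f -> (forall j, torus_periodic (fun t => (f t 0 j)%:C%C : C)) ->
  mean (fun t => f (t + w)) = mean f.
Proof.
move=> cf pf; apply/rowP => j; rewrite !mxE /cmean.
rewrite (cfourier_shift (f := fun t => (f t 0 j)%:C%C)) //.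
by rewrite intv0 dot0l expi0 mul1r.
Qed.

Lemma vtpD d M N f g : vtp d M f -> vtp d N g -> vtp d (M + N) (fun t => f t + g t).
Proof.
by move=> hf hg j; apply: tp_ext (tpD (hf j) (hg j)) => t; rewrite mxE rmorphD.
Qed.

Lemma vtpZ d M a f : vtp d M f -> vtp d (`|a| * M) (fun t => a *: f t).
Proof.
move=> hf j; rewrite -normc_real; apply: tp_ext (tpZ kap0 a%:C%C (hf j)) => t.
by rewrite mxE rmorphM.
Qed.

Lemma vtp_cst d M (c : 'rV[R]_D) : (forall j, `|c 0 j| <= M) -> vtp d M (fun _ => c).
Proof. by move=> h j; apply: tp_cst; rewrite normc_real. Qed.

Lemma vtp_cst_sum d (c : 'rV[R]_D) : vtp d (\sum_j `|c 0 j|) (fun _ => c).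
Proof. by apply: vtp_cst => j; rewrite (bigD1 j) //= lerDl sumr_ge0. Qed.

Lemma vtp_shift d M f w : vtp d M f -> vtp d M (fun t => f (t + w)).
Proof. by move=> h j; exact: (tp_shift w (h j)). Qed.

Lemma vtp_le d d' M M' f : (d <= d')%N -> M <= M' -> vtp d M f -> vtp d' M' f.
Proof. by move=> dissipation MM h j; exact: tp_le (h j). Qed.

Lemma vtp_periodic d M f j : vtp d M f -> torus_periodic (fun t => (f t 0 j)%:C%C : C).
Proof. by move=> h; exact: (tp_periodic (h j)). Qed.

(** The exponential of frequency l along the unperturbed embedding, translated to
    the chosen beta. *)
Definition phase (l : 'rV[int]_D) (t : 'rV[R]_L) : C :=
  expi (dot (intv R l) (embed t + beta *: kp)).

(** The exponent i l . (g - beta kp) as a series in e; its constant term is 0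
    because g_0 = beta kp. *)
Definition incr (l : 'rV[int]_D) (g : nat -> 'rV[R]_L -> 'rV[R]_D) t k : C :=
  if k is 0%N then 0 else 'i%C * (dot (intv R l) (g k t))%:C%C.

Definition forcec g n j (t : 'rV[R]_L) : C :=
  \sum_(a <- va) a.1 0 j * phase a.2 t * ecoef (incr a.2 g t) n.

(** The coefficient of e^n in grad V (theta K + sum_k e^k g_k). *)
Definition force g n (t : 'rV[R]_L) : 'rV[R]_D := \row_j complex.Re (forcec g n j t).

Definition hessc v j (t : 'rV[R]_L) : C :=
  \sum_(a <- va) a.1 0 j * phase a.2 t * ('i%C * (dot (intv R a.2) v)%:C%C).

(** The Hessian of V at the unperturbed embedding, applied to v. *)
Definition hess v (t : 'rV[R]_L) : 'rV[R]_D := \row_j complex.Re (hessc v j t).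

Definition wnorm_force : R := \sum_j \sum_(a <- va) normc (a.1 0 j) * wexp kap (pull K a.2).

Lemma tp_phase l : tp (l1norm l) (wexp kap (pull K l)) (phase l).
Proof.
have := tpZ kap0 (expi (dot (intv R l) (beta *: kp))) (tp_mon K kap l).
rewrite normc_expi mul1r; apply: tp_ext => t.
by rewrite /phase dotDr expiD dot_embed mulrC.
Qed.

Lemma tp_dot d M f l : vtp d M f ->
  tp d ((l1norm l)%:R * M) (fun t => (dot (intv R l) (f t))%:C%C).
Proof.
move=> h.
have -> : (l1norm l)%:R * M = \sum_i normc ((l 0 i)%:~R%:C%C : C) * M.
  rewrite -mulr_suml; congr (_ * M); rewrite /l1norm natr_sum; apply: eq_bigr => i _.
  rewrite normc_real -intr_norm -abszE; congr (_%:R); congr (absz (l _ i)); exact: val_inj.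
apply: tp_ext (_ : tp _ _ (fun t => \sum_i (l 0 i)%:~R%:C%C * (f t 0 i)%:C%C)).
  by move=> t; rewrite /dot rmorph_sum; apply: eq_bigr => i _; rewrite rmorphM mxE.
by apply: tp_sum => i; exact: tpZ.
Qed.

(** Bounds on the entries of incr: multiplication by i l . costs a factor J. *)
Definition stretch (b : nat -> R) k : R := if k is 0%N then 0 else J%:R * b k.

Lemma normci : normc ('i%C : C) = 1.
Proof. by rewrite /ComplexField.Normc.normc /= expr0n expr1n add0r sqrtr1. Qed.

Lemma tp_incr l g b n : (l1norm l <= J)%N -> (forall k, 0 <= b k) ->
  (forall k, (0 < k <= n)%N -> vtp (k * J) (b k) (g k)) ->
  forall k, (k <= n)%N -> tp (k * J) (stretch b k) (fun t => incr l g t k).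
Proof.
move=> lJ b0 h [|k] kn; first exact: tp0.
have := tpZ kap0 'i%C (tp_dot l (h k.+1 kn)); rewrite normci mul1r.
by apply: tp_le => //; rewrite ler_wpM2r // ler_nat.
Qed.

(** Degree count: the phase has degree at most J and the n-th coefficient of the
    exponential has degree n J. *)
Lemma tp_forcec g b n j : (forall k, 0 <= b k) ->
  (forall k, (0 < k <= n)%N -> vtp (k * J) (b k) (g k)) ->
  tp (n.+1 * J) (wnorm_force * ecoef (stretch b) n) (forcec g n j).
Proof.
move=> b0 h.
have [va0|[a0 a0va]] : (va = [::]) \/ exists a, a \in va.
  by case: va => [|a s]; [left|right; exists a; rewrite inE eqxx].
  rewrite /wnorm_force va0 big1 => [|i _]; last by rewrite big_nil.
  by rewrite mul0r; apply: tp_ext (tp0 _ _ _) => t; rewrite /forcec va0 big_nil.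
have e0 : 0 <= ecoef (stretch b) n.
  apply: (@tp_ge0 _ _ _ K kap (n * J) _ (fun t => ecoef (incr a0.2 g t) n)).
  by apply: (tp_ecoef kap0) => k; apply: tp_incr => //; exact: (allP vaJ).
apply: (@tp_le _ _ _ _ _ (n.+1 * J) _
   (\sum_(a <- va) normc (a.1 0 j) * wexp kap (pull K a.2) * ecoef (stretch b) n)) => //.
  rewrite -mulr_suml ler_wpM2r // /wnorm_force (bigD1 j) //= lerDl sumr_ge0 // => i _.
  by apply: sumr_ge0 => a _; rewrite mulr_ge0 ?normc_ge0 ?wexp_ge0.
have H (a : 'rV[C]_D * 'rV[int]_D) : (l1norm a.2 <= J)%N -> tp (n.+1 * J)
    (normc (a.1 0 j) * wexp kap (pull K a.2) * ecoef (stretch b) n)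
    (fun t => a.1 0 j * phase a.2 t * ecoef (incr a.2 g t) n).
  move=> aJ; apply: (@tp_le _ _ _ _ _ (l1norm a.2 + n * J) _
    (normc (a.1 0 j) * wexp kap (pull K a.2) * ecoef (stretch b) n)) => //.
    by rewrite mulSn leq_add2r.
  apply: (tpM kap0); first by apply: tpZ => //; exact: tp_phase.
  by apply: (tp_ecoef kap0) => k; exact: tp_incr.
rewrite /forcec; elim: (va) vaJ => [|a s IH] /=.
  by move=> _; rewrite big_nil; apply: tp_ext (tp0 _ _ _) => t; rewrite big_nil.
move=> /andP[aJ sJ]; rewrite big_cons.
by apply: tp_ext (tpD (H a aJ) (IH sJ)) => t; rewrite big_cons.
Qed.

Lemma vtp_force g b n : (forall k, 0 <= b k) ->
  (forall k, (0 < k <= n)%N -> vtp (k * J) (b k) (g k)) ->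
  vtp (n.+1 * J) (wnorm_force * ecoef (stretch b) n) (force g n).
Proof.
by move=> b0 h j; apply: tp_ext (tp_Re kap0 (tp_forcec j b0 h)) => t; rewrite mxE.
Qed.

Lemma force_eq g g' n : (forall k, (k <= n)%N -> g k = g' k) -> force g n = force g' n.
Proof.
move=> gg; apply/funext => t; apply/rowP => j; rewrite !mxE; congr complex.Re.
apply: eq_bigr => a _; congr (_ * _); apply: ecoef_eq => -[|k] kn //=.
by rewrite gg.
Qed.

(** A constant c added to g_n changes the n-th coefficient only through the
    Hessian, because g_n enters it linearly. *)
Lemma force_lin g g' n c : (0 < n)%N -> (forall k, (k < n)%N -> g k = g' k) ->
  (forall t, g n t = g' n t + c) -> forall t, force g n t = force g' n t + hess c t.
Proof.
move=> n0 gg gn t; apply/rowP => j; rewrite !mxE -ReD; congr complex.Re.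
apply/eqP; rewrite -subr_eq0 opprD addrA subr_eq0; apply/eqP.
rewrite -sumrB; apply: eq_bigr => a _; rewrite -mulrBr; congr (_ * _).
rewrite ecoef_lin //; last by case=> [//|k] kn /=; rewrite gg.
case: n n0 gg gn => // n _ _ gn /=.
by rewrite gn dotDr rmorphD mulrDr addrC addKr.
Qed.

Lemma vtp_hess c : exists M, vtp J M (hess c).
Proof.
have [M hM] : exists M, forall j, tp J (M j) (hessc c j).
  suff /choice [M hM] : forall j, exists M, tp J M (hessc c j) by exists M.
  move=> j; rewrite /hessc; elim: (va) vaJ => [|a s IH] /=.
    by move=> _; exists 0; apply: tp_ext (tp0 _ _ _) => t; rewrite big_nil.
  move=> /andP[aJ sJ]; have [M hM] := IH sJ.
  have h := tpM kap0 (tpZ kap0 (a.1 0 j) (tp_phase a.2))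
    (tp_cst K kap 0 (lexx (normc ('i%C * (dot (intv R a.2) c)%:C%C)))).
  eexists; apply: tp_ext (tpD (tp_le _ (lexx _) h) hM) => [t|]; first by rewrite big_cons.
  by rewrite addn0.
exists (\sum_j M j) => j; apply: tp_ext (_ : tp _ _ (fun t => (complex.Re (hessc c j t))%:C%C)).
  by move=> t; rewrite mxE.
apply: tp_Re => //; apply: tp_le (hM j) => //.
rewrite (bigD1 j) //= lerDl sumr_ge0 // => i _; exact: tp_ge0 (hM i).
Qed.

Lemma hessZ a c t : hess (a *: c) t = a *: hess c t.
Proof.
apply/rowP => j; rewrite !mxE -ReZr; congr complex.Re.
rewrite /hessc mulr_sumr; apply: eq_bigr => x _.
by rewrite dotZr rmorphM; ring.
Qed.

(** The first difference of the lift theta K + g: its constant part omega K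
    occurs at order 0. *)
Definition dissipation g n (t : 'rV[R]_L) : 'rV[R]_D :=
  g n t - g n (t - omega) + (if n is 0%N then embed omega else 0).

Definition source g n (t : 'rV[R]_L) : 'rV[R]_D :=
  (if n is n'.+1 then force g n' t else 0) -
  gamma *: (if n is n'.+3 then dissipation g n' t else 0).

Definition order_eq (g : nat -> 'rV[R]_L -> 'rV[R]_D) (mu : nat -> 'rV[R]_D) n : Prop :=
  forall t, g n (t + omega) + g n (t - omega) - 2 *: g n t = source g n t + mu n.

(** The conditions at order n. The last one is the solvability of the equation of
    order n + 1; it is recorded here because it is what fixes the average of
    g_n along kp. *)
Definition order_ok (h : nat -> ('rV[R]_L -> 'rV[R]_D) * 'rV[R]_D) n : Prop :=
  let g k := (h k).1 in let mu k := (h k).2 in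
  [/\ order_eq g mu n, exists M, vtp (n * J) M (g n),
      exists2 a, mean (g n) = a *: kp & (n = 0%N -> a = beta),
      dot (mu n) kp = 0 & dot (mean (force g n)) kp = 0].

Lemma dissipation_eq g g' n : (forall k, (k <= n)%N -> g k = g' k) -> dissipation g n = dissipation g' n.
Proof. by move=> gg; apply/funext => t; rewrite /dissipation gg. Qed.

Lemma source_eq g g' n : (forall k, (k < n)%N -> g k = g' k) -> source g n = source g' n.
Proof.
move=> gg; apply/funext => t; rewrite /source; case: n gg => [//|n] gg.
rewrite (@force_eq g g') //; case: n gg => [//|[//|n]] gg.
by rewrite (@dissipation_eq g g') // => k kn; apply: gg; lia.
Qed.

Lemma order_ok_ext h h' n : (forall k, (k <= n)%N -> h k = h' k) ->
  order_ok h n -> order_ok h' n.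
Proof.
move=> hh [h1 h2 h3 h4 h5]; have hn := hh n (leqnn n).
split; [|by rewrite -hn|by rewrite -hn|by rewrite -hn|].
- move=> t; rewrite -hn h1; congr (_ t + _).
  by apply: source_eq => k /ltnW kn; rewrite hh.
- by rewrite -(@force_eq (fun k => (h k).1)) // => k kn; rewrite hh.
Qed.

Lemma vtp_dissipation g n M : vtp (n * J) M (g n) ->
  vtp (n * J) (M + M + \sum_j `|embed omega 0 j|) (dissipation g n).
Proof.
move=> h; apply: vtpD.
  apply: vtpD => //; have := vtpZ (-1) (vtp_shift (- omega) h).
  rewrite normrN1 mul1r => {}h j; apply: tp_ext (h j) => t.
  by rewrite scaleN1r.
case: n {h} => [|n]; apply: vtp_cst => j; last by rewrite mxE normr0 sumr_ge0.
by rewrite (bigD1 j) //= lerDl sumr_ge0.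
Qed.

(** Differences of periodic functions have average zero. *)
Lemma mean_dissipation g n M : vtp (n * J) M (g n) ->
  mean (dissipation g n) = if n is 0%N then embed omega else 0.
Proof.
move=> h; have cg := vtp_cont h.
have cs : vcont (fun t => - g n (t - omega)).
  by have := vcontZ (-1) (vcont_shift (- omega) cg); under eq_fun do rewrite scaleN1r.
rewrite /dissipation meanD ?meanD ?mean_cst //; [|exact: vcontD|exact: vcont_cst].
have -> : mean (fun t => - g n (t - omega)) = - mean (g n).
  have -> : (fun t => - g n (t - omega)) = (fun t => (-1) *: g n (t - omega)).
    by apply/funext => t; rewrite scaleN1r.
  rewrite meanZ; last exact: vcont_shift.
  by rewrite mean_shift ?scaleN1r // => j; exact: vtp_periodic h.
by rewrite subrr add0r.
Qed.

Lemma vtp_source g n : (forall k, (k < n)%N -> exists M, vtp (k * J) M (g k)) ->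
  exists M, vtp (n * J) M (source g n).
Proof.
move=> h; case: n h => [|n] h.
  exists 0 => j; apply: tp_ext (tp0 _ _ _) => t.
  by rewrite /source scaler0 subr0 mxE.
have [b hb] : exists b : nat -> R, forall k, (k <= n)%N -> vtp (k * J) (b k) (g k).
  suff /choice [b hb] : forall k, exists M, (k <= n)%N -> vtp (k * J) M (g k) by exists b.
  move=> k; have [kn|_] := leqP k n; last by exists 0.
  by have [M hM] := h k kn; exists M.
have h1 := @vtp_force g (fun k => `|b k|) n (fun k => normr_ge0 _)
  (fun k kn => vtp_le (leqnn _) (ler_norm _) (hb k (proj2 (andP kn)))).
have [M hM] : exists M, vtp (n.+1 * J) M (fun t => if n.+1 is n'.+3 then dissipation g n' t else 0).
  case: n h hb h1 => [|[|n]] h hb h1; do ?by exists 0; apply: vtp_cst => j; rewrite mxE normr0.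
  have [|M hM] := h n; first lia.
  by eexists; apply: vtp_le (lexx _) (vtp_dissipation hM); rewrite leq_mul2r; lia.
have hs := vtpD h1 (vtpZ (- gamma) hM).
by eexists => j; apply: tp_ext (hs j) => t; rewrite /source scaleNr.
Qed.

Hypothesis div0 : forall m : 'rV[int]_L, m != 0 -> divisor omega m != 0.
Hypothesis kp_embed : dot (embed omega) kp = 0.

(** The solution of average zero; the loss of a factor B is the whole cost of the
    small divisors. *)
Lemma solve_sdiff d M B (f : 'rV[R]_L -> 'rV[R]_D) : vtp d M f -> 0 <= B ->
  (forall l : 'rV[int]_D, (l1norm l <= d)%N -> pull K l != 0 ->
     `|divisor omega (pull K l)|^-1 <= B) ->
  exists g : 'rV[R]_L -> 'rV[R]_D, [/\ vtp d (B * M) g,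
    forall t, g (t + omega) + g (t - omega) - 2 *: g t = f t - mean f & mean g = 0].
Proof.
move=> hf B0 hB; have cf := vtp_cont hf.
have hBd l : (l1norm l <= d)%N -> pull K l != 0 ->
    divisor omega (pull K l) != 0 /\ `|divisor omega (pull K l)|^-1 <= B.
  by move=> ld l0; split; [exact: div0|exact: hB].
have /choice [G hG] : forall j, exists g, [/\ tp d (B * M) g,
    (forall t, g (t + omega) + g (t - omega) - 2 * g t =
       (f t 0 j)%:C%C - cfourier (fun t => (f t 0 j)%:C%C) 0) & cfourier g 0 = 0].
  by move=> j; exact: (tp_inv (hf j) hBd B0).
exists (fun t => \row_j complex.Re (G j t)); split.
- move=> j; have [h _ _] := hG j.
  by apply: tp_ext (tp_Re kap0 h) => t; rewrite mxE.
- move=> t; apply/rowP => j; have [_ h _] := hG j.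
  have ReB (x y : C) : complex.Re (x - y) = complex.Re x - complex.Re y.
    by case: x y => [a b] [c e].
  have := congr1 (@complex.Re R) (h t); rewrite -/(cmean f j) !ReB ReD mulr_natl mulr2n ReD.
  by rewrite /mean !mxE => <-; rewrite mulr_natl mulr2n.
apply/rowP => j; rewrite mxE mxE /cmean.
have [hg _ g0] := hG j; have [c1 c2] := tp_ccont hg.
under eq_fun do rewrite mxE.
have := congr1 (@complex.Re R) g0.
rewrite /cfourier !ReZr /= intv0 => h; rewrite -[RHS]h; congr (_ * torus_int _).
by apply/funext => t; rewrite dot0l oppr0 expi0 mulr1 cos0 mulr1 mul0r subr0.
Qed.

Lemma divisor_bound d : exists2 B : R, 0 <= B &
  forall l : 'rV[int]_D, (l1norm l <= d)%N -> `|divisor omega (pull K l)|^-1 <= B.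
Proof.
exists (\sum_(l <- l1ball D d) `|divisor omega (pull K l)|^-1).
  by apply: sumr_ge0 => l _; rewrite invr_ge0.
move=> l ld; have lb : l \in l1ball D d by rewrite mem_l1ball.
by rewrite (bigD1_seq l) ?l1ball_uniq //= lerDl sumr_ge0 // => i _; rewrite invr_ge0.
Qed.

Hypothesis solv0 : dot (mean (fun t => \row_j complex.Re
   (\sum_(a <- va) a.1 0 j * phase a.2 t))) kp = 0.
Hypothesis nondeg : kp = 0 \/ dot (mean (hess kp)) kp != 0.

Lemma force0 g t : force g 0 t = \row_j complex.Re (\sum_(a <- va) a.1 0 j * phase a.2 t).
Proof.
apply/rowP => j; rewrite !mxE; congr complex.Re.
by apply: eq_bigr => a _; rewrite ecoef0 mulr1.
Qed.

(** The equation determines g_n up to a constant a kp, and a is then chosen to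
    make the next order solvable. *)
Lemma order_step n h : (forall m, (m < n)%N -> order_ok h m) ->
  exists s, order_ok (upd h n s) n.
Proof.
move=> hm.
pose g k := (h k).1.
have gtp k : (k < n)%N -> exists M, vtp (k * J) M (g k) by move=> /hm [].
case: n hm gtp => [|n] hm gtp.
  exists (fun _ => beta *: kp, 0); rewrite /order_ok /upd eqxx /=; split.
  - move=> t /=; rewrite /source /= addr0 scaler0 subr0.
    by rewrite -[2]/(1 + 1) scalerDl scale1r subrr.
  - by eexists; exact: vtp_cst_sum.
  - by exists beta => //; rewrite mean_cst.
  - by rewrite dot0l.
  - by rewrite -[RHS]solv0; congr (dot (mean _) _); apply/funext => t; rewrite force0.
have [M hM] := vtp_source gtp.
have [B B0 hB] := divisor_bound (n.+1 * J).
have [gt [hgt gte gt0]] := solve_sdiff hM B0 (fun l ld _ => hB l ld).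
pose mu := - mean (source g n.+1).
have mu0 : dot mu kp = 0.
  have hn : dot (mean (force g n)) kp = 0 by have [] := hm n (ltnSn n).
  have [b hb] : exists b : nat -> R, forall k, (k <= n)%N -> vtp (k * J) (b k) (g k).
    suff /choice [b hb] : forall k, exists M, (k <= n)%N -> vtp (k * J) M (g k) by exists b.
    move=> k; have [kn|_] := leqP k n; last by exists 0.
    by have [M' hM'] := gtp k kn; exists M'.
  have h1 := @vtp_force g (fun k => `|b k|) n (fun k => normr_ge0 _)
    (fun k kn => vtp_le (leqnn _) (ler_norm _) (hb k (proj2 (andP kn)))).
  have [c2 h2] : vcont (fun t => if n.+1 is n'.+3 then dissipation g n' t else 0) /\
      dot (mean (fun t => if n.+1 is n'.+3 then dissipation g n' t else 0)) kp = 0.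
    case: n hb {hn h1 hm gtp hM hB hgt gte mu} => [|[|n]] hb.
    - by split; [exact: vcont_cst|rewrite mean_cst dot0l].
    - by split; [exact: vcont_cst|rewrite mean_cst dot0l].
    have hbn : vtp (n * J) (b n) (g n) by apply: hb; lia.
    split; first exact: vtp_cont (vtp_dissipation hbn).
    by rewrite (mean_dissipation hbn); case: (n); rewrite ?kp_embed ?dot0l.
  rewrite /mu dotNl /source.
  have -> : (fun t => force g n t - gamma *: (if n.+1 is n'.+3 then dissipation g n' t else 0)) =
      (fun t => force g n t + (- gamma) *: (if n.+1 is n'.+3 then dissipation g n' t else 0)).
    by apply/funext => t; rewrite scaleNr.
  rewrite meanD ?meanZ //; [|exact: vtp_cont h1|exact: vcontZ].
  by rewrite dotDl dotZl h2 hn mulr0 addr0 oppr0.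
(* the average along kp is free at this order; it is fixed by the solvability of the next one *)
have [a ha] : exists a, dot (mean (force (upd g n.+1 (fun t => gt t + a *: kp)) n.+1)) kp = 0.
  have hF a t : force (upd g n.+1 (fun t => gt t + a *: kp)) n.+1 t =
      force (upd g n.+1 gt) n.+1 t + a *: hess kp t.
    rewrite -hessZ; apply: force_lin => // [k kn|t']; first by rewrite /upd ltn_eqF.
    by rewrite /upd eqxx.
  case: nondeg => [kp0|hn]; first by exists 0; rewrite kp0 dot0r.
  exists (- dot (mean (force (upd g n.+1 gt) n.+1)) kp / dot (mean (hess kp)) kp).
  rewrite (funext (hF _)).
  have [b hb] : exists b : nat -> R, forall k, (k <= n.+1)%N -> vtp (k * J) (b k) (upd g n.+1 gt k).
    suff /choice [b hb] : forall k, exists M, (k <= n.+1)%N -> vtp (k * J) M (upd g n.+1 gt k) by exists b.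
    move=> k; have [kn|_] := leqP k n.+1; last by exists 0.
    rewrite /upd; case: eqVneq => [->|kn']; first by exists (B * M).
    by have [|M' hM'] := gtp k; [lia|exists M'].
  have h1 := @vtp_force (upd g n.+1 gt) (fun k => `|b k|) n.+1 (fun k => normr_ge0 _)
    (fun k kn => vtp_le (leqnn _) (ler_norm _) (hb k (proj2 (andP kn)))).
  have [M' hM'] := vtp_hess kp.
  rewrite meanD ?meanZ; do ?[exact: vtp_cont h1|exact: vtp_cont hM'|exact: vcontZ (vtp_cont hM')].
  by rewrite dotDl dotZl divfK // subrr.
pose gn t := gt t + a *: kp.
exists (gn, mu).
have E k : (upd h n.+1 (gn, mu) k).1 = upd g n.+1 gn k by rewrite /upd; case: eqP.
rewrite /order_ok; have -> : (fun k => (upd h n.+1 (gn, mu) k).1) = upd g n.+1 gn.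
  by apply/funext => k; rewrite E.
have -> : (upd h n.+1 (gn, mu) n.+1).2 = mu by rewrite /upd eqxx.
have -> : (upd h n.+1 (gn, mu) n.+1).1 = gn by rewrite /upd eqxx.
split=> //.
- move=> t; rewrite /upd eqxx /=.
  have -> : source (fun k => if k == n.+1 then gn else g k) n.+1 = source g n.+1.
    by apply: source_eq => k kn; rewrite ltn_eqF.
  rewrite /mu -gte /gn; set x := gt _; set y := gt _; set z := gt _.
  rewrite scalerDr -[2]/(1 + 1) !scalerDl !scale1r !opprD.
  by apply/rowP => j; rewrite !mxE; ring.
- by eexists; exact: vtpD hgt (vtp_cst_sum _ _).
- exists a => //; rewrite meanD ?mean_cst ?gt0 ?add0r //; first exact: vtp_cont hgt.
  exact: vcont_cst.
Qed.

Theorem formal_expansion : exists h, forall n, order_ok h n.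
Proof.
apply: (dependent_sequence (fun _ => 0, 0)).
  exact: order_ok_ext.
exact: order_step.
Qed.

(** * The residual of the truncated expansion *)

Variable Vp : 'rV[R]_D -> 'rV[R]_D.
Hypothesis VpE : forall x j, (Vp x 0 j)%:C%C =
  \sum_(a <- va) a.1 0 j * expi (dot (intv R a.2) x) :> C.

Definition resid (e : R) (u : 'rV[R]_L -> 'rV[R]_D) (m : 'rV[R]_D) (t : 'rV[R]_L) : 'rV[R]_D :=
  u (t + omega) + u (t - omega) - 2 *: u t - e *: Vp (embed t + u t) - m
  + (gamma * e ^+ 3) *: (u t - u (t - omega) + embed omega).

Definition psum (g : nat -> 'rV[R]_L -> 'rV[R]_D) N (e : R) (t : 'rV[R]_L) : 'rV[R]_D :=
  \sum_(n < N.+1) e ^+ n *: g n t.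

Definition pmu (mu : nat -> 'rV[R]_D) N (e : R) : 'rV[R]_D :=
  \sum_(n < N.+1) e ^+ n *: mu n.

Lemma vtp0_cst M f : vtp (0 * J) M f -> forall t, f t = mean f.
Proof.
move=> h t; apply/rowP => j; apply: (@complexI R).
rewrite meanE; last exact: vtp_cont h.
have [s [fs sJ _]] := h j; rewrite /cmean (_ : (fun t => _) = teval K s); last exact/funext.
rewrite fs cfourier_teval /teval big_seq [RHS]big_seq; apply: eq_bigr => x xs.
have := allP sJ _ xs; rewrite mul0n leqn0 l1norm_eq0 => /eqP ->.
by rewrite /emon pull0 intv0 dot0l expi0 eqxx.
Qed.

Variable h : nat -> ('rV[R]_L -> 'rV[R]_D) * 'rV[R]_D.
Hypothesis hok : forall n, order_ok h n.
Let g k := (h k).1.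
Let mu k := (h k).2.

Lemma order0_cst t : g 0%N t = beta *: kp.
Proof.
have [_ [M hM] [a ha aE] _ _] := hok 0.
by rewrite [g 0 t](vtp0_cst hM t) ha aE.
Qed.

Lemma order_bounds : exists2 b : nat -> R, forall k, 0 <= b k & forall k, vtp (k * J) (b k) (g k).
Proof.
have /choice [b hb] : forall k, exists M, vtp (k * J) M (g k) by move=> k; have [] := hok k.
exists (fun k => `|b k|) => // k; exact: vtp_le (ler_norm _) (hb k).
Qed.

Let D3 n (t : 'rV[R]_L) : 'rV[R]_D := if n is n'.+3 then dissipation g n' t else 0.
Let F1 n (t : 'rV[R]_L) : 'rV[R]_D := if n is n'.+1 then force g n' t else 0.

(** Up to order N the truncated series solves the equation, so what remains is the
    Taylor remainder of the force, the last force coefficient, and the three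
    dissipative terms shifted beyond N by the factor e^3. *)
Lemma resid_psum N e t : resid e (psum g N e) (pmu mu N e) t =
  - (e *: (Vp (embed t + psum g N e t) - \sum_(n < N.+1) e ^+ n *: force g n t))
  - e ^+ N.+1 *: force g N t
  + gamma *: (e ^+ N.+1 *: D3 N.+1 t + e ^+ N.+2 *: D3 N.+2 t + e ^+ N.+3 *: D3 N.+3 t).
Proof.
have E1 : e *: \sum_(n < N.+1) e ^+ n *: force g n t =
    \sum_(n < N.+1) e ^+ n *: F1 n t + e ^+ N.+1 *: force g N t.
  transitivity (\sum_(n < N.+2) e ^+ n *: F1 n t); last by rewrite big_ord_recr.
  rewrite [RHS]big_ord_recl /= scaler0 add0r scaler_sumr; apply: eq_bigr => n _.
  by rewrite scalerA -exprS.
have E2 : e ^+ 3 *: \sum_(n < N.+1) e ^+ n *: dissipation g n t =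
    \sum_(n < N.+1) e ^+ n *: D3 n t +
    (e ^+ N.+1 *: D3 N.+1 t + e ^+ N.+2 *: D3 N.+2 t + e ^+ N.+3 *: D3 N.+3 t).
  transitivity (\sum_(n < N.+4) e ^+ n *: D3 n t); last by rewrite !big_ord_recr /= !addrA.
  rewrite [RHS]big_ord_recl [X in _ = _ + X]big_ord_recl [X in _ = _ + (_ + X)]big_ord_recl.
  rewrite /= !scaler0 !add0r scaler_sumr; apply: eq_bigr => n _.
  by rewrite scalerA -exprD.
have E3 : psum g N e t - psum g N e (t - omega) + embed omega =
    \sum_(n < N.+1) e ^+ n *: dissipation g n t.
  rewrite /psum -sumrB big_ord_recl [RHS]big_ord_recl /= expr0 !scale1r addrAC; congr (_ + _).
  by apply: eq_bigr => n _; rewrite /dissipation addr0 scalerBr.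
have E4 : psum g N e (t + omega) + psum g N e (t - omega) - 2 *: psum g N e t - pmu mu N e =
    \sum_(n < N.+1) e ^+ n *: F1 n t - gamma *: \sum_(n < N.+1) e ^+ n *: D3 n t.
  rewrite /psum /pmu !scaler_sumr -big_split /= -!sumrB; apply: eq_bigr => n _.
  have [/(_ t) hE _ _ _ _] := hok n.
  transitivity (e ^+ n *: (g n (t + omega) + g n (t - omega) - 2 *: g n t - mu n)).
    by apply/rowP => j; rewrite !mxE; ring.
  rewrite hE addrK /source scalerBr; congr (_ - _).
  by rewrite !scalerA mulrC.
rewrite /resid E3 -scalerA E2.
rewrite (_ : _ - e *: _ - _ = (psum g N e (t + omega) + psum g N e (t - omega)
  - 2 *: psum g N e t - pmu mu N e) - e *: Vp (embed t + psum g N e t)); last by rewrite addrAC.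
rewrite E4 scalerBr E1.
move: (\sum_(n < N.+1) _) (\sum_(n < N.+1) _) => A B.
by apply/rowP => j; rewrite !mxE; ring.
Qed.

(** The exponent of the exponential of frequency l, relative to the unperturbed
    embedding. *)
Definition ysum (l : 'rV[int]_D) N (e : R) t : R := dot (intv R l) (psum g N e t - beta *: kp).

Lemma ysumE l N e t : 'i%C * (ysum l N e t)%:C%C =
  \sum_(k < N.+1) e%:C%C ^+ k * incr l g t k.
Proof.
rewrite /ysum /psum big_ord_recl /= expr0 scale1r order0_cst addrAC subrr add0r.
rewrite [RHS]big_ord_recl /= mulr0 add0r.
have -> (I : finType) (F : I -> 'rV[R]_D) : dot (intv R l) (\sum_i F i) = \sum_i dot (intv R l) (F i).
  by rewrite (big_morph _ (fun x y => dotDr x y (intv R l)) (dot0r _)).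
rewrite rmorph_sum mulr_sumr; apply: eq_bigr => k _.
by rewrite dotZr rmorphM rmorphXn /= mulrCA.
Qed.

Lemma Vp_psum N e t j : (Vp (embed t + psum g N e t) 0 j)%:C%C =
  \sum_(a <- va) a.1 0 j * phase a.2 t * expi (ysum a.2 N e t) :> C.
Proof.
rewrite VpE; apply: eq_bigr => a _; rewrite -mulrA /phase -expiD -dotDr.
by congr (_ * expi (dot _ _)); rewrite -addrA [beta *: kp + _]addrC subrK.
Qed.

Lemma powfact_le M (x y : R) : 0 <= x -> x <= y -> powfact M x <= powfact M y.
Proof.
move=> x0 xy; rewrite /powfact ler_wpM2r ?invr_ge0 // lerXn2r ?nnegrE //.
exact: le_trans xy.
Qed.

(** With the exponential replaced by its partial sum of M + 1 terms the difference
    is a trigonometric polynomial, bounded uniformly in M; the partial sums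
    converge uniformly, and the bound passes to the limit. *)
Lemma wien_taylor N : exists2 C0 : R, 0 <= C0 & forall e j, `|e| <= 1 ->
  wien kap (C0 * `|e| ^+ N.+1) (fun t =>
    ((Vp (embed t + psum g N e t) - \sum_(n < N.+1) e ^+ n *: force g n t) 0 j)%:C%C).
Proof.
have [b b0 hb] := order_bounds.
pose Y := \sum_(k < N.+1) stretch b k.
have s0 k : 0 <= stretch b k by case: k => [|k] //=; rewrite mulr_ge0.
have Y0 : 0 <= Y by exact: sumr_ge0.
have MV0 : 0 <= wnorm_force.
  apply: sumr_ge0 => i _; apply: sumr_ge0 => a _.
  by rewrite mulr_ge0 ?normc_ge0 ?wexp_ge0.
exists (wnorm_force * expR Y); first by rewrite mulr_ge0 ?expR_ge0.
move=> e j e1.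
pose T t : C := \sum_(a <- va) a.1 0 j * phase a.2 t *
  (expi (ysum a.2 N e t) - \sum_(n < N.+1) e%:C%C ^+ n * ecoef (incr a.2 g t) n).
pose S M t : C := \sum_(a <- va) a.1 0 j * phase a.2 t *
  (expi_sum M.+1 (ysum a.2 N e t) - \sum_(n < N.+1) e%:C%C ^+ n * ecoef (incr a.2 g t) n).
have TE t : ((Vp (embed t + psum g N e t) - \sum_(n < N.+1) e ^+ n *: force g n t) 0 j)%:C%C =
    (complex.Re (T t))%:C%C :> C.
  congr (_%:C%C); rewrite /T.
  under [in RHS]eq_bigr do rewrite mulrBr.
  have ReB (x y : C) : complex.Re (x - y) = complex.Re x - complex.Re y.
    by case: x y => [? ?] [? ?].
  rewrite sumrB ReB -Vp_psum mxE [X in _ + X = _]mxE; congr (_ - _); rewrite summxE.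
  under [in RHS]eq_bigr do rewrite mulr_sumr.
  rewrite exchange_big Re_sum; apply: eq_bigr => n _.
  rewrite !mxE -ReZr rmorphXn /forcec mulr_sumr; congr complex.Re; apply: eq_bigr => a _ /=; ring.
have inc a k : (l1norm a <= J)%N -> (k <= N)%N -> tp (k * J) (stretch b k) (fun t => incr a g t k).
  by move=> aJ kN; apply: (@tp_incr a g b N).
have tpS M : (N <= M)%N -> exists J', tp J' (wnorm_force * expR Y * `|e| ^+ N.+1) (S M).
  move=> NM.
  have H (a : 'rV[C]_D * 'rV[int]_D) : (l1norm a.2 <= J)%N -> exists J', tp J'
      (normc (a.1 0 j) * wexp kap (pull K a.2) * (expR Y * `|e| ^+ N.+1))
      (fun t => a.1 0 j * phase a.2 t *
        (expi_sum M.+1 (ysum a.2 N e t) - \sum_(n < N.+1) e%:C%C ^+ n * ecoef (incr a.2 g t) n)).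
    move=> aJ.
    have [J' hJ'] := tp_pexp_rem kap0 (e := e) (M := M)
       (x := fun k t => incr a.2 g t k) (fun k kN => inc a.2 k aJ kN) (fun t => erefl) e1 NM.
    exists (l1norm a.2 + J')%N; apply: (tpM kap0); first by apply: tpZ => //; exact: tp_phase.
    apply: tp_ext (tp_le (leqnn _) _ hJ') => [t|].
      congr (_ - _); rewrite /expi_sum; apply: eq_bigr => m _; congr (_ * _ ^+ _).
      by rewrite ysumE.
    rewrite mulrC ler_wpM2r ?exprn_ge0 //; exact: exp_sum_le.
  have [J' hJ'] : exists J', tp J'
      (\sum_(a <- va) normc (a.1 0 j) * wexp kap (pull K a.2) * (expR Y * `|e| ^+ N.+1)) (S M).
    rewrite /S; elim: (va) vaJ => [_|a s IH /= /andP[aJ sJ]].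
      by exists 0%N; rewrite big_nil; apply: tp_ext (tp0 _ _ _) => t; rewrite big_nil.
    have [J1 h1] := H a aJ; have [J2 h2] := IH sJ; exists (maxn J1 J2); rewrite big_cons.
    apply: tp_ext (tpD (tp_le (leq_maxl J1 J2) (lexx _) h1) (tp_le (leq_maxr J1 J2) (lexx _) h2)) => t.
    by rewrite big_cons.
  exists J'; apply: tp_le (leqnn _) _ hJ'.
  rewrite -mulr_suml -mulrA ler_wpM2r ?mulr_ge0 ?expR_ge0 ?exprn_ge0 //.
  rewrite /wnorm_force (bigD1 j) //= lerDl sumr_ge0 // => i _.
  by apply: sumr_ge0 => a _; rewrite mulr_ge0 ?normc_ge0 ?wexp_ge0.
pose A := \sum_(a <- va) normc (a.1 0 j).
have A0 : 0 <= A by apply: sumr_ge0 => a _; exact: normc_ge0.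
have ST M t : normc (T t - S M t) <= A * (2 * powfact M.+1 Y).
  rewrite /T /S -sumrB /A mulr_suml; apply: le_trans (le_normc_sum _ _) _.
  rewrite big_seq [leRHS]big_seq; apply: ler_sum => a ain.
  rewrite -mulrBr !ComplexField.Normc.normcM normc_expi mulr1 ler_wpM2l ?normc_ge0 //.
  rewrite opprB addrA subrK; apply: le_trans (expi_taylor _ _) _.
  rewrite ler_wpM2l //; apply: powfact_le => //.
  rewrite -normc_real -[normc _]mul1r -normci -ComplexField.Normc.normcM ysumE.
  apply: le_trans (le_normc_sum _ _) _; apply: ler_sum => k _.
  rewrite ComplexField.Normc.normcM normcX normc_real -[leRHS]mul1r.
  rewrite ler_pM ?normc_ge0 ?exprn_ge0 ?exprn_ile1 //.
  by apply: (tp_normc kap0 t (inc a.2 k _ _)); [exact: (allP vaJ)|rewrite -ltnS].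
have cT : ccont (fun t => (complex.Re (T t))%:C%C).
  have hT : ccont T.
    apply: ccont_sum => a; apply: ccontM; first by apply: ccontZ; exact: tp_ccont (tp_phase _).
    have -> : (fun t => expi (ysum a.2 N e t) - \sum_(n < N.+1) e%:C%C ^+ n * ecoef (incr a.2 g t) n) =
      (fun t => expi (ysum a.2 N e t) + (-1) * \sum_(n < N.+1) e%:C%C ^+ n * ecoef (incr a.2 g t) n).
      by apply/funext => t; rewrite mulN1r.
    apply: ccontD.
      apply: (@ccont_o R _ _ (ysum a.2 N e) (@expi R)); last exact: ccont_expi.
      rewrite /ysum; apply: continuous_fct_sum => i.
      apply: continuous_fctM; first exact: continuous_fct_cst.
      under eq_fun do rewrite mxE summxE mxE.
      apply: continuous_fctD; last exact: continuous_fct_cst.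
      apply: continuous_fct_sum => k; under eq_fun do rewrite mxE.
      apply: continuous_fctM; first exact: continuous_fct_cst.
      by have [+ _] := vtp_cont (hb k) i.
    apply: ccontZ; apply: ccont_sum => n; apply: ccontZ.
    have /choice [B hB] : forall k, exists M, tp (k * J) M (fun t => incr a.2 g t k).
      case=> [|k]; first by exists 0; exact: tp0.
      by eexists; exact: (tpZ kap0 'i%C (tp_dot a.2 (hb k.+1))).
    exact: tp_ccont (tp_ecoef kap0 (n := n) (fun k _ => hB k)).
  by apply: ccont_real; have [] := hT.
apply: wien_ext (_ : wien kap _ (fun t => (complex.Re (T t))%:C%C)) => [t|]; first by rewrite TE.
apply: wien_lim => // d d0.
have [M NM hM] : exists2 M, (N <= M)%N & A * (2 * powfact M.+1 Y) <= d.
  have d1 : 0 < d / (A * 2 + 1) by rewrite divr_gt0 // ltr_wpDl ?mulr_ge0.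
  have /cvgrPdist_lt /(_ _ d1) := powfact_cvg0 Y.
  move=> [M0 _ hM0]; exists (maxn N M0); first exact: leq_maxl.
  have := hM0 (maxn N M0).+1; rewrite /= sub0r normrN => /(_ (leq_trans (leq_maxr N M0) (leqnSn _))).
  rewrite ger0_norm; last by rewrite /powfact divr_ge0 // exprn_ge0.
  move=> /ltW hp; rewrite mulrA; apply: le_trans (ler_wpM2l _ hp) _; first by rewrite mulr_ge0.
  by rewrite mulrCA ger_pMr // ler_pdivrMr ?mul1r ?lerDl // ltr_wpDl ?mulr_ge0.
have [J' hJ'] := tpS M NM.
exists (fun t => (complex.Re (S M t))%:C%C); first exact: wien_tp (tp_Re kap0 hJ').
move=> t; rewrite -rmorphB normc_real; apply: le_trans (hM).
apply: le_trans (ST M t); apply: le_trans (le_Re_normc _).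
by case: (T t) (S M t) => [? ?] [? ?].
Qed.

Definition vwien M (f : 'rV[R]_L -> 'rV[R]_D) : Prop :=
  forall j, wien kap M (fun t => (f t 0 j)%:C%C).

Lemma vwienD M N f f' : vwien M f -> vwien N f' -> vwien (M + N) (fun t => f t + f' t).
Proof.
by move=> hf hg j; apply: wien_ext (wienD (hf j) (hg j)) => t; rewrite mxE rmorphD.
Qed.

Lemma vwienZ M a f : vwien M f -> vwien (`|a| * M) (fun t => a *: f t).
Proof.
move=> hf j; rewrite -normc_real; apply: wien_ext (wienZ a%:C%C (hf j)) => t.
by rewrite mxE rmorphM.
Qed.

Lemma vwien_le M N f : M <= N -> vwien M f -> vwien N f.
Proof. by move=> MN hf j; exact: wien_le (hf j). Qed.

Lemma vwien_tp d M f : vtp d M f -> vwien M f.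
Proof. by move=> hf j; exact: wien_tp (hf j). Qed.

Lemma resid_bound N : exists2 C0 : R, 0 < C0 & forall e, `|e| <= 1 ->
  vwien (C0 * `|e| ^+ N.+1) (resid e (psum g N e) (pmu mu N e)).
Proof.
have [C1 C10 hC1] := wien_taylor N.
have [b b0 hb] := order_bounds.
have hF := vtp_force b0 (fun k _ => hb k) (n := N).
set MF := wnorm_force * _ in hF.
have hD n : exists2 M, 0 <= M & vtp (n * J) M (D3 n).
  case: n => [|[|[|n]]]; rewrite /D3; do ?[by exists 0 => //; apply: vtp_cst => j; rewrite mxE normr0].
  exists (b n + b n + \sum_j `|embed omega 0 j|); first by rewrite !addr_ge0 ?sumr_ge0.
  by apply: vtp_le (lexx _) (vtp_dissipation (hb n)); rewrite leq_mul2r; lia.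
have [M1 M10 h1] := hD N.+1; have [M2 M20 h2] := hD N.+2; have [M3 M30 h3] := hD N.+3.
exists (C1 + `|MF| + `|gamma| * (M1 + M2 + M3) + 1).
  by rewrite ltr_wpDl // !addr_ge0 // mulr_ge0 // !addr_ge0.
move=> e e1; have e0 := normr_ge0 e.
have eN k : (N.+1 <= k)%N -> `|e| ^+ k <= `|e| ^+ N.+1 by move=> ?; exact: ler_wiXn2l.
have W1 : vwien (C1 * `|e| ^+ N.+1)
   (fun t => (- e) *: (Vp (embed t + psum g N e t) - \sum_(n < N.+1) e ^+ n *: force g n t)).
  apply: vwien_le (vwienZ (- e) (fun j => hC1 e j e1)).
  by rewrite normrN ler_piMl // mulr_ge0 ?exprn_ge0.
have W2 : vwien (`|MF| * `|e| ^+ N.+1) (fun t => (- e ^+ N.+1) *: force g N t).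
  apply: vwien_le (vwienZ _ (vwien_tp hF)).
  by rewrite normrN normrX mulrC ler_wpM2r ?exprn_ge0 // ler_norm.
have W3 k M (hk : (N.+1 <= k)%N) : 0 <= M -> vtp (k * J) M (D3 k) ->
    vwien (M * `|e| ^+ N.+1) (fun t => e ^+ k *: D3 k t).
  move=> M0 hM; apply: vwien_le (vwienZ _ (vwien_tp hM)).
  by rewrite normrX mulrC ler_wpM2l // eN.
have W := vwienD (vwienD W1 W2) (vwienZ gamma (vwienD (vwienD
  (W3 _ _ (leqnn _) M10 h1) (W3 _ _ (leqnSn _) M20 h2)) (W3 N.+3 _ (leq_trans (leqnSn _) (leqnSn _)) M30 h3))).
have {}W : vwien ((C1 + `|MF| + `|gamma| * (M1 + M2 + M3) + 1) * `|e| ^+ N.+1) _ :=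
  vwien_le _ W.
move=> j; apply: wien_ext (W _ j) => [t|].
  by rewrite resid_psum !scaleNr.
have : 0 <= `|e| ^+ N.+1 by exact: exprn_ge0.
by move: (`|e| ^+ N.+1) => x x0; rewrite -!mulrDl mulrA -mulrDl ler_wpM2r // lerDl.
Qed.

(** * Uniqueness of the formal solution *)

Lemma continuous_box_bounded (f : 'rV[R]_L -> R) : continuous f ->
  exists2 M : R, 0 <= M & forall t, torus_box t -> `|f t| <= M.
Proof.
move=> cf.
have cn : continuous (fun t => `|f t|) := continuous_o cf (@norm_continuous R R).
have b0 : @torus_box R L !=set0.
  by exists 0 => i; rewrite mxE lexx ltW ?period_gt0.
have [c _ hc] := compact_EVT_max b0 (@compact_torus_box R L) (continuous_subspaceT cn).
by exists `|f c| => // t ht; apply: hc; rewrite inE.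
Qed.

Definition abs_sum (v : 'rV[R]_D) : R := \sum_i `|v 0 i|.

Lemma abs_sum_ge0 v : 0 <= abs_sum v.
Proof. exact: sumr_ge0. Qed.

Lemma abs_sumD u v : abs_sum (u + v) <= abs_sum u + abs_sum v.
Proof. by rewrite /abs_sum -big_split /=; apply: ler_sum => i _; rewrite mxE ler_normD. Qed.

Lemma abs_sumZ a v : abs_sum (a *: v) = `|a| * abs_sum v.
Proof. by rewrite /abs_sum mulr_sumr; apply: eq_bigr => i _; rewrite mxE normrM. Qed.

Lemma dot_abs_sum (l : 'rV[int]_D) v : (l1norm l <= J)%N -> `|dot (intv R l) v| <= J%:R * abs_sum v.
Proof.
move=> lJ; apply: le_trans (ler_norm_sum _ _ _) _; rewrite mulr_sumr; apply: ler_sum => i _.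
rewrite normrM mxE ler_wpM2r // -intr_norm -abszE ler_nat (leq_trans _ lJ) //.
rewrite /l1norm (bigD1 i) //=; apply: leq_trans (leq_addr _ _).
by rewrite (_ : ord0 = 0 :> 'I_1) //; exact: val_inj.
Qed.

Definition norm_force : R := \sum_j \sum_(a <- va) normc (a.1 0 j).

Lemma norm_force_ge0 : 0 <= norm_force.
Proof. by apply: sumr_ge0 => j _; apply: sumr_ge0 => a _; exact: normc_ge0. Qed.

Lemma le_norm_force j (F : 'rV[C]_D * 'rV[int]_D -> C) M : 0 <= M ->
  (forall a, (l1norm a.2 <= J)%N -> normc (F a) <= M) ->
  normc (\sum_(a <- va) a.1 0 j * F a) <= norm_force * M.
Proof.
move=> M0 hF; apply: le_trans (le_normc_sum _ _) _.
apply: (@le_trans _ _ (\sum_(a <- va) normc (a.1 0 j) * M)).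
  rewrite big_seq [leRHS]big_seq; apply: ler_sum => a ain.
  by rewrite ComplexField.Normc.normcM ler_wpM2l ?normc_ge0 // hF // (allP vaJ).
rewrite -mulr_suml ler_wpM2r // /norm_force (bigD1 j) //= lerDl sumr_ge0 // => i _.
by apply: sumr_ge0 => a _; exact: normc_ge0.
Qed.

Lemma normc_phase l t : normc (phase l t) = 1.
Proof. exact: normc_expi. Qed.

Lemma hess_le v t j : `|hess v t 0 j| <= norm_force * (J%:R * abs_sum v).
Proof.
rewrite mxE; apply: le_trans (le_Re_normc _) _; rewrite /hessc.
under eq_bigr do rewrite -mulrA.
apply: le_norm_force => [|a aJ]; first by rewrite mulr_ge0 // abs_sum_ge0.
by rewrite !ComplexField.Normc.normcM normc_phase normci !mul1r normc_real dot_abs_sum.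
Qed.

(** First order Taylor expansion of grad V at the truncated solution, with the
    Hessian taken at the unperturbed embedding: replacing the base point costs
    the term |e| |v|. *)
Lemma Vp_expand N : exists2 C0 : R, 0 <= C0 & forall e t v j, `|e| <= 1 ->
  `|Vp (embed t + psum g N e t + v) 0 j - Vp (embed t + psum g N e t) 0 j - hess v t 0 j|
   <= C0 * (abs_sum v ^+ 2 + `|e| * abs_sum v).
Proof.
have [b b0 hb] := order_bounds.
have s0 k : 0 <= stretch b k by case: k => [|k] //=; rewrite mulr_ge0.
pose Y := \sum_(k < N.+1) stretch b k.
have Y0 : 0 <= Y by exact: sumr_ge0.
exists (norm_force * (J%:R ^+ 2 + 2 * Y * J%:R)).
  by rewrite mulr_ge0 ?norm_force_ge0 // addr_ge0 ?exprn_ge0 ?mulr_ge0.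
move=> e t v j e1; have v0 := abs_sum_ge0 v.
have yle (l : 'rV[int]_D) : (l1norm l <= J)%N -> `|ysum l N e t| <= `|e| * Y.
  move=> lJ; rewrite -normc_real -[normc _]mul1r -normci -ComplexField.Normc.normcM ysumE.
  apply: le_trans (le_normc_sum _ _) _; rewrite mulr_sumr; apply: ler_sum => -[[|k] kN] _.
    by rewrite mulr0 ComplexField.Normc.normc0 mulr_ge0.
  rewrite ComplexField.Normc.normcM normcX normc_real.
  apply: ler_pM; rewrite ?normc_ge0 ?exprn_ge0 //.
    by rewrite exprS ler_piMr // exprn_ile1.
  by apply: (tp_normc kap0 t (tp_incr lJ b0 (fun k _ => hb k) _)); exact: (leqnn k.+1).
have ReB (x y : C) : complex.Re (x - y) = complex.Re x - complex.Re y.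
  by case: x y => [? ?] [? ?].
have -> : Vp (embed t + psum g N e t + v) 0 j - Vp (embed t + psum g N e t) 0 j - hess v t 0 j =
  complex.Re (\sum_(a <- va) a.1 0 j * (phase a.2 t *
    (expi (ysum a.2 N e t + dot (intv R a.2) v) - expi (ysum a.2 N e t)
      - 'i%C * (dot (intv R a.2) v)%:C%C))).
  rewrite -[LHS]/(complex.Re ((Vp (embed t + psum g N e t + v) 0 j)%:C%C : C) -
     complex.Re ((Vp (embed t + psum g N e t) 0 j)%:C%C : C) - _).
  rewrite Vp_psum VpE mxE -!ReB /hessc -!sumrB; congr complex.Re; apply: eq_bigr => a _.
  have -> : expi (dot (intv R a.2) (embed t + psum g N e t + v)) =
      phase a.2 t * expi (ysum a.2 N e t + dot (intv R a.2) v).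
    rewrite /phase -expiD; congr expi; rewrite /ysum !dotDr dotNr; ring.
  by ring.
apply: le_trans (le_Re_normc _) _.
rewrite -mulrA; apply: le_norm_force => [|a aJ].
  by rewrite mulr_ge0 ?addr_ge0 ?exprn_ge0 ?mulr_ge0.
rewrite ComplexField.Normc.normcM normc_phase mul1r.
have zle := dot_abs_sum v aJ; have {}yle := yle _ aJ.
set y := ysum _ _ _ _ in yle *; set z := dot _ _ in zle *.
have t1 : normc (expi y - 1) <= 2 * `|y|.
  have := expi_taylor 1 y; rewrite /expi_sum big_ord1 fact0 invr1 expr0 mulr1.
  by rewrite /powfact expr1 (_ : 1`! = 1)%N // divr1.
have t2 : normc (expi z - 1 - 'i%C * z%:C%C) <= `|z| ^+ 2.
  have := expi_taylor 2 z; rewrite /expi_sum !big_ord_recr big_ord0 /= add0r fact0 invr1.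
  rewrite expr0 mulr1 expr1 mul1r opprD addrA /powfact (_ : 2`! = 2)%N //.
  by rewrite (_ : 2 * (`|z| ^+ 2 / 2) = `|z| ^+ 2); last by field.
rewrite (_ : _ - _ - _ = expi y * (expi z - 1 - 'i%C * z%:C%C) + (expi y - 1) * ('i%C * z%:C%C)); last first.
  by rewrite expiD; ring.
apply: le_trans (le_normcD _ _) _.
rewrite !ComplexField.Normc.normcM normc_expi mul1r normci mul1r normc_real.
have e0 := normr_ge0 e; have z0 := normr_ge0 z; have y0 := normr_ge0 y.
have J0 : 0 <= J%:R :> R by [].
have h1 : `|z| ^+ 2 <= J%:R ^+ 2 * abs_sum v ^+ 2.
  by rewrite -exprMn lerXn2r ?nnegrE // mulr_ge0.
have h2 : normc (expi y - 1) * `|z| <= 2 * Y * J%:R * (`|e| * abs_sum v).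
  rewrite (_ : 2 * Y * J%:R * _ = (2 * (`|e| * Y)) * (J%:R * abs_sum v)); last by ring.
  apply: ler_pM; rewrite ?normc_ge0 //; apply: le_trans t1 _; by rewrite ler_wpM2l.
apply: le_trans (lerD t2 h2) _.
apply: le_trans (lerD h1 (lexx _)) _.
have p1 : 0 <= J%:R ^+ 2 * (`|e| * abs_sum v) by rewrite mulr_ge0 ?exprn_ge0 ?mulr_ge0.
have p2 : 0 <= 2 * Y * J%:R * abs_sum v ^+ 2 by rewrite !mulr_ge0 ?exprn_ge0.
lra.
Qed.

(** If E e = e^n f + O(e^(n+1)) uniformly and a Fourier coefficient of E e is
    O(e^(n+1)), then this coefficient of f is 0; it is enough to look at one
    small e. *)
Lemma leading_zero n (f : 'rV[R]_L -> R) (E : R -> 'rV[R]_L -> R) l (C1 C2 : R) :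
  continuous f -> (forall e, continuous (E e)) ->
  (\forall e \near (0 : R), normc (cfourier (fun t => (E e t)%:C%C) l) <= C1 * `|e| ^+ n.+1) ->
  (forall e, `|e| <= 1 -> forall t, torus_box t -> `|E e t - e ^+ n * f t| <= C2 * `|e| ^+ n.+1) ->
  cfourier (fun t => (f t)%:C%C) l = 0.
Proof.
move=> cf cE /nbhs_ballP [d /= d0 hd] hb.
set z := cfourier _ _; apply/eqP; rewrite -normc_eq0; apply: contraTT isT => z0.
have {z0}z0 : 0 < normc z by rewrite lt_neqAle eq_sym z0 normc_ge0.
pose K1 := `|C1| + 2 * `|C2| + 1.
have K0 : 0 < K1 by rewrite ltr_wpDl // addr_ge0 // mulr_ge0.
(* small enough for the hypotheses and for K1 e <= |z| / 2 *)
pose e := Num.min (Num.min (d / 2) 1) (normc z / (2 * K1)).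
have e0 : 0 < e by rewrite !lt_min ltr01 !divr_gt0 // mulr_gt0.
have e1 : e <= 1 by rewrite !ge_min lexx orbT.
have ed : e < d.
  apply: (@le_lt_trans _ _ (d / 2)); first by rewrite !ge_min lexx.
  by rewrite ltr_pdivrMr // ltr_pMr // ltr1n.
have ez : e <= normc z / (2 * K1) by rewrite ge_min lexx orbT.
have ee : `|e| = e by rewrite ger0_norm // ltW.
have h1 : normc (cfourier (fun t => (E e t)%:C%C) l) <= C1 * e ^+ n.+1.
  by rewrite -{2}ee; apply: hd; rewrite /ball /= sub0r normrN ee.
have h2 : normc (cfourier (fun t => (E e t - e ^+ n * f t)%:C%C) l) <= 2 * (C2 * e ^+ n.+1).
  apply: cfourier_norm.
    apply: ccont_real; apply: continuous_fctB => //.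
    by apply: continuous_fctM => //; exact: continuous_fct_cst.
  by move=> t ht; rewrite normc_real; have := hb e; rewrite ee => /(_ e1 t ht).
have h3 : normc ((e ^+ n)%:C%C * z) <= (C1 + 2 * C2) * e ^+ n.+1.
  have -> : (e ^+ n)%:C%C * z = cfourier (fun t => (E e t)%:C%C) l +
     (-1) * cfourier (fun t => (E e t - e ^+ n * f t)%:C%C) l.
    have cc (q : 'rV[R]_L -> R) : continuous q -> ccont (fun t => (q t)%:C%C) by exact: ccont_real.
    have cef : continuous (fun t => E e t - e ^+ n * f t).
      apply: continuous_fctB => //.
      by apply: continuous_fctM => //; exact: continuous_fct_cst.
    rewrite -!cfourierZ; do ?exact: cc.
    rewrite -cfourierD; [|exact: cc|exact: ccontZ (cc _ cef)].
    congr (cfourier _ l); apply/funext => t.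
    by rewrite -rmorphM; apply: complexP; rewrite ?ReD ?ImD ?ReM ?ImM /=; ring.
  apply: le_trans (le_normcD _ _) _.
  rewrite mulN1r normcN.
  by rewrite mulrDl lerD // -mulrA.
move: h3; rewrite ComplexField.Normc.normcM normc_real ger0_norm ?exprn_ge0 ?(ltW e0) //.
rewrite exprSr mulrA [_ * e ^+ n]mulrC -mulrA ler_pM2l ?exprn_gt0 // => h3.
have : normc z <= K1 * e.
  apply: le_trans h3 _; rewrite ler_wpM2r ?(ltW e0) // /K1.
  by have := ler_norm C1; have := ler_norm C2; lra.
move: ez; rewrite ler_pdivlMr ?mulr_gt0 // => ez h4.
have : normc z <= normc z / 2 by lra.
by rewrite ler_pdivlMr // ger_pMr // leNgt ltr1n.
Qed.

Definition vcontinuous (f : 'rV[R]_L -> 'rV[R]_D) := forall j, continuous (fun t => f t 0 j).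

Lemma Vp_continuous U : vcontinuous U -> vcontinuous (fun t => Vp (U t)).
Proof.
move=> cU j.
have -> : (fun t => Vp (U t) 0 j) = (fun t => complex.Re
    (\sum_(a <- va) a.1 0 j * expi (dot (intv R a.2) (U t)))).
  by apply/funext => t; rewrite -VpE.
suff [] : ccont (fun t => \sum_(a <- va) a.1 0 j * expi (dot (intv R a.2) (U t))) by [].
apply: ccont_sum => a; apply: ccontZ.
apply: (@ccont_o R _ _ (fun t => dot (intv R a.2) (U t)) (@expi R)); last exact: ccont_expi.
rewrite /dot; apply: continuous_fct_sum => i.
by apply: continuous_fctM; [exact: continuous_fct_cst|exact: cU].
Qed.

Lemma embed_continuous : vcontinuous embed.
Proof.
move=> j; under eq_fun do rewrite mxE; apply: continuous_fct_sum => i.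
by apply: continuous_fctM; [exact: coord_continuous|exact: continuous_fct_cst].
Qed.

Lemma resid_continuous e U m : vcontinuous U -> vcontinuous (resid e U m).
Proof.
move=> cU j.
have cs w : continuous (fun t : 'rV[R]_L => U (t + w) 0 j).
  exact: (continuous_o (@continuous_shift _ _ w) (cU j)).
have cV : vcontinuous (fun t => Vp (embed t + U t)).
  apply: Vp_continuous => i; under eq_fun do rewrite mxE.
  by apply: continuous_fctD; [exact: embed_continuous|exact: cU].
have -> : (fun t => resid e U m t 0 j) = (fun t => (U (t + omega) 0 j + U (t - omega) 0 j +
   (-2) * U t 0 j + (- e) * Vp (embed t + U t) 0 j) - m 0 j +
   (gamma * e ^+ 3) * (U t 0 j - U (t - omega) 0 j + embed omega 0 j)).
  by apply/funext => t; rewrite /resid !mxE; ring.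
have cc (c : R) := @continuous_fct_cst 'rV[R]_L R c.
apply: continuous_fctD.
  apply: continuous_fctB => //; apply: continuous_fctD.
    by apply: continuous_fctD; [exact: continuous_fctD|exact: continuous_fctM (cc _) (cU j)].
  exact: continuous_fctM (cc _) (cV j).
apply: continuous_fctM => //; apply: continuous_fctD => //.
exact: continuous_fctB.
Qed.

Lemma psum_continuous u N e : (forall n, vcontinuous (u n)) -> vcontinuous (psum u N e).
Proof.
move=> cu j; under eq_fun do rewrite summxE; apply: continuous_fct_sum => n.
under eq_fun do rewrite mxE.
by apply: continuous_fctM; [exact: continuous_fct_cst|exact: cu].
Qed.

Lemma g_continuous n : vcontinuous (g n).
Proof. by move=> j; have [b _ hb] := order_bounds; have [+ _] := vtp_cont (hb n) j. Qed.

Lemma g_periodic n : torus_periodic (g n).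
Proof.
move=> i t; have [b _ hb] := order_bounds; apply/rowP => j.
exact: (complexI (vtp_periodic j (hb n) i t)).
Qed.

Lemma resid_diff e U W m1 m2 t : resid e (fun t => U t + W t) (m1 + m2) t - resid e U m1 t =
  W (t + omega) + W (t - omega) - 2 *: W t - m2
  - e *: (Vp (embed t + U t + W t) - Vp (embed t + U t))
  + (gamma * e ^+ 3) *: (W t - W (t - omega)).
Proof.
rewrite /resid [embed t + (U t + _)]addrA; move: (Vp (embed t + U t + W t)) (Vp _) => V1 V2.
by apply/rowP => j; rewrite !mxE; ring.
Qed.

Lemma hessD v w t : hess (v + w) t = hess v t + hess w t.
Proof.
apply/rowP => j; rewrite !mxE -ReD; congr complex.Re.
rewrite /hessc -big_split; apply: eq_bigr => x _ /=.
by rewrite dotDr rmorphD; ring.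
Qed.

Lemma vcontinuous_vcont f : vcontinuous f -> vcont f.
Proof. by move=> cf j; exact: ccont_real. Qed.

Lemma vcontinuousD f f' : vcontinuous f -> vcontinuous f' ->
  vcontinuous (fun t => f t + f' t).
Proof. by move=> c c' j; under eq_fun do rewrite mxE; exact: continuous_fctD. Qed.

Lemma vcontinuousZ a f : vcontinuous f -> vcontinuous (fun t => a *: f t).
Proof.
by move=> c j; under eq_fun do rewrite mxE; apply: continuous_fctM => //; exact: continuous_fct_cst.
Qed.

Lemma vcontinuous_shift f w : vcontinuous f -> vcontinuous (fun t => f (t + w)).
Proof. by move=> c j; exact: (continuous_o (@continuous_shift _ _ w) (c j)). Qed.

Lemma vcontinuous_cst c : vcontinuous (fun _ => c).
Proof. by move=> j; exact: continuous_fct_cst. Qed.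

Definition sdiff (f : 'rV[R]_L -> 'rV[R]_D) t := f (t + omega) + f (t - omega) - 2 *: f t.

Lemma sdiff_continuous f : vcontinuous f -> vcontinuous (sdiff f).
Proof.
move=> cd; rewrite /sdiff; under eq_fun do rewrite -scaleNr.
apply: vcontinuousD; last exact: vcontinuousZ.
by apply: vcontinuousD; exact: vcontinuous_shift.
Qed.

Lemma periodic_coord (f : 'rV[R]_L -> 'rV[R]_D) j : torus_periodic f -> torus_periodic (fun t => (f t 0 j)%:C%C : C).
Proof. by move=> pf i x; rewrite pf. Qed.

Lemma cfourier_vsdiff f v j l : vcontinuous f -> torus_periodic f ->
  cfourier (fun t => ((sdiff f t - v) 0 j)%:C%C) l =
  (divisor omega l)%:C%C * cfourier (fun t => (f t 0 j)%:C%C) l - (l == 0)%:R * (v 0 j)%:C%C.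
Proof.
move=> cf pf; have pj := periodic_coord j pf.
rewrite -cfourier_sdiff //; last exact: ccont_real.
have c1 : ccont (fun t : 'rV[R]_L => (f (t + omega) 0 j)%:C%C + (f (t - omega) 0 j)%:C%C - 2 * (f t 0 j)%:C%C).
  have := vcontinuous_vcont (sdiff_continuous cf) j; congr ccont.
  by apply/funext => t; rewrite /sdiff !mxE rmorphB rmorphD rmorphM /= rmorph_nat.
rewrite -mulrN -cfourier_cst -cfourierD //; last exact: ccont_cst.
congr (cfourier _ l); apply/funext => t.
by rewrite /sdiff !mxE rmorphB rmorphB rmorphD rmorphM /= rmorph_nat.
Qed.

(** A second difference is constant only if it vanishes, and then the function
    itself is constant: the divisors at nonzero frequencies are nonzero. *)
Lemma sdiff_cst f v : vcontinuous f -> torus_periodic f ->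
  (forall j l, cfourier (fun t => ((sdiff f t - v) 0 j)%:C%C) l = 0) ->
  v = 0 /\ forall t, f t = mean f.
Proof.
move=> cf pf f0; split.
  apply/rowP => j; rewrite mxE; apply: (@complexI R).
  have := f0 j 0; rewrite cfourier_vsdiff // eqxx mul1r.
  rewrite (_ : divisor omega 0 = 0) ?mul0r ?sub0r; first by move/eqP; rewrite oppr_eq0 => /eqP.
  by rewrite /divisor intv0 dot0l cos0; ring.
move=> t; apply/rowP => j; apply: (@complexI R); rewrite meanE; last exact: vcontinuous_vcont.
apply: (@cfourier_inj R L (fun t => (f t 0 j)%:C%C) (fun _ => cmean f j)) => //; first exact: ccont_real.
- exact: ccont_cst.
- exact: periodic_coord.
move=> l; rewrite cfourier_cst; case: eqVneq => [->|l0]; first by rewrite mul1r.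
have := f0 j l; rewrite cfourier_vsdiff // (negPf l0) !mul0r subr0 => /eqP.
by rewrite mulf_eq0 eq_complex /= eqxx andbT (negPf (div0 l0)) => /eqP.
Qed.

Lemma mean_sdiff f : vcontinuous f -> torus_periodic f -> mean (sdiff f) = 0.
Proof.
move=> cf pf; have cv := vcontinuous_vcont cf.
have ps j := periodic_coord j pf.
rewrite /sdiff; under eq_fun do rewrite -scaleNr.
have cs w : vcont (fun t => f (t + w)) by exact: vcont_shift.
rewrite meanD; [|exact: vcontD (cs _) (cs _)|exact: vcontZ].
rewrite meanD; [|exact: cs|exact: cs].
rewrite meanZ // !mean_shift // scaleNr -[2]/(1 + 1) scalerDl scale1r.
exact: subrr.
Qed.

Lemma hess_continuous v : vcontinuous (hess v).
Proof. by have [M hM] := vtp_hess v; move=> j; have [] := vtp_cont hM j. Qed.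

Section Uniqueness.
Variables (u : nat -> 'rV[R]_L -> 'rV[R]_D) (m : nat -> 'rV[R]_D).
Hypothesis uc : forall n, vcontinuous (u n).
Hypothesis up : forall n, torus_periodic (u n).
Hypothesis ures : forall N, exists C1 : R, \forall e \near (0 : R), forall j l,
  normc (cfourier (fun t => (resid e (psum u N e) (pmu m N e) t 0 j)%:C%C) l) <= C1 * `|e| ^+ N.+1.
Hypothesis umean : forall n, exists2 a, mean (u n) = a *: kp & (n = 0%N -> a = beta).
Hypothesis um : forall n, dot (m n) kp = 0.

Let E N e t := resid e (psum u N e) (pmu m N e) t - resid e (psum g N e) (pmu mu N e) t.

Let E_fourier N j l : exists C1 : R, \forall e \near (0 : R),
  normc (cfourier (fun t => (E N e t 0 j)%:C%C) l) <= C1 * `|e| ^+ N.+1.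
Proof.
have [C1 h1] := ures N; have [C2 C20 h2] := resid_bound N.
exists (C1 + C2); near=> e.
have e1 : `|e| <= 1 by near: e; apply/nbhs_ballP; exists 1 => //= x; rewrite /ball /= sub0r normrN => /ltW.
have c1 : continuous (fun t => resid e (psum u N e) (pmu m N e) t 0 j).
  by apply: resid_continuous; exact: psum_continuous.
have c2 : continuous (fun t => resid e (psum g N e) (pmu mu N e) t 0 j).
  by apply: resid_continuous; apply: psum_continuous; exact: g_continuous.
have -> : (fun t => (E N e t 0 j)%:C%C : C) = (fun t =>
   (resid e (psum u N e) (pmu m N e) t 0 j)%:C%C + (-1) * (resid e (psum g N e) (pmu mu N e) t 0 j)%:C%C).
  by apply/funext => t; rewrite /E mxE [X in _ + X]mxE mulN1r -rmorphB.
rewrite cfourierD ?cfourierZ; do ?[exact: ccont_real|exact: ccontZ (ccont_real c2)].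
apply: le_trans (le_normcD _ _) _; rewrite mulrDl; apply: lerD.
  by move: j l {c1 c2}; near: e.
rewrite mulN1r normcN.
exact: wien_coef (h2 e e1 j).
Unshelve. all: by end_near. Qed.

Let E_continuous N j e : continuous (fun t => E N e t 0 j).
Proof.
rewrite /E; under eq_fun do rewrite mxE [X in _ + X]mxE.
by apply: continuous_fctB; apply: resid_continuous; apply: psum_continuous => //; exact: g_continuous.
Qed.

Let vbound (d : 'rV[R]_L -> 'rV[R]_D) : vcontinuous d ->
  exists2 M : R, 0 <= M & forall t, torus_box t -> abs_sum (d t) <= M.
Proof.
move=> cd; have c : continuous (fun t => abs_sum (d t)).
  apply: continuous_fct_sum => i; exact: (continuous_o (cd i) (@norm_continuous R R)).
have [M M0 hM] := continuous_box_bounded c; exists M => // t /hM.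
by apply: le_trans; exact: ler_norm.
Qed.

Let le_abs_sum (v : 'rV[R]_D) j : `|v 0 j| <= abs_sum v.
Proof. by rewrite /abs_sum (bigD1 j) //= lerDl sumr_ge0. Qed.

(** The two solutions differ by e^(N-1) c + e^N d, with c constant. A constant has
    zero second difference, so c first acts at order N, through the Hessian.
    For c <> 0 the quadratic error e e^(2N-2) is of order N + 1 only if N > 1. *)
Let leading_fourier N c d v : c = 0 \/ (1 < N)%N -> vcontinuous d ->
  (forall e t, psum u N e t = psum g N e t + (e ^+ N.-1 *: c + e ^+ N *: d t)) ->
  (forall e, pmu m N e = pmu mu N e + e ^+ N *: v) ->
  forall j l, cfourier (fun t => ((sdiff d t - v - hess c t) 0 j)%:C%C) l = 0.
Proof.
move=> cN cd hu hm j l.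
have [C1 hC1] := E_fourier N j l.
have [C0 C00 hC0] := Vp_expand N.
have [Q Q0 hQ] := vbound cd.
have [Q' Q'0 hQ'] := vbound (@vcontinuous_shift _ (- omega) cd).
pose q := abs_sum c + Q.
pose C2 := C0 * (q ^+ 2 + q) + norm_force * (J%:R * Q) + `|gamma| * (Q + Q').
apply: (leading_zero (n := N) (E := fun e t => E N e t 0 j) (C1 := C1) (C2 := C2)) => //.
  under eq_fun do rewrite mxE [X in _ + X]mxE [X in X - _]mxE [X in _ + X - _]mxE.
  apply: continuous_fctB; last exact: hess_continuous.
  by apply: continuous_fctB; [exact: sdiff_continuous|exact: continuous_fct_cst].
move=> e e1 t ht.
have vdt := hQ t ht; have vdt' := hQ' t ht.
pose W t := e ^+ N.-1 *: c + e ^+ N *: d t.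
set x := `|e| in e1 *; have x0 : 0 <= x by exact: normr_ge0.
have q0 : 0 <= q by rewrite addr_ge0 // abs_sum_ge0.
have vW : abs_sum (W t) <= x ^+ N.-1 * abs_sum c + x ^+ N * Q.
  apply: le_trans (abs_sumD _ _) _; rewrite !abs_sumZ !normrX -/x lerD2l.
  by rewrite ler_wpM2l ?exprn_ge0.
have xN k : 0 <= x ^+ k by exact: exprn_ge0.
have [i1 i2] : x * abs_sum (W t) <= x ^+ N * q /\ x * abs_sum (W t) ^+ 2 <= x ^+ N.+1 * q ^+ 2.
  case: cN => [c0|N1].
    have {}vW : abs_sum (W t) <= x ^+ N * q.
      by move: vW; rewrite /q c0 (_ : abs_sum 0 = 0) ?mulr0 ?add0r // /abs_sum big1 // => i; rewrite mxE normr0.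
    split.
      by apply: le_trans (ler_wpM2l x0 vW) _; rewrite ler_piMl // mulr_ge0.
    rewrite [x ^+ N.+1]exprS -mulrA ler_wpM2l //.
    apply: (@le_trans _ _ ((x ^+ N * q) ^+ 2)).
      by rewrite lerXn2r ?nnegrE ?abs_sum_ge0 // mulr_ge0.
    by rewrite exprMn ler_wpM2r ?exprn_ge0 // expr2 ler_piMl // exprn_ile1.
  have {}vW : abs_sum (W t) <= x ^+ N.-1 * q.
    apply: le_trans vW _; rewrite /q mulrDr lerD2l ler_wpM2r //.
    by rewrite ler_wiXn2l // leq_pred.
  have xE : x ^+ N = x * x ^+ N.-1 by rewrite -exprS prednK // ltnW.
  split; first by rewrite xE -mulrA ler_wpM2l.
  rewrite [x ^+ N.+1]exprS -mulrA ler_wpM2l //.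
  apply: (@le_trans _ _ ((x ^+ N.-1 * q) ^+ 2)).
    by rewrite lerXn2r ?nnegrE ?abs_sum_ge0 // mulr_ge0.
  rewrite exprMn ler_wpM2r ?exprn_ge0 // -exprM ler_wiXn2l //.
  by clear -N1; lia.
have eW : e *: hess (W t) t = e ^+ N *: hess c t + (e * e ^+ N) *: hess (d t) t.
  rewrite /W hessD !hessZ scalerDr !scalerA; congr (_ + _).
  case: cN => [->|N1]; first by rewrite -[0](scale0r (0 : 'rV[R]_D)) hessZ scale0r !scaler0.
  by rewrite -exprS prednK // ltnW.
have EE : E N e t = e ^+ N *: sdiff d t - e ^+ N *: v
  - e *: (Vp (embed t + psum g N e t + W t) - Vp (embed t + psum g N e t))
  + (gamma * e ^+ 3) *: (e ^+ N *: (d t - d (t - omega))).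
  rewrite /E (_ : psum u N e = (fun t => psum g N e t + W t)); last by apply/funext => s; rewrite hu.
  rewrite hm resid_diff; move: (Vp _ - Vp _) => Z; rewrite /W /sdiff.
  by apply/rowP => i; rewrite !mxE; ring.
have -> : E N e t 0 j - e ^+ N * (sdiff d t - v - hess c t) 0 j =
  - (e * (Vp (embed t + psum g N e t + W t) 0 j - Vp (embed t + psum g N e t) 0 j - hess (W t) t 0 j))
  - e * e ^+ N * hess (d t) t 0 j
  + gamma * e ^+ 3 * (e ^+ N * (d t 0 j - d (t - omega) 0 j)).
  have /rowP/(_ j) := eW; rewrite EE !mxE => h1.
  apply/eqP; rewrite -subr_eq0; apply/eqP.
  transitivity (e ^+ N * complex.Re (hessc c j t) + e * e ^+ N * complex.Re (hessc (d t) j t)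
    - e * complex.Re (hessc (W t) j t)); first by ring.
  by rewrite h1 subrr.
apply: le_trans (ler_normD _ _) _; apply: le_trans (lerD (ler_normB _ _) (lexx _)) _.
rewrite normrN !normrM !normrX -/x /C2.
have hV := hC0 e t (W t) j e1; rewrite -/x in hV.
have hH := hess_le (d t) t j.
have r1 : x * `|Vp (embed t + psum g N e t + W t) 0 j - Vp (embed t + psum g N e t) 0 j - hess (W t) t 0 j|
   <= C0 * (q ^+ 2 + q) * x ^+ N.+1.
  apply: le_trans (ler_wpM2l x0 hV) _.
  rewrite mulrCA -mulrA ler_wpM2l // mulrDr mulrDl [q ^+ 2 * _]mulrC lerD // exprS.
  by rewrite [leRHS]mulrC -mulrA ler_wpM2l.
have r2 : x * x ^+ N * `|hess (d t) t 0 j| <= norm_force * (J%:R * Q) * x ^+ N.+1.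
  rewrite -exprS mulrC ler_wpM2r //; apply: le_trans hH _.
  by rewrite ler_wpM2l ?norm_force_ge0 // ler_wpM2l.
have r3 : `|gamma| * x ^+ 3 * (x ^+ N * `|d t 0 j - d (t - omega) 0 j|) <= `|gamma| * (Q + Q') * x ^+ N.+1.
  rewrite (_ : _ * _ * (_ * _) = `|gamma| * (x ^+ (3 + N) * `|d t 0 j - d (t - omega) 0 j|)); last first.
    by rewrite exprD; ring.
  rewrite -mulrA ler_wpM2l //.
  have hd : `|d t 0 j - d (t - omega) 0 j| <= Q + Q'.
    apply: le_trans (ler_normB _ _) _; apply: lerD; apply: le_trans (le_abs_sum _ _) _ => //.
  rewrite [leRHS]mulrC; apply: ler_pM => //; rewrite ler_wiXn2l //.
  by rewrite addSn ltnS leq_addl.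
by rewrite 2![(_ + _) * x ^+ N.+1]mulrDl; apply: lerD r3; apply: lerD r1 r2.
Qed.

(** Order n leaves a constant difference a kp; it is excluded at order n + 1 by the
    Hessian or, for n = 0, by the prescribed value beta. *)
Theorem expansion_unique n : (forall t, u n t = g n t) /\ m n = mu n.
Proof.
elim/ltn_ind: n => n IH.
pose d k t := u k t - g k t; pose v k := m k - mu k.
have dE k : d k = (fun t => u k t + (-1) *: g k t).
  by apply/funext => t; rewrite scaleN1r.
have dc k : vcontinuous (d k).
  by rewrite dE; apply: vcontinuousD => //; apply: vcontinuousZ; exact: g_continuous.
have dp k : torus_periodic (d k) by move=> i t; rewrite /d up g_periodic.
have IHu e t : \sum_(k < n) e ^+ k *: u k t = \sum_(k < n) e ^+ k *: g k t.
  by apply: eq_bigr => k _; have [-> _] := IH k (ltn_ord k).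
have IHm e : \sum_(k < n) e ^+ k *: m k = \sum_(k < n) e ^+ k *: mu k.
  by apply: eq_bigr => k _; have [_ ->] := IH k (ltn_ord k).
have [v0 dm] : v n = 0 /\ forall t, d n t = mean (d n).
  apply: sdiff_cst => // j l.
  have := leading_fourier (N := n) (c := 0) (or_introl erefl) (dc n) _ _ j l.
  move=> /(_ (v n)) H; rewrite -[RHS]H.
  - congr (cfourier _ l); apply/funext => t.
    by rewrite -[X in hess X](scale0r (0 : 'rV[R]_D)) hessZ scale0r subr0.
  - move=> e t; rewrite scaler0 add0r /psum !big_ord_recr /= IHu -addrA -scalerDr /d.
    by rewrite [g n t + _]addrC subrK.
  - by move=> e; rewrite /pmu !big_ord_recr /= IHm -addrA -scalerDr /v [mu n + _]addrC subrK.
have [a ma aE] := umean n; have [_ _ [a' ma' aE'] _ _] := hok n.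
have da t : d n t = (a - a') *: kp.
  rewrite dm dE meanD ?meanZ ?ma.
  - by rewrite scaleN1r [X in _ - X]ma' scalerBl.
  - exact: vcontinuous_vcont (@g_continuous n).
  - exact: vcontinuous_vcont.
  - exact: vcontZ (vcontinuous_vcont (@g_continuous n)).
suff c0 : (a - a') *: kp = 0.
  split; last by apply/eqP; rewrite -subr_eq0; apply/eqP; exact: v0.
  by move=> t; apply/eqP; rewrite -subr_eq0; apply/eqP; rewrite -/(d n t) da.
case: (posnP n) => [n0|n0]; first by rewrite aE // aE' // subrr scale0r.
set c := _ *: kp in da *.
have F0 j : cfourier (fun t => ((sdiff (d n.+1) t - v n.+1 - hess c t) 0 j)%:C%C) 0 = 0.
  apply: (leading_fourier (N := n.+1) (c := c)) => //; first by right.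
  - move=> e t; rewrite /psum !big_ord_recr /= IHu.
    rewrite (_ : u n t = g n t + c); last by rewrite -(da t) /d addrC subrK.
    rewrite (_ : u n.+1 t = g n.+1 t + d n.+1 t); last by rewrite /d addrC subrK.
    rewrite !scalerDr -!addrA; congr (_ + (_ + _)).
    by rewrite addrCA.
  - move=> e; rewrite /pmu !big_ord_recr /= IHm.
    have /eqP := v0; rewrite subr_eq0 => /eqP ->.
    by rewrite -[RHS]addrA -scalerDr /v [mu n.+1 + _]addrC subrK.
have M0 : mean (fun t => sdiff (d n.+1) t - v n.+1 - hess c t) = 0.
  by apply/rowP => j; rewrite !mxE /cmean F0.
have cH := vcontinuous_vcont (@hess_continuous kp).
have cS := vcontinuous_vcont (sdiff_continuous (dc n.+1)).
have := congr1 (fun x => dot x kp) M0.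
rewrite (_ : (fun t => _) = (fun t => sdiff (d n.+1) t + (- v n.+1) + (- (a - a')) *: hess kp t)); last first.
  by apply/funext => t; rewrite /c hessZ scaleNr.
rewrite meanD; [|exact: vcontD cS (@vcont_cst _)|exact: vcontZ].
rewrite (meanD cS (@vcont_cst _)) mean_sdiff // mean_cst meanZ //.
rewrite add0r dotDl dotNl dotZl dot0l.
have -> : dot (v n.+1) kp = 0.
  have [_ _ _ hmu _] := hok n.+1.
  by rewrite /v dotDl dotNl um [X in _ - X]hmu subrr.
rewrite oppr0 add0r => /eqP; rewrite mulf_eq0 oppr_eq0.
case: nondeg => [kp0 _|/negPf ->]; first by rewrite /c kp0 scaler0.
by rewrite orbF => /eqP; rewrite /c => ->; rewrite scale0r.
Qed.

End Uniqueness.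

(** * Gevrey bounds on the expansion *)

Section Gevrey.
Variables (Cd : R) (s : nat).
Hypothesis Cd0 : 0 <= Cd.
Hypothesis hdiv : forall n (l : 'rV[int]_D), (0 < n)%N -> (l1norm l <= n * J)%N ->
  pull K l != 0 -> `|divisor omega (pull K l)|^-1 <= Cd * n%:R ^+ s.

(* S bounds the sources in units of the previous weight, and C1 / B the
   solutions of average zero; G measures the response of the average along kp,
   with G = 0 when kp = 0. A makes G times the quadratic part at most A / 2, and B
   then does the same for the terms of size C1 / B. *)
Let W : R := \sum_j `|embed omega 0 j|.
Let S : R := wnorm_force * expR 1 + `|gamma| * (2 + W).
Let wk : R := \sum_j `|kp 0 j|.
Let hh : R := dot (mean (hess kp)) kp.
Let G : R := `|hh|^-1 * (wk * wnorm_force) * wk.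
Let C1 : R := 4 * Cd * S.
Let A : R := (1 + 8 * J%:R + 128 * G * expR 1 * J%:R ^+ 2)^-1.
Let B : R := 4 + 2 * C1 * (1 + G * J%:R) / A.

Let MV0 : 0 <= wnorm_force.
Proof.
apply: sumr_ge0 => i _; apply: sumr_ge0 => a _.
by rewrite mulr_ge0 ?normc_ge0 ?wexp_ge0.
Qed.

Let W0 : 0 <= W. Proof. exact: sumr_ge0. Qed.
Let S0 : 0 <= S. Proof. by rewrite addr_ge0 ?mulr_ge0 ?expR_ge0 ?addr_ge0. Qed.
Let wk0 : 0 <= wk. Proof. exact: sumr_ge0. Qed.
Let G0 : 0 <= G. Proof. by rewrite !mulr_ge0 // invr_ge0. Qed.
Let C10 : 0 <= C1. Proof. by rewrite !mulr_ge0. Qed.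

Let Ainv : 0 <= 8 * J%:R + 128 * G * expR 1 * J%:R ^+ 2 :> R.
Proof. by rewrite addr_ge0 ?mulr_ge0 ?expR_ge0 ?exprn_ge0. Qed.

Let A0 : 0 < A. Proof. by rewrite invr_gt0 -addrA ltr_wpDr. Qed.

Let A_le1 : A <= 1. Proof. by rewrite /A invf_le1 -addrA ?lerDl // ltr_wpDr. Qed.

Let A_J : 8 * (J%:R * A) <= 1.
Proof.
rewrite mulrA ler_pdivrMr ?mul1r; last by rewrite -addrA ltr_wpDr.
have : 0 <= 128 * G * expR 1 * J%:R ^+ 2 by rewrite !mulr_ge0 ?expR_ge0 ?exprn_ge0.
lra.
Qed.

Let A_G : G * (64 * expR 1 * J%:R ^+ 2) * A <= 1 / 2.
Proof.
rewrite ler_pdivrMr; last by rewrite -addrA ltr_wpDr.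
have h8 : 0 <= 8 * J%:R :> R by rewrite mulr_ge0.
rewrite (_ : G * _ = 1 / 2 * (128 * G * expR 1 * J%:R ^+ 2)); last by field.
by rewrite ler_wpM2l //; lra.
Qed.

Let B4 : 4 <= B.
Proof.
rewrite lerDl divr_ge0 ?(ltW A0) //.
by apply: mulr_ge0; [exact: mulr_ge0|rewrite addr_ge0 // mulr_ge0].
Qed.

Let B1 : 1 <= B. Proof. by apply: le_trans B4; rewrite ler1n. Qed.
Let B0 : 0 < B. Proof. exact: lt_le_trans B1. Qed.

Let B_C1 : C1 / B * (1 + G * J%:R) <= A / 2.
Proof.
rewrite mulrAC ler_pdivrMr // /B [A / 2 * _]mulrDr.
rewrite (_ : A / 2 * (2 * _ * _ / _) = C1 * (1 + G * J%:R)); last first.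
  by field; rewrite gt_eqF.
by rewrite lerDr mulr_ge0 // ltW // divr_gt0.
Qed.

Local Notation w := (gevrey_weight s B).
Let w_ge0 n : 0 <= w n. Proof. exact: gevrey_weight_ge0. Qed.
Let w_ge1 n : 1 <= w n.
Proof. by have := gevrey_weight_le s B1 B4 (leq0n n); rewrite gevrey_weight0. Qed.

Let stretch_gevrey_weight (b : nat -> R) n :
  (forall k, 0 <= b k) -> (forall k, (0 < k <= n)%N -> b k <= A * w k) ->
  forall k, (k <= n)%N -> stretch b k <= J%:R * A * w k.
Proof.
move=> b0 hb [|k] kn /=; first by rewrite !mulr_ge0 // ltW.
by rewrite -mulrA ler_wpM2l // hb.
Qed.

Let stretch_ge0 (b : nat -> R) k : (forall k, 0 <= b k) -> 0 <= stretch b k.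
Proof. by move=> b0; case: k => [|k] //=; rewrite mulr_ge0. Qed.

Let JA0 : 0 <= J%:R * A. Proof. by rewrite mulr_ge0 // ltW. Qed.

(** For order 3 the dissipative term is the constant omega K, which is not small
    with A; this is why S contains W. *)
Let source_gevrey_weight n : (forall k, (0 < k < n.+1)%N -> vtp (k * J) (A * w k) (g k)) ->
  vtp (n.+1 * J) (S * w n) (source g n.+1).
Proof.
move=> IH.
have Aw0 k : 0 <= A * w k by rewrite mulr_ge0 // ltW.
have h1 : vtp (n.+1 * J) (wnorm_force * expR 1 * w n) (force g n).
  apply: vtp_le (leqnn _) _ (vtp_force (b := fun k => A * w k) Aw0 IH).
  rewrite -mulrA ler_wpM2l //.
  apply: (@ecoef_gevrey_weight _ s B B1 _ (J%:R * A)) => //; first by move=> k; exact: stretch_ge0.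
  by move=> k kn; apply: (@stretch_gevrey_weight _ n).
have h2 : vtp (n.+1 * J) ((2 + W) * w n) (fun t => if n.+1 is n'.+3 then dissipation g n' t else 0).
  have z0 k : 0 <= (2 + W) * w k by rewrite mulr_ge0 // addr_ge0.
  case: n IH {h1} => [|[|[|n]]] IH; do ?by apply: vtp_cst => j; rewrite mxE normr0.
    have -> : dissipation g 0 = (fun _ => embed omega).
      by apply/funext => t; rewrite /dissipation !order0_cst subrr add0r.
    apply: vtp_le (leq0n _) _ (vtp_cst_sum 0 _).
    by rewrite -/W -[leLHS]mulr1 ler_pM // lerDr.
  have n13 : (n.+1 <= n.+3)%N by exact: leqW (leqnSn _).
  have gn1 := IH n.+1 n13.
  apply: vtp_le _ _ (vtp_dissipation gn1); first by rewrite leq_mul2r (leqW n13) orbT.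
  have wn : w n.+1 <= w n.+3 := gevrey_weight_le s B1 B4 n13.
  rewrite mulrDl; apply: lerD; last by rewrite ler_peMr.
  have aw : A * w n.+1 <= w n.+3 by apply: le_trans wn; rewrite ler_piMl.
  by rewrite [leRHS]mulr_natl [leRHS]mulr2n lerD.
have h3 := vtpD h1 (vtpZ (- gamma) h2).
move=> j; apply: tp_ext (tp_le (leqnn _) _ (h3 j)) => [t|].
  by rewrite /source scaleNr.
by rewrite normrN [X in _ + X]mulrA -mulrDl.
Qed.

Lemma mu_mean n : mu n = - mean (source g n).
Proof.
have [he _ _ _ _] := hok n.
have := mean_sdiff (@g_continuous n) (@g_periodic n).
rewrite (_ : sdiff (g n) = fun t => source g n t + mu n); last by apply/funext => t; rewrite -he.
have [b b0 hb] := order_bounds.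
have [M hM] : exists M, vtp (n * J) M (source g n).
  by apply: vtp_source => k _; exists (b k).
rewrite meanD ?mean_cst; [|exact: vtp_cont hM|exact: vcont_cst].
by move=> /eqP; rewrite addrC addr_eq0 => /eqP.
Qed.

Lemma mean_le d M f j : vtp d M f -> `|mean f 0 j| <= M.
Proof.
move=> hf; rewrite mxE; apply: le_trans (le_Re_normc _) _.
exact: (tp_cfourier kap0 0 (hf j)).
Qed.

(** By uniqueness up to constants, g_n is the bounded solution of average zero plus
    a multiple of kp. *)
Let split_gevrey_weight n : (forall k, (0 < k < n.+1)%N -> vtp (k * J) (A * w k) (g k)) ->
  exists gt a, vtp (n.+1 * J) (C1 / B * w n.+1) gt /\ forall t, g n.+1 t = gt t + a *: kp.
Proof.
move=> IH; have hs := source_gevrey_weight IH.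
have Cn0 : 0 <= Cd * n.+1%:R ^+ s by rewrite mulr_ge0 ?exprn_ge0.
have [gt [hgt gte gt0]] := solve_sdiff hs Cn0 (fun l => hdiv (ltn0Sn n)).
have cgt : vcontinuous gt by move=> j; have [] := vtp_cont hgt j.
have pgt : torus_periodic gt.
  by move=> i t; apply/rowP => j; exact: (complexI (vtp_periodic j hgt i t)).
have [_ _ [a ha _] _ _] := hok n.+1.
exists gt, a; split.
  apply: vtp_le (leqnn _) _ hgt; rewrite (_ : _ * (S * _) = Cd * S * (n.+1%:R ^+ s * w n)); last by ring.
  rewrite (_ : C1 / B * _ = Cd * S * (4 / B * w n.+1)); last by rewrite /C1; ring.
  by rewrite ler_wpM2l ?mulr_ge0 // gevrey_weight_step.
pose d t := g n.+1 t + (-1) *: gt t.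
have cd : vcontinuous d by apply: vcontinuousD; [exact: g_continuous|exact: vcontinuousZ].
have pd : torus_periodic d by move=> i t; rewrite /d pgt g_periodic.
have sd t : sdiff d t - 0 = 0.
  have [he _ _ _ _] := hok n.+1.
  rewrite subr0 (_ : sdiff d t = sdiff (g n.+1) t - sdiff gt t).
    rewrite /sdiff he gte -/(mu n.+1) mu_mean.
    by apply/eqP; rewrite subr_eq0.
  by rewrite /sdiff /d; apply/rowP => j; rewrite !mxE; ring.
have [_ dm] : (0 : 'rV[R]_D) = 0 /\ forall t, d t = mean d.
  apply: sdiff_cst => // j l; under eq_fun do rewrite sd mxE.
  by rewrite cfourier_cst mulr0.
move=> t; have := dm t.
rewrite {2}/d meanD; [|exact: vcontinuous_vcont (@g_continuous _)|exact: vcontZ (vcontinuous_vcont cgt)].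
rewrite meanZ; last exact: vcontinuous_vcont.
rewrite gt0 scaler0 addr0 [X in _ = X]ha /d scaleN1r => /eqP.
by rewrite subr_eq addrC => /eqP.
Qed.

(** Induction on n. The multiple a of kp is read off from the solvability of order
    n + 1: the Hessian times a equals minus the force built with the part of
    average zero, which consists of a quadratic part and a linear part of
    size C1 / B. *)
Let g_gevrey_weight n : (0 < n)%N -> vtp (n * J) (A * w n) (g n).
Proof.
elim/ltn_ind: n => -[//|n] IH _.
have {}IH k : (0 < k < n.+1)%N -> vtp (k * J) (A * w k) (g k).
  by move=> /andP[k0 kn]; exact: IH.
have [gt [a [hgt gE]]] := split_gevrey_weight IH.
(* b' omits the linear contribution of the part of average zero *)
pose b k := if k == n.+1 then C1 / B * w n.+1 else A * w k.
pose b' k := if k == n.+1 then 0 else A * w k.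
have C1B0 : 0 <= C1 / B by rewrite divr_ge0 // ltW.
have Aw0 k : 0 <= A * w k by rewrite mulr_ge0 // ltW.
have b0 k : 0 <= b k by rewrite /b; case: eqP => _ //; rewrite mulr_ge0.
have b'0 k : 0 <= b' k by rewrite /b'; case: eqP.
have hb k : (0 < k <= n.+1)%N -> vtp (k * J) (b k) (upd g n.+1 gt k).
  rewrite /b /upd; case: eqVneq => [->//|kn] hk; apply: IH.
  by move: hk => /andP[k0 k1]; rewrite k0 ltn_neqAle kn.
have hF := vtp_force b0 hb.
pose E := (8 * (J%:R * A)) ^+ 2 * expR 1 + J%:R * (C1 / B).
have E0 : 0 <= E.
  apply: addr_ge0; last exact: mulr_ge0.
  by rewrite mulr_ge0 ?expR_ge0 // exprn_ge0 // mulr_ge0.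
have eE : ecoef (stretch b) n.+1 <= E * w n.+1.
  have : ecoef (stretch b) n.+1 - ecoef (stretch b') n.+1 = stretch b n.+1 - stretch b' n.+1.
    apply: ecoef_lin => // -[|k] kn //=; rewrite /b /b' !ltn_eqF //.
  rewrite /= /b /b' !eqxx mulr0 subr0 => /eqP; rewrite subr_eq => /eqP ->.
  rewrite /E mulrDl addrC -[J%:R * (C1 / B) * _]mulrA lerD2r.
  apply: (@ecoef_gevrey_weight_quadratic _ s B B1) => //.
  - by move=> k; exact: stretch_ge0.
  - apply: (@stretch_gevrey_weight b') => // k kn; rewrite /b'; case: eqP => //.
  - by rewrite /= /b' eqxx mulr0.
have hFE : vtp (n.+2 * J) (wnorm_force * (E * w n.+1)) (force (upd g n.+1 gt) n.+1).
  by apply: vtp_le (leqnn _) _ hF; rewrite ler_wpM2l.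
have ha : a * hh = - dot (mean (force (upd g n.+1 gt) n.+1)) kp.
  have [_ _ _ _] := hok n.+1.
  rewrite (_ : force _ n.+1 = fun t => force (upd g n.+1 gt) n.+1 t + a *: hess kp t); last first.
    apply/funext => t; rewrite -hessZ; apply: force_lin => // [k kn|t'].
      by rewrite /upd ltn_eqF.
    by rewrite /upd eqxx; exact: gE.
  have cH := vcontinuous_vcont (@hess_continuous kp).
  rewrite meanD ?meanZ //; [|exact: vtp_cont hF|exact: vcontZ].
  by rewrite dotDl dotZl => /eqP; rewrite addrC addr_eq0 => /eqP.
have hah : `|a * hh| <= wk * (wnorm_force * (E * w n.+1)).
  rewrite ha normrN; apply: le_trans (ler_norm_sum _ _ _) _.
  rewrite /wk mulr_suml; apply: ler_sum => i _; rewrite normrM mulrC.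
  by rewrite ler_wpM2l //; exact: mean_le hFE.
have akp j : `|(a *: kp) 0 j| <= G * E * w n.+1.
  case: nondeg => [kp0|hh0].
    rewrite kp0 scaler0 mxE normr0; exact: mulr_ge0 (mulr_ge0 G0 E0) (w_ge0 _).
  have a_le : `|a| <= `|hh|^-1 * (wk * (wnorm_force * (E * w n.+1))).
    by rewrite ler_pdivlMl ?normr_gt0 // -normrM mulrC.
  rewrite mxE normrM (_ : G * E * _ = `|hh|^-1 * (wk * (wnorm_force * (E * w n.+1))) * wk); last by rewrite /G; ring.
  by apply: ler_pM => //; rewrite /wk (bigD1 j) //= lerDl sumr_ge0.
move=> j; apply: tp_ext (tp_le (leqnn _) _ (vtpD hgt (vtp_cst _ akp) j)) => [t|].
  by rewrite gE.
rewrite -mulrDl ler_wpM2r //.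
have h1 := B_C1; have := A_G => h2.
have h3 : G * ((8 * (J%:R * A)) ^+ 2 * expR 1) <= A / 2.
  rewrite (_ : G * _ = A * (G * (64 * expR 1 * J%:R ^+ 2) * A)); last by ring.
  by rewrite ler_wpM2l ?(ltW A0) // -[2^-1]mul1r.
rewrite /E (_ : C1 / B + G * _ = C1 / B * (1 + G * J%:R) + G * ((8 * (J%:R * A)) ^+ 2 * expR 1)); last by ring.
by apply: le_trans (lerD h1 h3) _; rewrite -splitr.
Qed.

Theorem expansion_gevrey : exists A' B' : R, [/\ 0 < A', 0 < B' &
  forall n, vtp (n * J) (A' * B' ^+ n * n`!%:R ^+ s) (g n) /\
    forall j, `|mu n 0 j| <= A' * B' ^+ n * n`!%:R ^+ s].
Proof.
pose A' := A + S + \sum_j `|(beta *: kp) 0 j|.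
have b0 : 0 <= \sum_j `|(beta *: kp) 0 j| by exact: sumr_ge0.
have A'0 : 0 < A' by rewrite /A' -addrA; exact: ltr_wpDr (addr_ge0 S0 b0) A0.
exists A', B; split=> // n.
have nB0 : 0 <= B ^+ n * n`!%:R ^+ s by rewrite mulr_ge0 ?exprn_ge0 // ltW.
have le_w : w n <= B ^+ n * n`!%:R ^+ s.
  rewrite /gevrey_weight mulrC [B ^+ n * _]mulrC ler_piMl //; first by rewrite mulrC.
  by rewrite invf_le1 ?exprn_ege1 ?exprn_gt0 ?ler1n.
rewrite -[A' * _ * _]mulrA; case: n nB0 le_w => [|n] nB0 le_w.
  rewrite expr0 fact0 expr1n !mulr1; split.
    rewrite (_ : g 0 = fun _ => beta *: kp); last by apply/funext => t; exact: order0_cst.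
    by apply: vtp_le (leqnn _) _ (vtp_cst_sum 0 _); rewrite /A' lerDr addr_ge0 // ltW.
  move=> j; rewrite mu_mean (_ : source g 0 = fun _ => 0) ?mean_cst.
    by rewrite oppr0 mxE normr0 ltW.
  by apply/funext => t; rewrite /source scaler0 subr0.
split.
  apply: vtp_le (leqnn _) _ (g_gevrey_weight (ltn0Sn n)).
  apply: ler_pM => //; first exact: ltW.
  by rewrite /A' -addrA lerDl addr_ge0.
move=> j; rewrite mu_mean mxE normrN.
have hs := @source_gevrey_weight n (fun k kn => @g_gevrey_weight k (proj1 (andP kn))).
apply: le_trans (mean_le j hs) _; apply: ler_pM => //.
  by rewrite /A' addrAC lerDr addr_ge0 // ltW.
exact: le_trans (gevrey_weight_le s B1 B4 (leqnSn n)) le_w.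
Qed.

End Gevrey.

End Orders.

(** * Trigonometric sums in one variable *)

Section TrigSum.
Variables (R : realType) (I : Type).
Local Notation C := (complex R).
Implicit Types (r : seq I) (c : I -> C) (m s : I -> R).

Definition trig r c m s (t : R) : R :=
  complex.Re (\sum_(i <- r) c i * expi (t * m i + s i)).

Lemma trig_cons i r c m s t : trig (i :: r) c m s t =
  complex.Re (c i) * cos (t * m i + s i) - complex.Im (c i) * sin (t * m i + s i) + trig r c m s t.
Proof. by rewrite /trig big_cons ReD ReM. Qed.

Lemma is_derive_trig r c m s (t : R) :
  is_derive t 1 (trig r c m s) (trig r (fun i => c i * ('i%C * (m i)%:C%C)) m s t).
Proof.
elim: r => [|i r IH].
  rewrite (_ : trig [::] c m s = cst 0); last by apply/funext => x; rewrite /trig big_nil.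
  by rewrite /trig big_nil /=; exact: is_derive_cst.
have -> : trig (i :: r) c m s = (fun x => complex.Re (c i) * cos (x * m i + s i)
    - complex.Im (c i) * sin (x * m i + s i)) \+ trig r c m s.
  by apply/funext => x; rewrite trig_cons.
have d1 : is_derive t 1 (fun x : R => x * m i + s i) (m i).
  by apply: is_derive_eq; rewrite addr0 scaler0 add0r /GRing.scale /= mulr1.
have dc := @is_derive1_comp R cos (fun x => x * m i + s i) t _ _ (is_derive_cos _) d1.
have ds := @is_derive1_comp R sin (fun x => x * m i + s i) t _ _ (is_derive_sin _) d1.
have d2 := is_deriveB (is_deriveZ (complex.Re (c i)) dc) (is_deriveZ (complex.Im (c i)) ds).
apply: is_derive_eq (is_deriveD d2 IH) _.
rewrite trig_cons; congr (_ + _).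
by rewrite !ReM !ImM /GRing.scale /=; ring.
Qed.

Lemma continuous_trig r c m s : continuous (trig r c m s).
Proof.
move=> t; apply/differentiable_continuous/derivable1_diffP.
by have [] := is_derive_trig r c m s t.
Qed.

Lemma expi_per_int (x : R) (n : int) : expi (x + 2 * pi * n%:~R) = expi x.
Proof. by apply: (@periodic_int R _ (@expi R)); exact: expi_per. Qed.

(** Nonresonant terms have a periodic primitive; resonant ones are constant. *)
Lemma int_trig r c (m : I -> int) s :
  \int[@lebesgue_measure R]_(t in `[0, 2 * pi]) trig r c (fun i => (m i)%:~R) s t =
  2 * pi * complex.Re (\sum_(i <- r | m i == 0) c i * expi (s i)).
Proof.
pose mr i : R := (m i)%:~R; rewrite -/mr.
pose b i : C := if m i == 0 then 0 else c i / ('i%C * (mr i)%:C%C).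
pose z := complex.Re (\sum_(i <- r | m i == 0) c i * expi (s i)); rewrite -/z.
pose P : R -> R := trig r b mr s \+ (fun t : R => t * z).
have dP (t : R) : is_derive t 1 P (trig r c mr s t).
  have dz : is_derive t 1 (fun t : R => t * z) z.
    by apply: is_derive_eq; rewrite scaler0 add0r /GRing.scale /= mulr1.
  apply: is_derive_eq (is_deriveD (is_derive_trig r b mr s t) dz) _.
  rewrite /trig /z -ReD [X in _ + X]big_mkcond -big_split /=; congr complex.Re.
  apply: eq_bigr => i _; rewrite /b /mr; case: (eqVneq (m i) 0) => [->|mi0].
    by rewrite !mul0r add0r mulr0 add0r.
  rewrite addr0 divfK // mulf_eq0 fmorph_eq0 intr_eq0 (negPf mi0) orbF.
  by rewrite eq_complex /= eqxx oner_eq0.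
rewrite (int1_primitive (@continuous_trig r c mr s) dP) /P /= mul0r addr0.
have -> : trig r b mr s (2 * pi) = trig r b mr s 0.
  congr complex.Re; apply: eq_bigr => i _.
  by rewrite mul0r add0r addrC expi_per_int.
by rewrite addrAC subrr add0r.
Qed.

End TrigSum.

(** * The potential along lines *)

Section Gradient.
Variables (R : realType) (D : nat).
Local Notation C := (complex R).

Definition idot (l m : 'rV[int]_D) : int := \sum_j l 0 j * m 0 j.

Lemma idotE l m : (idot l m)%:~R = dot (intv R l) (intv R m).
Proof. by rewrite /idot /dot rmorph_sum; apply: eq_bigr => j _; rewrite rmorphM !mxE. Qed.

Definition dotc (v : 'rV[R]_D) (a : 'rV[C]_D) : C := \sum_j (v 0 j)%:C%C * a 0 j.

Lemma dotcD v w a : dotc (v + w) a = dotc v a + dotc w a.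
Proof. by rewrite /dotc -big_split; apply: eq_bigr => j _ /=; rewrite mxE rmorphD mulrDl. Qed.

Lemma dotcZ b v a : dotc (b *: v) a = b%:C%C * dotc v a.
Proof. by rewrite /dotc mulr_sumr; apply: eq_bigr => j _; rewrite mxE rmorphM mulrA. Qed.

(** The difference quotients at s *: v + x in direction v and those of the
    restriction to the line are the same functions. *)
Lemma is_derive_line (f : 'rV[R]_D -> R) x v (s : R) df :
  is_derive (s *: v + x) v f df <-> is_derive s 1 (fun s => f (s *: v + x)) df.
Proof.
have E : (fun h : R => h^-1 *: ((f \o shift (s *: v + x)) (h *: v) - f (s *: v + x))) =
    (fun h : R => h^-1 *: (((fun s => f (s *: v + x)) \o shift s) (h *: 1) - f (s *: v + x))).
  apply/funext => h; congr (_ *: (f _ - _)).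
  by rewrite /= addrA -scalerDl /GRing.scale /= mulr1.
split=> -[h1 h2]; split; rewrite /derivable /derive.
- by rewrite -E.
- by rewrite -E.
- by rewrite E.
- by rewrite E.
Qed.

Lemma periodic_intv (T : Type) (f : 'rV[R]_D -> T) (v : 'rV[int]_D) x :
  torus_periodic f -> f (x + (2 * pi) *: intv R v) = f x.
Proof.
move=> pf; have -> : intv R v = \sum_j (v 0 j)%:~R *: delta_mx 0 j.
  by rewrite [LHS]row_sum_delta; apply: eq_bigr => j _; rewrite mxE.
elim: (index_enum _) x => [|j r IH] x; first by rewrite big_nil scaler0 addr0.
rewrite big_cons scalerDr addrA IH scalerA.
have := @periodic_int R T (fun t => f (x + t *: delta_mx 0 j)) (v 0 j) 0.
rewrite add0r scale0r addr0; apply=> t.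
by rewrite scalerDl addrA pf.
Qed.

Variables (V : 'rV[R]_D -> R) (va : seq ('rV[C]_D * 'rV[int]_D)).
Hypothesis VE : forall x j, (grad V x 0 j)%:C%C =
  \sum_(a <- va) a.1 0 j * expi (dot (intv R a.2) x) :> C.

Lemma dot_grad v w x t : dot v (grad V (t *: w + x)) =
  trig va (fun a => dotc v a.1) (fun a => dot (intv R a.2) w) (fun a => dot (intv R a.2) x) t.
Proof.
rewrite /trig; transitivity (complex.Re (\sum_j (v 0 j)%:C%C * (grad V (t *: w + x) 0 j)%:C%C : C)).
  by rewrite Re_sum; apply: eq_bigr => j _; rewrite -rmorphM.
congr complex.Re; under eq_bigr do rewrite VE mulr_sumr.
rewrite exchange_big; apply: eq_bigr => a _ /=.
by rewrite /dotc mulr_suml; apply: eq_bigr => j _; rewrite mulrA dotDr dotZr.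
Qed.

Lemma hessianE x i j : hessian V x i j =
  complex.Re (\sum_(a <- va) a.1 0 i * ('i%C * (intv R a.2 0 j)%:C%C) * expi (dot (intv R a.2) x)).
Proof.
rewrite mxE; have hD : is_derive (0 : R) 1
    (fun s => grad V (s *: delta_mx 0 j + x) 0 i)
    (complex.Re (\sum_(a <- va) a.1 0 i * ('i%C * (intv R a.2 0 j)%:C%C) * expi (dot (intv R a.2) x))).
  have -> : (fun s => grad V (s *: delta_mx 0 j + x) 0 i) = trig va (fun a => a.1 0 i)
      (fun a => dot (intv R a.2) (delta_mx 0 j)) (fun a => dot (intv R a.2) x).
    apply/funext => s; rewrite -[LHS]/(complex.Re ((grad V (s *: delta_mx 0 j + x) 0 i)%:C%C : C)).
    by rewrite VE; congr complex.Re; apply: eq_bigr => a _; rewrite dotDr dotZr.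
  apply: is_derive_eq (is_derive_trig _ _ _ _ _) _; congr complex.Re; apply: eq_bigr => a _.
  by rewrite dot_delta mul0r add0r.
have [_ h] := (@is_derive_line (fun y => grad V y 0 i) x (delta_mx 0 j) 0 _).2 hD.
by rewrite -h scale0r add0r.
Qed.

Lemma hessian_form v x : (v *m hessian V x *m v^T) 0 0 =
  complex.Re (\sum_(a <- va) dotc v a.1 * ('i%C * (dot (intv R a.2) v)%:C%C) * expi (dot (intv R a.2) x)).
Proof.
transitivity (\sum_j \sum_i v 0 i * v 0 j * hessian V x i j).
  rewrite mxE; apply: eq_bigr => j _; rewrite mxE mxE mulr_suml.
  by apply: eq_bigr => i _; ring.
transitivity (complex.Re (\sum_j \sum_i (v 0 i * v 0 j)%:C%C *
   (\sum_(a <- va) a.1 0 i * ('i%C * (intv R a.2 0 j)%:C%C) * expi (dot (intv R a.2) x)) : C)).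
  rewrite Re_sum; apply: eq_bigr => j _; rewrite Re_sum; apply: eq_bigr => i _.
  by rewrite ReZr hessianE.
congr complex.Re.
under eq_bigr do under eq_bigr do rewrite mulr_sumr.
under eq_bigr do rewrite exchange_big /=.
rewrite exchange_big /=; apply: eq_bigr => a _.
rewrite /dotc /dot rmorph_sum mulr_sumr mulr_sumr mulr_suml; apply: eq_bigr => j _.
rewrite !mulr_suml; apply: eq_bigr => i _; rewrite !rmorphM; ring.
Qed.

Hypotheses (pV : torus_periodic V) (dV : forall x, differentiable V x).

Lemma derive_grad v x : is_derive x v V (dot v (grad V x)).
Proof.
split; first exact: diff_derivable.
rewrite deriveE // [v in 'd V x v]row_sum_delta linear_sum; apply: eq_bigr => j _.
by rewrite linearZ /= mxE deriveE.
Qed.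

(** Along an integer direction v the restriction of V is periodic, so the
    integral of its derivative over a period vanishes. Up to a factor
    2 pi this integral is the sum of the coefficients of v . grad V at the
    frequencies orthogonal to v. *)
Lemma grad_average (v : 'rV[int]_D) :
  complex.Re (\sum_(a <- va | idot a.2 v == 0) dotc (intv R v) a.1) = 0.
Proof.
have d (s : R) : is_derive s 1 (fun s => V (s *: intv R v + 0))
    (trig va (fun a => dotc (intv R v) a.1) (fun a => (idot a.2 v)%:~R) (fun=> 0) s).
  apply/(@is_derive_line V); apply: is_derive_eq (derive_grad _ _) _.
  rewrite dot_grad; congr complex.Re; apply: eq_bigr => a _.
  by rewrite idotE dot0r.
have := int1_primitive (@continuous_trig _ _ va _ _ _) d.
rewrite int_trig scale0r !addr0 -[(2 * pi) *: _]add0r periodic_intv // subrr => /eqP.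
rewrite mulf_eq0 gt_eqF ?period_gt0 //= => /eqP h.
by rewrite -[RHS]h; congr complex.Re; apply: eq_bigr => a _; rewrite expi0 mulr1.
Qed.

Variables (J : nat) (k q : 'rV[int]_D).
Hypothesis vaJ : all (fun a => l1norm a.2 <= J)%N va.
Hypothesis indep : forall l, idot l k = 0 -> idot l q = 0 -> l = 0.

Lemma idotDr l m n : idot l (m + n) = idot l m + idot l n.
Proof. by rewrite /idot -big_split; apply: eq_bigr => j _; rewrite mxE mulrDr. Qed.

Lemma idotZr l (c : int) m : idot l (c *: m) = c * idot l m.
Proof. by rewrite /idot mulr_sumr; apply: eq_bigr => j _; rewrite mxE mulrCA. Qed.

Lemma idot0l m : idot 0 m = 0.
Proof. by rewrite /idot big1 // => j _; rewrite mxE mul0r. Qed.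

(** The directions N q + k and N q - k, with N large, are orthogonal to no nonzero
    frequency of degree at most J. *)
Lemma nonresonant : exists N : nat, (0 < N)%N /\
  forall (l : 'rV[int]_D) (c : int), (l1norm l <= J)%N -> `|c| = 1 ->
    (idot l (N%:Z *: q + c *: k) == 0) = (l == 0).
Proof.
pose N := (Num.truncn (J%:R * abs_sum (intv R k))).+1.
have hN : J%:R * abs_sum (intv R k) < N%:R := truncnS_gt _.
exists N; split=> // l c lJ c1; apply/idP/idP => [|/eqP->]; last by rewrite idot0l.
rewrite idotDr !idotZr => /eqP h.
have lq : idot l q = 0.
  apply/eqP; apply: contraTT isT => lq.
  have : `|N%:Z * idot l q| = `|idot l k|.
    by move/eqP: h; rewrite addr_eq0 => /eqP ->; rewrite normrN normrM c1 mul1r.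
  move/(congr1 (intr : int -> R)); rewrite !intr_norm rmorphM !idotE normrM /= => h1.
  have := dot_abs_sum (intv R k) lJ; rewrite -h1 leNgt => /negP h2; case: h2.
  apply: lt_le_trans hN _; rewrite ger0_norm ?ler0n // ler_peMr //.
  by rewrite -intr_norm ler1z -gtz0_ge1 normr_gt0.
move: h; rewrite lq mulr0 add0r => h.
apply/eqP/indep => //; apply/eqP; move/eqP: h; rewrite mulf_eq0 => /predU1P[c0|//].
by move: c1; rewrite c0 normr0.
Qed.

(** Averages along N q + k and N q - k, added. *)
Lemma grad_average0 : complex.Re (\sum_(a <- va | a.2 == 0) dotc (intv R q) a.1) = 0.
Proof.
have [N [N0 hN]] := nonresonant.
have h (c : int) : `|c| = 1 -> complex.Re (\sum_(a <- va | a.2 == 0)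
     (N%:R%:C%C * dotc (intv R q) a.1 + c%:~R%:C%C * dotc (intv R k) a.1)) = 0.
  move=> c1; rewrite -[RHS](grad_average (N%:Z *: q + c *: k)); congr complex.Re.
  rewrite big_seq_cond [RHS]big_seq_cond; apply: eq_big => [a|a /andP[ain _]].
    by case: (boolP (a \in va)) => //= ain; rewrite hN // (allP vaJ).
  rewrite -!dotcZ -dotcD; congr dotc; apply/rowP => j.
  by rewrite !mxE rmorphD !rmorphM.
have := congr2 +%R (h 1 erefl) (h (-1) erefl).
rewrite -ReD -big_split addr0 /=.
rewrite (eq_bigr (fun a => (2 * N%:R)%:C%C * dotc (intv R q) a.1)); last first.
  by move=> a _; rewrite rmorphM rmorph_nat rmorphN rmorph1; ring.
rewrite -mulr_sumr ReZr => /eqP; rewrite mulf_eq0 mulf_eq0 !pnatr_eq0 /=.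
by rewrite gtn_eqF //= => /eqP.
Qed.

(** Integration over t keeps the frequencies orthogonal to k. Among these only the
    frequency 0 is also orthogonal to q, and its coefficient vanishes; the
    others have periodic primitives in beta. *)
Lemma beta_potential : exists Psi : R -> R,
  (forall b : R, is_derive b 1 Psi ((2 * pi)^-1 * \int[@lebesgue_measure R]_(t in `[0, 2 * pi])
      dot (intv R q) (grad V (t *: intv R k + b *: intv R q)))) /\
  forall b, Psi (b + 2 * pi) = Psi b.
Proof.
pose r := [seq a <- va | (idot a.2 k == 0) && (a.2 != 0)].
pose m (a : 'rV[C]_D * 'rV[int]_D) : R := (idot a.2 q)%:~R.
exists (trig r (fun a => dotc (intv R q) a.1 / ('i%C * (m a)%:C%C)) m (fun=> 0)); split=> b; last first.
  congr complex.Re; apply: eq_bigr => a _; congr (_ * _).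
  by rewrite !addr0 mulrDl expi_per_int.
apply: is_derive_eq (is_derive_trig _ _ _ _ _) _.
have -> : (fun t => dot (intv R q) (grad V (t *: intv R k + b *: intv R q))) =
    trig va (fun a => dotc (intv R q) a.1) (fun a => (idot a.2 k)%:~R)
      (fun a => dot (intv R a.2) (b *: intv R q)).
  apply/funext => t; rewrite dot_grad; congr complex.Re; apply: eq_bigr => a _.
  by rewrite idotE.
rewrite int_trig mulrA mulVf ?mul1r; last by rewrite gt_eqF ?period_gt0.
rewrite (bigID (fun a => a.2 == 0)) /= ReD.
rewrite (_ : complex.Re (\sum_(a <- va | (idot a.2 k == 0) && (a.2 == 0)) _) = 0); last first.
  rewrite -[RHS]grad_average0; congr complex.Re.
  apply: eq_big => [a|a /andP[_ /eqP ->]].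
    by case: (eqVneq a.2 0) => [->|]; rewrite ?idot0l ?eqxx ?andbF.
  by rewrite intv0 dot0l expi0 mulr1.
rewrite add0r /trig big_filter; congr complex.Re; apply: eq_bigr => a /andP[/eqP ak a0].
rewrite /m addr0 divfK.
  by rewrite idotE dotZr.
rewrite mulf_eq0 fmorph_eq0 intr_eq0 negb_or eq_complex /= eqxx oner_eq0 /=.
by apply: contra a0 => /eqP /indep -> .
Qed.

End Gradient.

(** * Critical points of periodic functions *)

Section TwoZeros.
Variables (R : realType) (f f' : R -> R).
Hypothesis df : forall x : R, is_derive x 1 f (f' x).
Hypothesis pf : forall x, f (x + 2 * pi) = f x.

Let near_period (x t : R) : 0 <= x < 2 * pi -> t \in `]x - 1, x + 1[ ->
  exists2 t', t' \in `[0, 2 * pi] & f t' = f t.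
Proof.
move=> /andP[x0 x1]; rewrite in_itv /= => /andP[t0 t1].
have p1 := pi_ge2 R.
have [tn|tn] := ltP t 0.
  by exists (t + 2 * pi); rewrite ?pf // in_itv /=; apply/andP; split; lra.
have [tp|tp] := leP t (2 * pi); first by exists t; rewrite // in_itv /= tn.
exists (t - 2 * pi); last by rewrite -pf subrK.
by rewrite in_itv /=; apply/andP; split; lra.
Qed.

Lemma periodic_max x : 0 <= x < 2 * pi ->
  (forall t, t \in `[0, 2 * pi] -> f t <= f x) -> f' x = 0.
Proof.
move=> hx hmax; have [_ <-] := df x.
have [] // := @derive1_at_max R f (x - 1) (x + 1) x _ _ _ _.
- by rewrite lerBlDr -addrA lerDl.
- by rewrite in_itv /= ltrBlDr !ltrDl ltr01.
- by move=> t /(near_period hx)[t' /hmax ht <-].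
Qed.

Lemma periodic_min x : 0 <= x < 2 * pi ->
  (forall t, t \in `[0, 2 * pi] -> f x <= f t) -> f' x = 0.
Proof.
move=> hx hmin; have [_ <-] := df x.
have [] // := @derive1_at_min R f (x - 1) (x + 1) x _ _ _ _.
- by rewrite lerBlDr -addrA lerDl.
- by rewrite in_itv /= ltrBlDr !ltrDl ltr01.
- by move=> t /(near_period hx)[t' /hmin ht <-].
Qed.

(** The maximum and the minimum over a period are global extrema. If they are
    attained at the same point the function is constant, and 0 and pi do. *)
Lemma periodic_two_critical : exists x y : R,
  [/\ 0 <= x, x < y, y < 2 * pi, f' x = 0 & f' y = 0].
Proof.
have p0 := period_gt0 R; have p1 := pi_gt0 R.
have cf : continuous f.
  by move=> x; apply/differentiable_continuous/derivable1_diffP; have [] := df x.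
have red c : c \in `[0, 2 * pi] -> exists2 c', 0 <= c' < 2 * pi & f c' = f c.
  rewrite in_itv /= => /andP[c0]; rewrite le_eqVlt => /predU1P[->|c1].
    by exists 0; rewrite ?lexx // -[in RHS](add0r (2 * pi)) pf.
  by exists c; rewrite ?c0.
have [c0 /red[c hc cE] cmax] := EVT_max (ltW p0) (continuous_subspaceT cf).
have [d0 /red[d hd dE] dmin] := EVT_min (ltW p0) (continuous_subspaceT cf).
have {cE}cmax t : t \in `[0, 2 * pi] -> f t <= f c by rewrite cE; exact: cmax.
have {dE}dmin t : t \in `[0, 2 * pi] -> f d <= f t by rewrite dE; exact: dmin.
have fc := periodic_max hc cmax; have fd := periodic_min hd dmin.
case: (ltgtP c d) => [cd|dc|cd].
- by exists c, d; split=> //; [case/andP: hc|case/andP: hd].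
- by exists d, c; split=> //; [case/andP: hd|case/andP: hc].
have fE t : t \in `[0, 2 * pi] -> f t = f c.
  by move=> ht; apply/eqP; rewrite eq_le cmax //= cd dmin.
have z x : 0 <= x < 2 * pi -> f' x = 0.
  move=> hx; apply: periodic_max => // t ht; rewrite !fE // in_itv /=.
  by case/andP: hx => -> /ltW.
exists 0, pi; split=> //; first by rewrite ltr_pMl // ltr1n.
  by apply: z; rewrite lexx.
by apply: z; rewrite (ltW p1) ltr_pMl // ltr1n.
Qed.

End TwoZeros.

(** * Extension of embedded trigonometric polynomials *)

Section TrigPolyExtension.
Variable R : realType.
Local Notation C := (complex R).
Variables (L D : nat) (K : 'M[int]_(L, D)) (kap : R).

Lemma tp_trig_poly p d (G : 'rV[R]_D -> 'rV[R]_p) :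
  (forall j, exists M, tp (1%:M : 'M[int]_D) 0 d M (fun x => (G x 0 j)%:C%C)) -> trig_poly d G.
Proof.
have pull1 (l : 'rV[int]_D) : pull (1%:M : 'M[int]_D) l = l by rewrite /pull trmx1 mulmx1.
move=> hG; have /choice [s hs] : forall j, exists s : seq (C * 'rV[int]_D),
    (fun x => (G x 0 j)%:C%C) =1 teval 1%:M s /\ all (fun x => l1norm x.2 <= d)%N s.
  by move=> j; have [M [s [sE sd _]]] := hG j; exists s.
exists (fun l => \row_j \sum_(x <- s j | x.2 == l) x.1) => theta.
apply/rowP => j; have [sE sd] := hs j.
rewrite mxE sE fsbig_l1ball summxE /teval.
under [RHS]eq_bigr do rewrite !mxE mulr_sumr big_mkcond.
rewrite exchange_big /= big_seq [RHS]big_seq; apply: eq_bigr => x xs.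
have xb : x.2 \in l1ball D d by rewrite mem_l1ball (allP sd).
rewrite (bigD1_seq x.2) ?l1ball_uniq //= eqxx big1 => [|l /negPf lx].
  by rewrite addr0 mulrC /emon pull1.
by rewrite eq_sym lx.
Qed.

(** The real part is taken because the extension of a function that is real on the
    embedded torus need not be real elsewhere. *)
Lemma vtp_trig_poly d M (f : 'rV[R]_L -> 'rV[R]_D) : vtp K kap d M f ->
  exists2 G : 'rV[R]_D -> 'rV[R]_D, trig_poly d G & forall t, f t = G (embed K t).
Proof.
move=> hf; have /choice [s hs] : forall j, exists s : seq (C * 'rV[int]_D),
    (fun t => (f t 0 j)%:C%C) =1 teval K s /\ all (fun x => l1norm x.2 <= d)%N s.
  by move=> j; have [s [sE sd _]] := hf j; exists s.
exists (fun x => \row_j complex.Re (teval 1%:M (s j) x)).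
  apply: tp_trig_poly => j; exists (tnorm 1%:M 0 (s j)).
  apply: tp_ext (tp_Re (lexx 0) (_ : tp _ _ _ _ (teval 1%:M (s j)))) => [x|].
    by rewrite mxE.
  by exists (s j); split=> //; have [] := hs j.
move=> t; apply/rowP => j; have [sE _] := hs j.
rewrite mxE -[LHS]/(complex.Re ((f t 0 j)%:C%C : C)) sE; congr complex.Re.
rewrite /teval; apply: eq_bigr => x _; congr (_ * expi _).
by rewrite -!dot_embed; congr dot; rewrite {2}/embed map_mx1 mulmx1.
Qed.

End TrigPolyExtension.

(** * Formal solutions with averages on a line *)

Section Solutions.
Variable R : realType.
Local Notation C := (complex R).
Local Notation normc := ComplexField.Normc.normc.
Variables (L D : nat) (K : 'M[int]_(L, D)).
Variables (J : nat) (va : seq ('rV[C]_D * 'rV[int]_D)).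
Hypothesis vaJ : all (fun a => l1norm a.2 <= J)%N va.
Variables (gamma : R) (omega : 'rV[R]_L) (kp : 'rV[R]_D) (beta : R).
Variable Vp : 'rV[R]_D -> 'rV[R]_D.
Hypothesis VpE : forall x j, (Vp x 0 j)%:C%C =
  \sum_(a <- va) a.1 0 j * expi (dot (intv R a.2) x) :> C.
Hypothesis div0 : forall m : 'rV[int]_L, m != 0 -> divisor omega m != 0.
Hypothesis kp_embed : dot (embed K omega) kp = 0.
Hypothesis solv0 : dot (mean (fun t => Vp (embed K t + beta *: kp))) kp = 0.
Hypothesis nondeg : kp = 0 \/ dot (mean (hess K va kp beta kp)) kp != 0.
Variables (rho : R) (r : nat).
Hypothesis rho0 : 0 <= rho.
Let kap : R := rho + r%:R.
Let kap0 : 0 <= kap. Proof. by rewrite addr_ge0. Qed.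

(** The normalization common to both problems: averages on the line R kp, with
    the value beta at order 0, and mu orthogonal to kp. *)
Definition averaged_solution (s : series_pair R L D) : Prop :=
  [/\ formal_solution rho r (resid K gamma omega Vp) s,
      forall n, exists2 a, mean (s.1 n) = a *: kp & (n = 0%N -> a = beta) &
      forall n, dot (s.2 n) kp = 0].

Definition series_of (h : nat -> ('rV[R]_L -> 'rV[R]_D) * 'rV[R]_D) : series_pair R L D :=
  (fun n => (h n).1, fun n => (h n).2).

Lemma vcontinuousP (f : 'rV[R]_L -> 'rV[R]_D) : continuous f <-> vcontinuous f.
Proof.
split=> [cf j|cf]; last by apply: continuous_mx => i j; rewrite (ord1 i); exact: cf.
exact: (continuous_o cf (@coord_continuous _ _ _ 0 j)).
Qed.

Let solution h : (forall n, order_ok K kap J va gamma omega kp beta h n) ->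
  averaged_solution (series_of h).
Proof.
move=> hok; split; last 2 first.
- by move=> n; have [] := hok n.
- by move=> n; have [] := hok n.
split=> [n|N].
  split; last exact: g_periodic hok n.
  by apply/vcontinuousP; exact: (@g_continuous _ _ _ _ _ _ _ _ _ _ _ _ hok).
have [C0 C00 hC0] := resid_bound kap0 vaJ nondeg VpE hok N.
exists (2 * D%:R * C0 + 1); first by rewrite ltr_wpDl // !mulr_ge0 // ltW.
near=> e.
have e1 : `|e| <= 1 by near: e; apply/nbhs_ballP; exists 1 => //= x; rewrite /ball /= sub0r normrN => /ltW.
have cr : vcontinuous (resid K gamma omega Vp e
    (psum (series_of h).1 N e) (pmu (series_of h).2 N e)).
  apply: (resid_continuous VpE); apply: psum_continuous => n.
  exact: (@g_continuous _ _ _ _ _ _ _ _ _ _ _ _ hok).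
apply: le_trans (wien_rho_r_norm cr (hC0 e e1)) _.
rewrite lee_fin mulrA ler_wpM2r ?exprn_ge0 //.
by rewrite lerDl.
Unshelve. all: by end_near. Qed.

Let residual_fourier s : averaged_solution s -> forall N, exists C1 : R,
  \forall e \near (0 : R), forall j l, normc (cfourier (fun t =>
    (resid K gamma omega Vp e (psum s.1 N e) (pmu s.2 N e) t 0 j)%:C%C) l) <= C1 * `|e| ^+ N.+1.
Proof.
move=> [[sc sres] _ _] N; have [C1 C10 hC1] := sres N; exists C1.
near=> e; move=> j l; apply: (fourier_sqr_le_norm rho0).
- apply: (resid_continuous VpE); apply: psum_continuous => k.
  exact: (vcontinuousP _).1 (sc k).1.
- by near: e; exact: hC1.
- by rewrite mulr_ge0 ?exprn_ge0 // ltW.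
Unshelve. all: by end_near. Qed.

Let unique h s : (forall n, order_ok K kap J va gamma omega kp beta h n) ->
  averaged_solution s -> s = series_of h.
Proof.
move=> hok hs; have [[sc sres] smean smu] := hs.
have H := expansion_unique kap0 vaJ div0 nondeg VpE hok
  (fun n => (vcontinuousP _).1 (sc n).1) (fun n => (sc n).2) (residual_fourier hs) smean smu.
case: s {sc sres smean smu hs} H => s1 s2 H.
by rewrite /series_of; congr pair; apply/funext => n; have [h1 h2] := H n => //; exact/funext.
Qed.

Theorem averaged_solution_unique :
  exists h, [/\ forall n, order_ok K kap J va gamma omega kp beta h n,
    averaged_solution (series_of h) & forall s, averaged_solution s -> s = series_of h].
Proof.
have [|h hok] := formal_expansion kap0 vaJ gamma div0 kp_embed _ nondeg.
  rewrite -[RHS]solv0; congr (dot (mean _) kp); apply/funext => t; apply/rowP => j.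
  by rewrite mxE -[RHS]/(complex.Re ((Vp (embed K t + beta *: kp) 0 j)%:C%C : C)) VpE.
by exists h; split=> // [|s]; [exact: solution|exact: unique].
Qed.

Lemma absz_sum (I : Type) (q : seq I) (F : I -> int) :
  (absz (\sum_(i <- q) F i)%R <= \sum_(i <- q) absz (F i))%N.
Proof. by elim/big_rec2: _ => // i y x _ h; lia. Qed.

Lemma l1norm_pull (l : 'rV[int]_D) :
  (l1norm (pull K l) <= (\sum_i \sum_j absz (K i j)) * l1norm l)%N.
Proof.
rewrite /l1norm big_distrl /=; apply: leq_sum => i _.
rewrite mxE; apply: leq_trans (absz_sum _ _) _; rewrite big_distrl /=.
apply: leq_sum => j _; rewrite abszM mxE mulnC leq_mul2l (bigD1 j) //=.
by rewrite leq_addr orbT.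
Qed.

(** Pulled back frequencies are bounded by a multiple of n J, so the divisor bound
    becomes a power of n. The exponent is e + 1 because sigma has to be
    positive while e may be 0. *)
Theorem averaged_solution_gevrey s : diophantine_multiple omega ->
  averaged_solution s -> gevrey rho r s.
Proof.
move=> hdio; have [h [hok hsol huniq]] := averaged_solution_unique => /huniq -> {s}.
have [Bd Bd0 [e hBd]] := diophantine_divisor hdio.
pose kK := (\sum_i \sum_j absz (K i j))%N.
have hdiv n (l : 'rV[int]_D) : (0 < n)%N -> (l1norm l <= n * J)%N -> pull K l != 0 ->
    `|divisor omega (pull K l)|^-1 <= Bd * (kK * J)%:R ^+ e * n%:R ^+ e.
  move=> n0 lJ l0; apply: le_trans (hBd _ l0) _.
  rewrite -mulrA -exprMn -natrM ler_wpM2l // lerXn2r ?nnegrE // ler_nat.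
  by apply: leq_trans (l1norm_pull l) _; rewrite -/kK -mulnA leq_mul2l mulnC lJ orbT.
have Bd0' : 0 <= Bd * (kK * J)%:R ^+ e by rewrite mulr_ge0 ?exprn_ge0.
have [A [B [A0 B0 hAB]]] := expansion_gevrey kap0 vaJ div0 nondeg hok Bd0' hdiv.
exists ((2 * D%:R + 1) * A), B, e.+1%:R; split=> //.
  by rewrite mulr_gt0 // ltr_wpDl // mulr_ge0.
move=> n; have [h1 h2] := hAB n.
pose w := A * B ^+ n * n`!%:R ^+ e.
have w0 : 0 <= w by rewrite !mulr_ge0 ?exprn_ge0 // ltW.
have le_w : (2 * D%:R + 1) * w <= (2 * D%:R + 1) * A * B ^+ n * n`!%:R `^ e.+1%:R.
  rewrite powR_mulrn // /w !mulrA ler_wpM2l //.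
    by rewrite !mulr_ge0 ?exprn_ge0 ?addr_ge0 ?mulr_ge0 // ltW.
  by rewrite ler_weXn2l // ler1n fact_gt0.
split.
  have cg : vcontinuous ((series_of h).1 n) by exact: (@g_continuous _ _ _ _ _ _ _ _ _ _ _ _ hok).
  apply: le_trans (wien_rho_r_norm cg (vwien_tp h1)) _.
  by rewrite lee_fin; apply: le_trans le_w; rewrite ler_wpM2r // lerDl.
apply: le_trans le_w; apply: (@le_trans _ _ (D%:R * w)); last first.
  by rewrite ler_wpM2r // mulr_natl mulr2n -addrA lerDl addr_ge0.
have Dw0 : 0 <= D%:R * w by exact: mulr_ge0.
rewrite /enorm -(ger0_norm Dw0) -sqrtr_sqr ler_wsqrtr // exprMn [D%:R ^+ 2]expr2 -natrM /dot.
apply: (@le_trans _ _ (\sum_(j < D) w ^+ 2)).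
  apply: ler_sum => j _; rewrite -expr2 -[leLHS]real_normK ?num_real //.
  by rewrite lerXn2r ?nnegrE // h2.
rewrite sumr_const card_ord -[leLHS]mulr_natl ler_wpM2r ?exprn_ge0 // ler_nat.
by case: (D) => // d; rewrite leq_pmull.
Qed.

Lemma mean_torus_int (f : 'rV[R]_L -> 'rV[R]_D) j :
  mean f 0 j = (2 * pi) ^- L * torus_int (fun t => f t 0 j).
Proof.
rewrite mxE /cmean /cfourier ReZr /=; congr (_ * torus_int _); apply/funext => t.
by rewrite intv0 dot0l oppr0 cos0 mulr1 mul0r subr0.
Qed.

Lemma dot_mean (f : 'rV[R]_L -> 'rV[R]_D) v : vcontinuous f ->
  dot (mean f) v = (2 * pi) ^- L * torus_int (fun t => dot (f t) v).
Proof.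
move=> cf; rewrite /dot; under eq_bigr do rewrite mean_torus_int.
have cs (q : seq 'I_D) : continuous (fun t => \sum_(j <- q) f t 0 j * v 0 j).
  apply: continuous_fct_sum => j; apply: continuous_fctM; first exact: cf.
  exact: continuous_fct_cst.
elim: (index_enum _) => [|j q IH].
  by under [X in torus_int X]eq_fun do rewrite big_nil; rewrite big_nil torus_int_cst !mulr0.
rewrite big_cons IH; under [X in _ = _ * torus_int X]eq_fun do rewrite big_cons mulrC.
rewrite torus_intD; [|by apply: continuous_fctM => //; exact: continuous_fct_cst|exact: cs].
by rewrite (torus_intZ _ (cf j)); ring.
Qed.

End Solutions.

(** * Maximal and lower dimensional tori *)

Section Final.
Variable R : realType.
Local Notation C := (complex R).

Lemma trig_poly_seq D p J (f : 'rV[R]_D -> 'rV[R]_p) : trig_poly J f ->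
  exists va : seq ('rV[C]_p * 'rV[int]_D), all (fun a => l1norm a.2 <= J)%N va /\
    forall x j, (f x 0 j)%:C%C = \sum_(a <- va) a.1 0 j * expi (dot (intv R a.2) x).
Proof.
move=> [a fa]; exists [seq (a l, l) | l <- l1ball D J]; split.
  by apply/allP => x /mapP[l lb ->] /=; rewrite -mem_l1ball.
move=> x j; have /rowP/(_ j) := fa x; rewrite mxE => ->.
rewrite fsbig_l1ball summxE big_map; apply: eq_bigr => l _.
by rewrite mxE mulrC.
Qed.

Lemma dot_eq0 n (x : 'rV[R]_n) : dot x x = 0 -> x = 0.
Proof.
move=> /eqP; rewrite /dot psumr_eq0; last by move=> i _; rewrite -expr2 sqr_ge0.
move=> /allP h; apply/rowP => i; rewrite mxE.
by have := h i (mem_index_enum i); rewrite mulf_eq0 orbb => /eqP.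
Qed.

Lemma orthogonal_basis2 (k q v : 'rV[R]_2) : k != 0 -> q != 0 -> dot k q = 0 ->
  dot v k = 0 -> dot v q = 0 -> v = 0.
Proof.
move=> k0 q0 kq vk vq; apply: dot_eq0; apply/eqP; apply: contraTT isT => vv.
have kk : dot k k != 0 by apply: contra k0 => /eqP/dot_eq0 ->.
have qq : dot q q != 0 by apply: contra q0 => /eqP/dot_eq0 ->.
move: kq vk vq vv kk qq; rewrite /dot !big_ord_recl !big_ord0 !addr0.
set k1 := k 0 _; set k2 := k 0 _; set q1 := q 0 _; set q2 := q 0 _.
set v1 := v 0 _; set v2 := v 0 _ => kq vk vq vv kk qq.
have : (v1 * v1 + v2 * v2) * ((k1 * k1 + k2 * k2) * (q1 * q1 + q2 * q2)) = 0.
  have d0 : v1 * (k1 * q2 - k2 * q1) = 0.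
    rewrite (_ : _ * _ = (v1 * k1 + v2 * k2) * q2 - (v1 * q1 + v2 * q2) * k2); last by ring.
    by rewrite vk vq !mul0r subrr.
  have d1 : v2 * (k1 * q2 - k2 * q1) = 0.
    rewrite (_ : _ * _ = (v1 * q1 + v2 * q2) * k1 - (v1 * k1 + v2 * k2) * q1); last by ring.
    by rewrite vk vq !mul0r subrr.
  rewrite (_ : (k1 * k1 + _) * _ = (k1 * q2 - k2 * q1) ^+ 2 + (k1 * q1 + k2 * q2) ^+ 2); last by ring.
  rewrite kq expr0n addr0 expr2 mulrDl.
  rewrite (_ : v1 * v1 * _ = (v1 * (k1 * q2 - k2 * q1)) ^+ 2); last by ring.
  rewrite (_ : v2 * v2 * _ = (v2 * (k1 * q2 - k2 * q1)) ^+ 2); last by ring.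
  by rewrite d0 d1 expr0n addr0.
by move/eqP; rewrite !mulf_eq0 (negPf vv) (negPf kk) (negPf qq).
Qed.

Lemma intv_eq0 n (l : 'rV[int]_n) : intv R l = 0 -> l = 0.
Proof.
move=> /rowP h; apply/rowP => i; have := h i; rewrite !mxE => /eqP.
by rewrite intr_eq0 => /eqP.
Qed.

Lemma intv_neq0 n (l : 'rV[int]_n) : l != 0 -> intv R l != 0.
Proof. by apply: contra => /eqP/intv_eq0 ->. Qed.

Lemma torus_int1 (phi : R -> R) : torus_int (fun t : 'rV[R]_1 => phi (t 0 0)) =
  \int[@lebesgue_measure R]_(x in `[0, 2 * pi]) phi x.
Proof.
rewrite torus_intS; congr Rintegral; apply/funext => x /=.
by rewrite -[RHS](congr1 phi (rcons_torus0 x (0 : 'rV[R]_0))).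
Qed.

Section Maximal.
Variables (D : nat) (V : 'rV[R]_D -> R) (gamma : R) (omega : 'rV[R]_D) (rho : R) (r : nat).

Lemma embed1 (t : 'rV[R]_D) : embed 1%:M t = t.
Proof. by rewrite /embed map_mx1 mulmx1. Qed.

Lemma residual_maxE : residual_max V gamma omega = resid 1%:M gamma omega (grad V).
Proof.
apply/funext => e; apply/funext => u; apply/funext => m; apply/funext => t.
by rewrite /resid !embed1.
Qed.

Lemma max_solutionP s : max_solution V gamma omega rho r s <->
  averaged_solution 1%:M gamma omega 0 0 (grad V) rho r s.
Proof.
have T0 : (2 * pi) ^- D != 0 :> R by rewrite invr_eq0 period_neq0.
rewrite /max_solution /averaged_solution residual_maxE; split=> [[fs s0]|[fs s0 _]].
  split=> // n; last exact: dot0r.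
  exists 0 => //; rewrite scaler0; apply/rowP => j.
  by rewrite mean_torus_int s0 mulr0 mxE.
split=> // n j; have [a + _] := s0 n; rewrite scaler0 => /rowP/(_ j).
by rewrite mean_torus_int mxE => /eqP; rewrite mulf_eq0 (negPf T0) => /eqP.
Qed.

End Maximal.

Section Lower.
Variables (V : 'rV[R]_2 -> R) (gamma : R) (omega : 'rV[R]_1) (k kperp : 'rV[int]_2).
Hypotheses (k0 : k != 0) (kperp0 : kperp != 0).
Hypothesis kkperp : dot (intv R k) (intv R kperp) = 0.
Local Notation q := (intv R kperp).

Lemma embed_row (t : 'rV[R]_1) : embed (k : 'M[int]_(1, 2)) t = t 0 0 *: intv R k.
Proof. by apply/rowP => j; rewrite !mxE big_ord1 !mxE. Qed.

Lemma lower_indep (l : 'rV[int]_2) : idot l k = 0 -> idot l kperp = 0 -> l = 0.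
Proof.
move=> /(congr1 (fun z : int => z%:~R : R)) lk /(congr1 (fun z : int => z%:~R : R)) lq.
apply: intv_eq0; apply: orthogonal_basis2 kkperp _ _; rewrite ?intv_neq0 //.
  by rewrite -idotE.
by rewrite -idotE.
Qed.

Lemma residual_lowE : residual_low V gamma omega (intv R k) =
  resid (k : 'M[int]_(1, 2)) gamma omega (grad V).
Proof.
apply/funext => e; apply/funext => u; apply/funext => m; apply/funext => t.
by rewrite /resid !embed_row.
Qed.

(** In the plane, a mean orthogonal to k is a multiple of k^perp; the normalization
    of g thus puts its averages on the line R k^perp. *)
Lemma orthogonal_multiple (v : 'rV[R]_2) : dot v (intv R k) = 0 ->
  v = (dot v q / dot q q) *: q.
Proof.
move=> vk; have qq : dot q q != 0.
  by apply: contra (intv_neq0 kperp0) => /eqP/dot_eq0 ->.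
apply/eqP; rewrite -subr_eq0; apply/eqP.
apply: orthogonal_basis2 kkperp _ _; rewrite ?intv_neq0 //.
  by rewrite dotDl dotNl dotZl vk [dot _ (intv R k)]dotC kkperp mulr0 subrr.
by rewrite dotDl dotNl dotZl divfK // subrr.
Qed.

Lemma low_solution_averaged beta rho r s :
  low_solution V gamma omega (intv R k) q beta rho r s ->
  averaged_solution (k : 'M[int]_(1, 2)) gamma omega q beta (grad V) rho r s.
Proof.
rewrite /low_solution residual_lowE => -[fs s0 sk smu]; split=> // n.
exists (dot (mean (s.1 n)) q / dot q q) => [|n0].
  apply: orthogonal_multiple; rewrite dot_mean ?sk ?mulr0 //.
  by apply/vcontinuousP; have [h _] := fs; have [] := h n.
rewrite {}n0 (_ : s.1 0%N = fun=> beta *: q); last exact/funext.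
rewrite mean_cst dotZl mulfK //.
by apply: contra (intv_neq0 kperp0) => /eqP/dot_eq0 ->.
Qed.

Variables (J : nat) (va : seq ('rV[C]_2 * 'rV[int]_2)).
Hypothesis vaJ : all (fun a => l1norm a.2 <= J)%N va.
Hypothesis VE : forall x j, (grad V x 0 j)%:C%C =
  \sum_(a <- va) a.1 0 j * expi (dot (intv R a.2) x) :> C.
Variable beta : R.

Lemma lower_solvable : beta_condition V (intv R k) q beta ->
  dot (mean (fun t => grad V (embed (k : 'M[int]_(1, 2)) t + beta *: q))) q = 0.
Proof.
move=> hb; rewrite dot_mean.
  under [X in torus_int X]eq_fun do rewrite dotC embed_row.
  by rewrite (torus_int1 (fun x => dot q (grad V (x *: intv R k + beta *: q)))) hb mulr0.
apply: (Vp_continuous VE); apply: vcontinuousD; last exact: vcontinuous_cst.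
exact: embed_continuous.
Qed.

Lemma lower_nondegenerate : beta_nondegenerate V (intv R k) q beta ->
  dot (mean (hess (k : 'M[int]_(1, 2)) va q beta q)) q != 0.
Proof.
apply: contra; rewrite dot_mean; last exact: (hess_continuous (lexx 0) vaJ).
rewrite mulf_eq0 invr_eq0 (negPf (period_neq0 R 1)) orFb => /eqP h.
rewrite -(torus_int1 (fun x =>
  (q *m hessian V (x *: intv R k + beta *: q) *m q^T) 0 0)) -[X in _ == X]h.
apply/eqP; congr torus_int; apply/funext => t /=.
rewrite (hessian_form VE) [RHS]/dot.
transitivity (complex.Re (\sum_j (q 0 j)%:C%C * hessc (k : 'M[int]_(1, 2)) va q beta q j t : C)); last first.
  rewrite Re_sum; apply: eq_bigr => j _.
  by rewrite ReZr [hess _ _ _ _ _ _ 0 j]mxE mulrC.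
congr complex.Re; rewrite /hessc; under [RHS]eq_bigr do rewrite mulr_sumr.
rewrite exchange_big; apply: eq_bigr => a _ /=.
rewrite -mulrA /dotc mulr_suml; apply: eq_bigr => j _.
by rewrite /phase embed_row; ring.
Qed.

End Lower.

End Final.

Theorem theorem17 (R : realType) :
  (* maximal dimensional tori *)
  (forall (D J : nat) (V : 'rV[R]_D -> R) (gamma : R) (omega : 'rV[R]_D),
     torus_periodic V ->
     (forall x, differentiable V x) ->
     trig_poly J (grad V) ->
     gamma != 0 ->
     (irrational_multiple omega ->
        forall (rho : R) (r : nat), 0 <= rho ->
          (exists! s : series_pair R D D, max_solution V gamma omega rho r s) /\
          (forall s : series_pair R D D, max_solution V gamma omega rho r s ->
             forall n : nat, trig_poly (n * J) (s.1 n))) /\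
     (diophantine_multiple omega ->
        forall (rho : R) (r : nat), 1 <= rho -> (D < 2 * r)%N ->
          forall s : series_pair R D D, max_solution V gamma omega rho r s ->
            gevrey rho r s)) /\
  (* lower dimensional tori, D = 2 and L = 1; gamma may be zero or not *)
  (forall (J : nat) (V : 'rV[R]_2 -> R) (k kperp : 'rV[int]_2),
     torus_periodic V ->
     (forall x, differentiable V x) ->
     trig_poly J (grad V) ->
     k != 0 -> kperp != 0 -> dot (intv R k) (intv R kperp) = 0 ->
     (exists beta1 beta2 : R,
        [/\ 0 <= beta1, beta1 < beta2, beta2 < 2 * pi,
            beta_condition V (intv R k) (intv R kperp) beta1 &
            beta_condition V (intv R k) (intv R kperp) beta2]) /\
     (forall (gamma : R) (omega : 'rV[R]_1) (beta0 : R),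
        0 <= beta0 < 2 * pi ->
        beta_condition V (intv R k) (intv R kperp) beta0 ->
        beta_nondegenerate V (intv R k) (intv R kperp) beta0 ->
        (irrational_multiple omega ->
           forall (rho : R) (r : nat), 0 <= rho ->
             (exists! s : series_pair R 1 2,
                low_solution V gamma omega (intv R k) (intv R kperp) beta0
                  rho r s) /\
             (forall s : series_pair R 1 2,
                low_solution V gamma omega (intv R k) (intv R kperp) beta0
                  rho r s ->
                forall n : nat, trig_poly_along (intv R k) (n * J) (s.1 n))) /\
        (diophantine_multiple omega ->
           forall (rho : R) (r : nat), 1 <= rho -> (1 < 2 * r)%N ->
             forall s : series_pair R 1 2,
               low_solution V gamma omega (intv R k) (intv R kperp) beta0
                 rho r s ->
               gevrey rho r s))).
Proof.
split.
- move=> D J V gamma omega pV dV tV gamma0.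
  have [va [vaJ VE]] := trig_poly_seq tV.
  have solv0 : dot (mean (fun t => grad V (embed 1%:M t + (0 : R) *: 0))) 0 = 0 by rewrite dot0r.
  have kp0 : dot (embed (1%:M : 'M[int]_D) omega) 0 = 0 by rewrite dot0r.
  split=> [irr rho r rho0|dio rho r rho1 _ s].
    have div0 (m : 'rV[int]_D) : m != 0 -> divisor omega m != 0 := divisor_neq0 irr.
    have [h [hok hs hu]] := averaged_solution_unique vaJ gamma VE div0 kp0 solv0 (or_introl erefl) r rho0.
    split.
      exists (series_of h); split; first exact/max_solutionP.
      by move=> s /max_solutionP/hu ->.
    move=> s /max_solutionP/hu -> n; have [_ [M hM] _ _ _] := hok n.
    have [G hG hE] := vtp_trig_poly hM.
    by rewrite /= (_ : (h n).1 = G) //; apply/funext => t; rewrite hE embed1.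
  move=> /max_solutionP hs.
  have rho0 : 0 <= rho by apply: le_trans rho1.
  have div0 (m : 'rV[int]_D) : m != 0 -> divisor omega m != 0 :=
    divisor_neq0 (diophantine_irrational dio).
  exact: (averaged_solution_gevrey vaJ VE div0 kp0 solv0 (or_introl erefl) rho0 dio hs).
move=> J V k kperp pV dV tV k0 kperp0 kkperp.
have [va [vaJ VE]] := trig_poly_seq tV.
have indep := lower_indep k0 kperp0 kkperp.
split.
  have [Psi [dPsi pPsi]] := beta_potential VE pV dV vaJ indep.
  have [x [y [x0 xy y1 fx fy]]] := periodic_two_critical dPsi pPsi.
  have T0 : (2 * pi)^-1 != 0 :> R by rewrite invr_eq0 gt_eqF ?period_gt0.
  exists x, y; split=> //; apply/eqP.
    by move/eqP: fx; rewrite mulf_eq0 (negPf T0).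
  by move/eqP: fy; rewrite mulf_eq0 (negPf T0).
move=> gamma omega beta0 _ hb hn.
have solv0 := lower_solvable VE hb.
have nondeg := lower_nondegenerate vaJ VE hn.
have kp0 : dot (embed (k : 'M[int]_(1, 2)) omega) (intv R kperp) = 0.
  by rewrite embed_row dotZl kkperp mulr0.
split=> [irr rho r rho0|dio rho r rho1 _ s].
  have div0 (m : 'rV[int]_1) : m != 0 -> divisor omega m != 0 := divisor_neq0 irr.
  have [h [hok hs hu]] := averaged_solution_unique vaJ gamma VE div0 kp0 solv0 (or_intror nondeg) r rho0.
  split.
    exists (series_of h); split; last by move=> s /(low_solution_averaged k0 kperp0 kkperp)/hu ->.
    have [fs smean smu] := hs.
    split; [rewrite residual_lowE; exact: fs|exact: (order0_cst hok)| |exact: smu].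
    move=> n; have [a ha _] := smean n.
    have := dot_mean (intv R k) ((vcontinuousP _).1 (proj1 (proj1 fs n))).
    rewrite ha dotZl [dot _ (intv R k)]dotC kkperp mulr0 => /esym/eqP.
    by rewrite mulf_eq0 invr_eq0 (negPf (period_neq0 R 1)) => /eqP.
  move=> s /(low_solution_averaged k0 kperp0 kkperp)/hu -> n.
  have [_ [M hM] _ _ _] := hok n.
  have [G hG hE] := vtp_trig_poly hM.
  by exists G => // t; rewrite -embed_row; exact: hE.
move=> /(low_solution_averaged k0 kperp0 kkperp) hs.
have rho0 : 0 <= rho by apply: le_trans rho1.
have div0 (m : 'rV[int]_1) : m != 0 -> divisor omega m != 0 :=
  divisor_neq0 (diophantine_irrational dio).
exact: (averaged_solution_gevrey vaJ VE div0 kp0 solv0 (or_intror nondeg) rho0 dio hs).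
Qed.
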